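(* Let $(\mathfrak g,K)$ be a reductive pair over a field $F$ of characteristic $0$ satisfying condition (Q), and let $X$ be an $F$-rational $(\mathfrak g,K)$-module. Then the following are equivalent: (i) $X$ is of finite length. (ii) For some extension $F'/F$, $X\otimes_FF'$ is of finite length. (iii) For every extension $F'/F$, $X\otimes_FF'$ is of finite length.
   Context: A pair $(\mathfrak a,B)$ over $F$ consists of a reductive linear algebraic group $B$ over $F$ (not necessarily connected; connected components assumed geometrically connected), a finite-dimensional Lie algebra $\mathfrak a$ over $F$, a monomorphism $\mathfrak b=\mathrm{Lie}(B)\to\mathfrak a$, and an action of $B$ on $\mathfrak a$ whose differential is the action of $\mathfrak b$ on $\mathfrak a$. An $(\mathfrak a,B)$-module over $F$ is a locally finite rational $B$-module over $F$ with a $B$-equivariant action of $\mathfrak a$ whose restriction to $\mathfrak b$ is the derivative of the $B$-action. Base change to $F'$ is extension of scalars of both the pair and the module, and finite length is meant in the category of modules for the (base changed) pair. A pair $(\mathfrak g,K)$ is reductive if $\mathfrak g$ is reductive, $\mathfrak k=\mathrm{Lie}(K)$ is the space of fixed points of an $F$-linear involution $\theta$ of $\mathfrak g$, and a non-degenerate bilinear form on $\mathfrak g$, invariant under the adjoint actions of $\mathfrak g$ and $K$, is given. Condition (Q): there is a finite subgroup $K_0\subseteq K$ such that $K_0\to\pi_0(K\otimes_F\overline F)$ is surjective, $\overline F$ an algebraic closure of $F$. *)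

(* Defs.v *)
From HB Require Import structures.
From mathcomp Require Import all_boot all_order all_algebra.
From mathcomp Require Import boolp.
From mathcomp Require Import mpoly.

Set Implicit Arguments.
Unset Strict Implicit.
Unset Printing Implicit Defensive.

Import GRing.Theory.
Local Open Scope ring_scope.
Local Open Scope quotient_scope.

(* Conventions.  A commutative F-algebra is a commutative ring R together with
   a ring morphism phi : F -> R; in particular a field extension F'/F is a ring
   morphism iota : F -> F' between fields, an F'-algebra (R, phi) is regarded
   as an F-algebra by composing with iota, and a morphism of F-algebras
   (R, phi) -> (S, psi) is a ring morphism h with h \o phi =1 psi. *)

Section Tensor.
Variables (F : fieldType) (R : comNzRingType) (phi : {rmorphism F -> R}).
Variable V : lmodType F.

Record balanced (W : zmodType) (b : V -> R -> W) : Prop := Balanced {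
  balancedDl : forall v v' r, b (v + v') r = b v r + b v' r;
  balancedDr : forall v r r', b v (r + r') = b v r + b v r';
  balancedZ : forall a v r, b (a *: v) r = b v (phi a * r) }.

Definition tsum (W : zmodType) (b : V -> R -> W) (s : seq (V * R)) : W :=
  \sum_(p <- s) b p.1 p.2.

(* A list [:: (v1, r1); ...] stands for v1 (x) r1 + ...; two lists are equal
   in the tensor product iff no balanced map can distinguish them. *)
Definition teq (s t : seq (V * R)) : bool :=
  `[< forall (W : zmodType) (b : V -> R -> W),
        balanced b -> tsum b s = tsum b t >].

Lemma teq_refl : reflexive teq.
Proof. by move=> s; apply/asboolP. Qed.

Lemma teq_sym : ssrbool.symmetric teq.
Proof.
by move=> s t; apply/asboolP/asboolP => st W b bP; rewrite (st W b bP).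
Qed.

Lemma teq_trans : transitive teq.
Proof.
move=> t s u /asboolP st /asboolP tu; apply/asboolP => W b bP.
by rewrite (st W b bP) (tu W b bP).
Qed.

Canonical teq_equiv := EquivRel teq teq_refl teq_sym teq_trans.

Definition tens := {eq_quot teq_equiv}.

HB.instance Definition _ := Choice.on tens.

Definition tmk (s : seq (V * R)) : tens := \pi s.

Definition pure (v : V) (r : R) : tens := tmk [:: (v, r)].

(* The additive map v (x) r |-> b v r; only meaningful when b is balanced. *)
Definition tlift (W : zmodType) (b : V -> R -> W) (t : tens) : W :=
  tsum b (repr t).

Lemma tlift_mk (W : zmodType) (b : V -> R -> W) s :
  balanced b -> tlift b (tmk s) = tsum b s.
Proof.
move=> bP; have : repr (tmk s) = s %[mod {eq_quot teq_equiv}] by rewrite reprK.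
by move=> /eqmodP /asboolP; apply.
Qed.

Lemma tens_ext (x y : tens) :
  (forall (W : zmodType) (b : V -> R -> W),
      balanced b -> tlift b x = tlift b y) -> x = y.
Proof.
move=> xy; rewrite -[x]reprK -[y]reprK; apply/eqmodP/asboolP => W b bP.
exact: xy.
Qed.

Definition tadd (x y : tens) : tens := tmk (repr x ++ repr y).
Definition topp (x : tens) : tens := tmk [seq (- p.1, p.2) | p <- repr x].
Definition tscale (c : R) (x : tens) : tens :=
  tmk [seq (p.1, c * p.2) | p <- repr x].

Section Lift.
Variables (W : zmodType) (b : V -> R -> W) (bP : balanced b).

Lemma balanced0l r : b 0 r = 0.
Proof. by apply: (addrI (b 0 r)); rewrite -(balancedDl bP) !addr0. Qed.

Lemma balancedNl v r : b (- v) r = - b v r.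
Proof.
by apply: (addrI (b v r)); rewrite -(balancedDl bP) !subrr balanced0l.
Qed.

Lemma balanced_scale c : balanced (fun v r => b v (c * r)).
Proof.
split=> [v v' r|v r r'|a v r]; first exact: (balancedDl bP).
  by rewrite mulrDr (balancedDr bP).
by rewrite (balancedZ bP) mulrCA.
Qed.

Lemma tlift_add x y : tlift b (tadd x y) = tlift b x + tlift b y.
Proof. by rewrite tlift_mk // /tsum big_cat. Qed.

Lemma tlift_opp x : tlift b (topp x) = - tlift b x.
Proof.
rewrite tlift_mk // /tsum big_map -sumrN.
by apply: eq_bigr => p _; rewrite balancedNl.
Qed.

Lemma tlift_scale c x : tlift b (tscale c x) = tlift (fun v r => b v (c * r)) x.
Proof. by rewrite tlift_mk // /tsum big_map. Qed.

Lemma tlift_nil : tlift b (tmk [::]) = 0.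
Proof. by rewrite tlift_mk // /tsum big_nil. Qed.

End Lift.

Lemma taddA : associative tadd.
Proof. by move=> x y z; apply: tens_ext => W b bP; rewrite !tlift_add ?addrA. Qed.

Lemma taddC : commutative tadd.
Proof. by move=> x y; apply: tens_ext => W b bP; rewrite !tlift_add 1?addrC. Qed.

Lemma tadd0 : left_id (tmk [::]) tadd.
Proof.
by move=> x; apply: tens_ext => W b bP; rewrite tlift_add ?tlift_nil ?add0r.
Qed.

Lemma taddN : left_inverse (tmk [::]) topp tadd.
Proof.
move=> x; apply: tens_ext => W b bP.
by rewrite tlift_add ?tlift_opp ?tlift_nil ?addNr.
Qed.

HB.instance Definition _ := GRing.isZmodule.Build tens taddA taddC tadd0 taddN.

Lemma tscaleA a b x : tscale a (tscale b x) = tscale (a * b) x.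
Proof.
apply: tens_ext => W c cP; rewrite !tlift_scale //; last exact: balanced_scale.
by rewrite /tlift /tsum; apply: eq_bigr => p _; rewrite mulrA.
Qed.

Lemma tscale1 : left_id 1 tscale.
Proof.
move=> x; apply: tens_ext => W c cP; rewrite tlift_scale //.
by rewrite /tlift /tsum; apply: eq_bigr => p _; rewrite mul1r.
Qed.

Lemma tscaleDr : right_distributive tscale +%R.
Proof.
move=> a x y; apply: tens_ext => W c cP.
by rewrite !(tlift_scale, tlift_add) //; apply: balanced_scale.
Qed.

Lemma tscaleDl x : {morph tscale^~ x : a b / a + b}.
Proof.
move=> a b; apply: tens_ext => W c cP; rewrite !(tlift_scale, tlift_add) //.
rewrite /tlift /tsum -big_split.
by apply: eq_bigr => p _; rewrite mulrDl (balancedDr cP).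
Qed.

HB.instance Definition _ :=
  GRing.Zmodule_isLmodule.Build R tens tscaleA tscale1 tscaleDr tscaleDl.

Lemma tliftD (W : zmodType) (b : V -> R -> W) x y :
  balanced b -> tlift b (x + y) = tlift b x + tlift b y.
Proof. by move=> bP; apply: tlift_add. Qed.

Lemma tliftZ (W : zmodType) (b : V -> R -> W) c x :
  balanced b -> tlift b (c *: x) = tlift (fun v r => b v (c * r)) x.
Proof. by move=> bP; apply: tlift_scale. Qed.

Lemma tlift_pure (W : zmodType) (b : V -> R -> W) v r :
  balanced b -> tlift b (pure v r) = b v r.
Proof. by move=> bP; rewrite tlift_mk // /tsum big_seq1. Qed.

Lemma pure_balanced : balanced pure.
Proof.
split=> [v v' r|v r r'|a v r]; apply: tens_ext => W b bP.
- by rewrite tliftD // !tlift_pure // (balancedDl bP).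
- by rewrite tliftD // !tlift_pure // (balancedDr bP).
- by rewrite !tlift_pure // (balancedZ bP).
Qed.

Lemma scale_pure c v r : c *: pure v r = pure v (c * r).
Proof.
apply: tens_ext => W b bP; rewrite tliftZ // !tlift_pure //.
exact: balanced_scale.
Qed.

Lemma tens_sum (x : tens) : x = \sum_(p <- repr x) pure p.1 p.2.
Proof.
rewrite -{1}[x]reprK; move: (repr x) => s; rewrite -[LHS]/(tmk s).
apply: tens_ext => W b bP; elim: s => [|p s IH].
  by rewrite big_nil -[0]/(tmk [::]).
rewrite big_cons tliftD // -IH tlift_pure // !tlift_mk //.
by rewrite /tsum big_cons.
Qed.

End Tensor.

Section TensorMaps.
Variable F : fieldType.

(* The R-linear extension V (x) R -> W of an F-linear map V -> W. *)
Definition linext (R : comNzRingType) (phi : {rmorphism F -> R})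
    (V : lmodType F) (W : lmodType R) (f : V -> W) : tens phi V -> W :=
  tlift (fun v r => r *: f v).

(* The map id (x) h : V (x) R -> V (x) S of a morphism h of F-algebras. *)
Definition tpush (R S : comNzRingType) (phi : {rmorphism F -> R})
    (psi : {rmorphism F -> S}) (V : lmodType F) (h : R -> S) :
    tens phi V -> tens psi V :=
  tlift (fun v r => pure psi v (h r)).

(* The R-bilinear extension of an F-bilinear map. *)
Definition bilext (R : comNzRingType) (phi : {rmorphism F -> R})
    (U V W : lmodType F) (b : U -> V -> W) (x : tens phi U) (y : tens phi V) :
    tens phi W :=
  tlift (fun u r => tlift (fun v s => pure phi (b u v) (r * s)) y) x.

(* The same for a scalar valued bilinear form. *)
Definition formext (R : comNzRingType) (phi : {rmorphism F -> R})
    (U : lmodType F) (b : U -> U -> F) (x y : tens phi U) : R :=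
  tlift (fun u r => tlift (fun v s => phi (b u v) * (r * s)) y) x.

(* For an F'-algebra R, the canonical map
   V (x)_F R -> (V (x)_F F') (x)_{F'} R, v (x) r |-> (v (x) 1) (x) r. *)
Definition tassoc (F' : fieldType) (iota : {rmorphism F -> F'})
    (R : comNzRingType) (phi : {rmorphism F' -> R}) (V : lmodType F) :
    tens (phi \o iota : {rmorphism F -> R}) V -> tens phi (tens iota V) :=
  tlift (fun v r => pure phi (pure iota v 1) r).

(* The image of S (x) R in V (x) R, for a subset S of V. *)
Definition extset (R : comNzRingType) (phi : {rmorphism F -> R})
    (V : lmodType F) (S : V -> Prop) (t : tens phi V) : Prop :=
  exists s : seq (V * R),
    (forall p, p \in s -> S p.1) /\ t = \sum_(p <- s) pure phi p.1 p.2.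

Definition subspace (V : lmodType F) (S : V -> Prop) : Prop :=
  S 0 /\ forall (a : F) x y, S x -> S y -> S (a *: x + y).

Definition lspan (V : lmodType F) (s : seq V) (v : V) : Prop :=
  exists c : 'I_(size s) -> F, v = \sum_i c i *: s`_i.

Definition bilin (U V W : lmodType F) (b : U -> V -> W) : Prop :=
  (forall v, linear (b^~ v)) /\ (forall u, linear (b u)).

End TensorMaps.

(* A closed subscheme of GL_n over F, given by polynomial equations in the
   matrix entries. *)
Record gl_scheme (F : fieldType) := GLScheme {
  gdim : nat;
  geqs : {mpoly F[gdim * gdim]} -> Prop }.

Definition mxeval (F : fieldType) (R : comNzRingType) (phi : {rmorphism F -> R})
    (n : nat) (p : {mpoly F[n * n]}) (g : 'M[R]_n) : R :=
  mmap phi (fun k => mxvec g 0 k) p.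

Definition points (F : fieldType) (G : gl_scheme F) (R : comNzRingType)
    (phi : {rmorphism F -> R}) (g : 'M[R]_(gdim G)) : Prop :=
  (exists h, g *m h = 1%:M) /\ (forall p, geqs p -> mxeval phi p g = 0).

Arguments points {F} G {R} phi g.

Definition is_alg_group (F : fieldType) (G : gl_scheme F) : Prop :=
  forall (R : comNzRingType) (phi : {rmorphism F -> R}),
    [/\ points G phi 1%:M,
        forall g h, points G phi g -> points G phi h -> points G phi (g *m h)
      & forall g h, points G phi g -> g *m h = 1%:M -> points G phi h].

Definition gl_base_change (F F' : fieldType) (iota : {rmorphism F -> F'})
    (G : gl_scheme F) : gl_scheme F' :=
  {| gdim := gdim G;
     geqs := fun q => exists p, geqs p /\ q = map_mpoly iota p |}.

(* Dual numbers R[eps] = R[X]/(X^2) and the Lie algebra of G: the matrices A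
   such that 1 + eps A is a point of G. *)
Definition dual (R : comNzRingType) : comNzRingType := {poly %/ ('X^2 : {poly R})}.

Definition dualC (R : comNzRingType) : {rmorphism R -> dual R} :=
  qpolyC ('X^2 : {poly R}).

Definition deps (R : comNzRingType) : dual R := qpolyX ('X^2 : {poly R}).

Definition one_eps (R : comNzRingType) (n : nat) (A : 'M[R]_n) : 'M[dual R]_n :=
  1%:M + deps R *: map_mx (dualC R) A.

Definition in_lie (F : fieldType) (G : gl_scheme F) (A : 'M[F]_(gdim G)) : Prop :=
  points G (dualC F) (one_eps A).

Arguments in_lie {F} G A.

Section Zariski.
Variables (k L : fieldType) (phi : {rmorphism k -> L}) (n : nat).

(* Subsets of 'M[L]_n defined by polynomials over k.  When L is an algebraic
   closure of k, the k-Zariski topology on G(L) models the topological space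
   of the scheme G, whereas the L-Zariski topology (phi := idfun) models that
   of G (x) L. *)
Definition zclosed (Z : 'M[L]_n -> Prop) : Prop :=
  exists S : {mpoly k[n * n]} -> Prop,
    forall g, Z g <-> (forall p, S p -> mxeval phi p g = 0).

Definition zconnected (Z : 'M[L]_n -> Prop) : Prop :=
  (exists g, Z g) /\
  forall A B, zclosed A -> zclosed B ->
    (forall g, Z g -> A g \/ B g) -> (forall g, Z g -> ~ (A g /\ B g)) ->
    (forall g, Z g -> A g) \/ (forall g, Z g -> B g).

Definition zcomponent (Y Z : 'M[L]_n -> Prop) : Prop :=
  [/\ forall g, Z g -> Y g, zconnected Z
    & forall Z', zconnected Z' -> (forall g, Z' g -> Y g) ->
        (forall g, Z g -> Z' g) -> forall g, Z' g -> Z g].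

End Zariski.

Section GeometricProperties.
Variables (F : fieldType) (Fbar : closedFieldType).
Variables (iota : {rmorphism F -> Fbar}) (G : gl_scheme F).

Let GFbar : 'M[Fbar]_(gdim G) -> Prop := points G iota.

Definition geom_connected_components : Prop :=
  forall Z, zcomponent iota GFbar Z -> zconnected (idfun : {rmorphism Fbar -> Fbar}) Z.

(* U is closed in G(Fbar), i.e. the trace of a closed set of matrices. *)
Definition normal_connected_unipotent (U : 'M[Fbar]_(gdim G) -> Prop) : Prop :=
  [/\ exists2 Z, zclosed (idfun : {rmorphism Fbar -> Fbar}) Z
        & forall g, U g <-> GFbar g /\ Z g,
      zconnected (idfun : {rmorphism Fbar -> Fbar}) U,
      [/\ U 1%:M, forall g h, U g -> U h -> U (g *m h)
        & forall g, U g -> U (invmx g)],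
      forall g u, GFbar g -> U u -> U (g *m u *m invmx g)
    & forall u, U u -> exists m : nat, (u - 1%:M) ^+ m = 0].

(* The unipotent radical of G (x) Fbar is trivial. *)
Definition group_reductive : Prop :=
  forall U, normal_connected_unipotent U -> forall u, U u -> u = 1%:M.

(* The finite subgroup K0 is an algebraic subgroup over F; this includes the
   finite groups of F-rational points. *)
Definition condition_Q : Prop :=
  exists eqs : {mpoly F[gdim G * gdim G]} -> Prop,
    let K0 := GLScheme eqs in
    [/\ is_alg_group K0,
        forall (R : comNzRingType) (phi : {rmorphism F -> R}) g,
          points K0 phi g -> points G phi g,
        exists s : seq 'M[Fbar]_(gdim G),
          forall g, points K0 iota g -> g \in s
      & forall Z, zcomponent (idfun : {rmorphism Fbar -> Fbar}) GFbar Z ->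
          exists2 g, points K0 iota g & Z g].

End GeometricProperties.

(* A rational action of G on V is a natural family of R-linear actions of G(R)
   on V (x) R.  By R-linearity it is determined by the maps
   v |-> g (v (x) 1); values at matrices that are not points are irrelevant. *)
Definition fun_action (F : fieldType) (n : nat) (V : lmodType F) :=
  forall (R : comNzRingType) (phi : {rmorphism F -> R}), 'M[R]_n -> V -> tens phi V.

Section Representations.
Variables (F : fieldType) (G : gl_scheme F) (V : lmodType F).
Variable act : fun_action (gdim G) V.

Record rational_action : Prop := RationalAction {
  ract_linear : forall (R : comNzRingType) (phi : {rmorphism F -> R}) g,
    points G phi g ->
    forall a x y, act phi g (a *: x + y) = phi a *: act phi g x + act phi g y;
  ract_1 : forall (R : comNzRingType) (phi : {rmorphism F -> R}) x,
    act phi 1%:M x = pure phi x 1;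
  ract_M : forall (R : comNzRingType) (phi : {rmorphism F -> R}) g h,
    points G phi g -> points G phi h ->
    forall x, act phi (g *m h) x = linext (act phi g) (act phi h x);
  ract_natural : forall (R S : comNzRingType) (phi : {rmorphism F -> R})
    (psi : {rmorphism F -> S}) (h : {rmorphism R -> S}),
    h \o phi =1 psi -> forall g, points G phi g ->
    forall x, act psi (map_mx h g) x = tpush psi h (act phi g x) }.

Definition group_stable (S : V -> Prop) : Prop :=
  forall (R : comNzRingType) (phi : {rmorphism F -> R}) g, points G phi g ->
    forall x, S x -> extset S (act phi g x).

Definition locally_finite : Prop :=
  forall x, exists s : seq V, lspan s x /\ group_stable (lspan s).

(* The differential of the action at A in Lie(G) is x |-> d x, i.e.
   (1 + eps A) x = x + eps (d x). *)
Definition has_differential (A : 'M[F]_(gdim G)) (d : V -> V) : Prop :=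
  forall x, act (dualC F) (one_eps A) x
            = pure (dualC F) x 1 + pure (dualC F) (d x) (deps F).

End Representations.

Arguments rational_action {F} G {V} act.
Arguments group_stable {F} G {V} act S.
Arguments locally_finite {F} G {V} act.
Arguments has_differential {F} G {V} act A d.

Definition act_base_change (F F' : fieldType) (iota : {rmorphism F -> F'})
    (n : nat) (V : lmodType F) (act : fun_action n V) :
    fun_action n (tens iota V) :=
  fun R phi g =>
    tlift (fun v c => phi c *: tassoc (act R (phi \o iota : {rmorphism F -> R}) g v)).

(* The morphism Lie(K) -> g is encoded by a linear map on all of 'M_n, of which
   only the restriction to the subspace Lie(K) matters. *)
Record pair (F : fieldType) := Pair {
  pgrp : gl_scheme F;
  plie : lmodType F;
  pbr : plie -> plie -> plie;
  pemb : 'M[F]_(gdim pgrp) -> plie;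
  pAd : fun_action (gdim pgrp) plie }.

Arguments pbr {F} P : rename.
Arguments pemb {F} P : rename.
Arguments pAd {F} P {R} phi : rename.

Definition is_lie_bracket (F : fieldType) (g : lmodType F) (br : g -> g -> g) : Prop :=
  [/\ bilin br, forall x, br x x = 0
    & forall x y z, br x (br y z) + br y (br z x) + br z (br x y) = 0].

Record is_pair (F : fieldType) (Fbar : closedFieldType)
    (iota : {rmorphism F -> Fbar}) (P : pair F) : Prop := IsPair {
  pair_group : is_alg_group (pgrp P);
  pair_group_reductive : group_reductive iota (pgrp P);
  pair_group_components : geom_connected_components iota (pgrp P);
  pair_bracket : is_lie_bracket (pbr P);
  pair_finite_dim : exists s : seq (plie P), forall x, lspan s x;
  pair_emb_linear : linear (pemb P);
  pair_emb_inj : forall A, in_lie (pgrp P) A -> pemb P A = 0 -> A = 0;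
  pair_emb_br : forall A B, in_lie (pgrp P) A -> in_lie (pgrp P) B ->
    pemb P (A *m B - B *m A) = pbr P (pemb P A) (pemb P B);
  pair_Ad : rational_action (pgrp P) (@pAd F P);
  pair_Ad_br : forall (R : comNzRingType) (phi : {rmorphism F -> R}) g,
    points (pgrp P) phi g ->
    forall x y, pAd P phi g (pbr P x y) = bilext (pbr P) (pAd P phi g x) (pAd P phi g y);
  pair_differential : forall A, in_lie (pgrp P) A ->
    has_differential (pgrp P) (@pAd F P) A (pbr P (pemb P A)) }.

Record gkmod (F : fieldType) (P : pair F) := GKMod {
  mcarrier : lmodType F;
  mgrp : fun_action (gdim (pgrp P)) mcarrier;
  mlie : plie P -> mcarrier -> mcarrier }.

Arguments mgrp {F P} X {R} phi : rename.
Arguments mlie {F P} X : rename.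

Record is_gkmod (F : fieldType) (P : pair F) (X : gkmod P) : Prop := IsGKMod {
  gkmod_rational : rational_action (pgrp P) (@mgrp F P X);
  gkmod_locally_finite : locally_finite (pgrp P) (@mgrp F P X);
  gkmod_bilin : bilin (mlie X);
  gkmod_br : forall u v x,
    mlie X (pbr P u v) x = mlie X u (mlie X v x) - mlie X v (mlie X u x);
  gkmod_equivariant : forall (R : comNzRingType) (phi : {rmorphism F -> R}) g,
    points (pgrp P) phi g ->
    forall u x, mgrp X phi g (mlie X u x)
                = bilext (mlie X) (pAd P phi g u) (mgrp X phi g x);
  gkmod_differential : forall A, in_lie (pgrp P) A ->
    has_differential (pgrp P) (@mgrp F P X) A (mlie X (pemb P A)) }.

Definition pair_base_change (F F' : fieldType) (iota : {rmorphism F -> F'})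
    (P : pair F) : pair F' :=
  @Pair F' (gl_base_change iota (pgrp P)) (tens iota (plie P))
    (bilext (pbr P))
    (fun A => \sum_i \sum_j pure iota (pemb P (delta_mx i j)) (A i j))
    (act_base_change (@pAd F P)).

Definition gkmod_base_change (F F' : fieldType) (iota : {rmorphism F -> F'})
    (P : pair F) (X : gkmod P) : gkmod (pair_base_change iota P) :=
  @GKMod F' (pair_base_change iota P) (tens iota (mcarrier X))
    (act_base_change (@mgrp F P X))
    (bilext (mlie X)).

Section FiniteLength.
Variables (F : fieldType) (P : pair F) (X : gkmod P).

Definition submodule (S : mcarrier X -> Prop) : Prop :=
  [/\ subspace S, forall u x, S x -> S (mlie X u x)
    & group_stable (pgrp P) (@mgrp F P X) S].

(* S is a submodule of T with simple quotient T / S. *)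
Definition simple_step (S T : mcarrier X -> Prop) : Prop :=
  [/\ forall x, S x -> T x, exists2 x, T x & ~ S x
    & forall D, submodule D -> (forall x, S x -> D x) -> (forall x, D x -> T x) ->
        (forall x, D x -> S x) \/ (forall x, T x -> D x)].

Definition finite_length : Prop :=
  exists (m : nat) (C : nat -> mcarrier X -> Prop),
    [/\ forall i, (i <= m)%N -> submodule (C i),
        forall x, C 0%N x <-> x = 0,
        forall x, C m x
      & forall i, (i < m)%N -> simple_step (C i) (C i.+1)].

End FiniteLength.

Definition is_ideal (F : fieldType) (g : lmodType F) (br : g -> g -> g)
    (S : g -> Prop) : Prop :=
  subspace S /\ forall x y, S y -> S (br x y).

(* The adjoint representation is semisimple. *)
Definition lie_reductive (F : fieldType) (g : lmodType F) (br : g -> g -> g) : Prop :=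
  forall S, is_ideal br S -> exists T,
    [/\ is_ideal br T, forall x, exists y z, [/\ S y, T z & x = y + z]
      & forall x, S x -> T x -> x = 0].

Record is_reductive_pair (F : fieldType) (Fbar : closedFieldType)
    (iota : {rmorphism F -> Fbar}) (P : pair F) : Prop := IsReductivePair {
  reductive_is_pair : is_pair iota P;
  reductive_lie : lie_reductive (pbr P);
  reductive_involution : exists theta : plie P -> plie P,
    [/\ linear theta, involutive theta,
        forall x y, theta (pbr P x y) = pbr P (theta x) (theta y)
      & forall x, theta x = x <-> (exists2 A, in_lie (pgrp P) A & x = pemb P A)];
  reductive_form : exists B : plie P -> plie P -> F^o,
    [/\ bilin B,
        (forall x, (forall y, B x y = 0) -> x = 0) /\
        (forall y, (forall x, B x y = 0) -> y = 0),
        forall x y z, B (pbr P x y) z + B y (pbr P x z) = 0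
      & forall (R : comNzRingType) (phi : {rmorphism F -> R}) g,
        points (pgrp P) phi g ->
        forall x y, formext B (pAd P phi g x) (pAd P phi g y) = phi (B x y)] }.

(* Main.v *)
Require Import Defs.
From HB Require Import structures.
From mathcomp Require Import all_boot all_order all_algebra.
From mathcomp Require Import separable boolp mpoly.
From mathcomp Require classical_sets.

Set Implicit Arguments.
Unset Strict Implicit.
Unset Printing Implicit Defensive.

Import GRing.Theory.
Local Open Scope ring_scope.

(** Only (i) => (iii) has substance; a submodule N of X is recovered from
    N (x) F' by contracting with a functional on F', so the length of X (x) F'
    bounds that of X.

    Everything is phrased with operators.  The action of a point g of G(R)
    gives the operators x |-> (id (x) mu)(g (x (x) 1)) for the F-linear
    functionals mu on R, and a subspace is a submodule exactly when it is stable
    under these operators and under the Lie algebra ([submoduleE]).  Submodules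
    of X (x) F' are stable under the same operators extended to F', as one sees
    from the image of g in G(R (x) F') ([submodule_tstable]).  Finite length is
    equivalent to the existence of a strictly monotone rank on submodules, and
    ranks add up along a composition series, so X may be replaced by a simple
    subquotient V ([step_rank], [extension_rank]).

    By local finiteness and equivariance, V is finitely generated over the Lie
    algebra g alone ([fin_gen_lie]).  Let D be the division ring of
    endomorphisms of V.  Every stable subspace N of V (x) F' is generated by its
    intersection with (D x) (x) F', for any x != 0 in V ([tstable_generated]),
    so it suffices that D has finite dimension over F ([endo_finite]).  This has
    three ingredients.

    - Elements of D are algebraic over F, by Quillen's lemma
      ([endo_algebraic]): generic flatness of finitely generated modules over
      U(g)[t] excludes that V is divisible over F[t] with t acting by a
      transcendental endomorphism.  Generic flatness is proved with leading
      terms: V is spanned by the ordered monomials in a basis of g applied to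
      generators, and the leading terms where torsion occurs have finitely many
      minimal elements by Dickson's lemma.

    - A maximal subfield L of D is finite over F
      ([field_of_endomorphisms_simple]).  The same leading term argument shows
      that V (x) L satisfies the ascending chain condition.  Apply it to the
      images of z (x) 1 - 1 (x) z, for z in L: a maximal one comes from a z with
      L = F(z), because by the primitive element theorem any two elements of L
      lie in a common F(w).

    - A division algebra with a maximal subfield of finite dimension has finite
      dimension ([finite_over_center]), by Artin's argument on the independence
      of the maps y |-> y d on L. *)

(** * Linear maps, subspaces and functionals *)

Section LinearMaps.
Variables (R : pzRingType) (U V : lmodType R) (f : U -> V).
Hypothesis fL : linear f.

Lemma linD x y : f (x + y) = f x + f y.
Proof. by rewrite -[x]scale1r fL !scale1r. Qed.

Lemma lin0 : f 0 = 0.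
Proof. by apply: (addrI (f 0)); rewrite -linD !addr0. Qed.

Lemma linZ a x : f (a *: x) = a *: f x.
Proof. by rewrite -[a *: x]addr0 fL lin0 addr0. Qed.

Lemma linN x : f (- x) = - f x.
Proof. by rewrite -scaleN1r linZ scaleN1r. Qed.

Lemma linB x y : f (x - y) = f x - f y.
Proof. by rewrite linD linN. Qed.

Lemma lin_sum I (r : seq I) (P : pred I) (E : I -> U) :
  f (\sum_(i <- r | P i) E i) = \sum_(i <- r | P i) f (E i).
Proof. exact: (big_morph f linD lin0). Qed.

End LinearMaps.

Section Subspaces.
Variables (F : fieldType) (V : lmodType F) (S : V -> Prop).
Hypothesis subS : subspace S.

Lemma sub0 : S 0. Proof. by case: subS. Qed.

Lemma subZ a x : S x -> S (a *: x).
Proof. by move=> Sx; rewrite -[a *: x]addr0; apply: subS.2 => //; apply: sub0. Qed.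

Lemma subD x y : S x -> S y -> S (x + y).
Proof. by move=> Sx; rewrite -[x]scale1r; apply: subS.2. Qed.

Lemma subN x : S x -> S (- x).
Proof. by rewrite -scaleN1r; apply: subZ. Qed.

Lemma subB x y : S x -> S y -> S (x - y).
Proof. by move=> Sx Sy; apply: subD => //; apply: subN. Qed.

Lemma sub_sum I (r : seq I) (P : pred I) (E : I -> V) :
  (forall i, P i -> S (E i)) -> S (\sum_(i <- r | P i) E i).
Proof. by move=> SE; apply: big_ind => //; [apply: sub0|apply: subD]. Qed.

End Subspaces.

Definition fspan (F : fieldType) (V : lmodType F) n (e : 'I_n -> V) (x : V) :=
  exists c : 'I_n -> F, x = \sum_i c i *: e i.

Lemma fspan_subspace (F : fieldType) (V : lmodType F) n (e : 'I_n -> V) :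
  subspace (fspan e).
Proof.
split=> [|a x y [c ->] [d ->]].
  by exists (fun=> 0); rewrite big1 // => i _; rewrite scale0r.
exists (fun i => a * c i + d i); rewrite scaler_sumr -big_split /=.
by apply: eq_bigr => i _; rewrite scalerDl scalerA.
Qed.

Lemma fspan_mem (F : fieldType) (V : lmodType F) n (e : 'I_n -> V) i :
  fspan e (e i).
Proof.
exists (fun j => (j == i)%:R); rewrite (bigD1 i) //= eqxx scale1r big1 ?addr0 //.
by move=> j /negbTE ->; rewrite scale0r.
Qed.

(** A maximal subspace that contains S and avoids v is a hyperplane, on which
    the required functional vanishes; the dimension may be infinite. *)
Lemma functional_separation (F : fieldType) (V : lmodType F) (S : V -> Prop) v :
  subspace S -> ~ S v -> exists mu : V -> F^o,
    [/\ linear mu, forall x, S x -> mu x = 0 & mu v = 1].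
Proof.
move=> subS Sv.
pose good (H : V -> Prop) := subspace (fun x => S x \/ H x) /\ ~ H v.
have [|A [[subW Av] Amax]] := @classical_sets.Zorn_bigcup V good.
  move=> Fam goodF totF; split; last by move=> [X FX]; apply: (goodF X FX).2.
  split=> [|a x y]; first by left; apply: sub0.
  have inX X : Fam X -> S (a *: x + y) \/ X (a *: x + y) ->
      S (a *: x + y) \/ classical_sets.bigcup Fam id (a *: x + y).
    by move=> FX [|Xz]; [left|right; exists X].
  case=> [Sx|[X FX Xx]] [Sy|[Y FY Yy]]; first by left; apply: subS.2.
  - by apply: (inX Y) => //; apply: (goodF Y FY).1.2; [left|right].
  - by apply: (inX X) => //; apply: (goodF X FX).1.2; [right|left].
  have [XY|YX] := totF _ _ FX FY.
    by apply: (inX Y) => //; apply: (goodF Y FY).1.2; right => //; apply: XY.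
  by apply: (inX X) => //; apply: (goodF X FX).1.2; right => //; apply: YX.
pose W x := S x \/ A x; have Wv : ~ W v by case.
have ex_c x : exists c : F, W (x - c *: v).
  apply: contrapT => noc.
  pose A' z := exists c : F, W (z - c *: x).
  apply: (Amax A').
    split=> [z Az|]; first by exists 0; rewrite scale0r subr0; right.
    move=> /(_ x) A'A; apply: noc; exists 0; rewrite scale0r subr0; right.
    by apply: A'A; exists 1; rewrite scale1r subrr; apply: sub0.
  split.
    have SA' z : S z \/ A' z -> A' z.
      by case=> // Sz; exists 0; rewrite scale0r subr0; left.
    split=> [|a y z /SA'[c Wc] /SA'[d Wd]].
      by right; exists 0; rewrite scale0r subr0; apply: sub0.
    right; exists (a * c + d); rewrite scalerDl -scalerA opprD addrACA -scalerBr.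
    exact: subW.2.
  move=> [c Wc]; have [c0|c0] := eqVneq c 0.
    by apply: Wv; move: Wc; rewrite c0 scale0r subr0.
  apply: noc; exists c^-1; suff -> : x - c^-1 *: v = - c^-1 *: (v - c *: x).
    exact: (subZ subW).
  by rewrite scalerBr scalerA mulNr mulVf // scaleN1r opprK addrC scaleNr.
have [mu muP] := choice ex_c.
have mu_uniq x c : W (x - c *: v) -> mu x = c.
  move=> Wc; apply/eqP; rewrite -subr_eq0; apply: contrapT => /negP nz.
  apply: Wv; rewrite -[v](scalerK nz); apply: (subZ subW).
  suff -> : (mu x - c) *: v = (x - c *: v) - (x - mu x *: v).
    exact: (subB subW Wc (muP x)).
  by rewrite scalerBl opprB [RHS]addrC addrA subrK.
exists mu; split=> [a x y|x Sx|]; apply: mu_uniq.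
- have -> : (a *: (mu x : F^o) + (mu y : F^o) : F) = a * mu x + mu y by [].
  by rewrite scalerDl -scalerA opprD addrACA -scalerBr; exact: (subW.2 _ _ _ (muP x) (muP y)).
- by rewrite scale0r subr0; left.
- by rewrite scale1r subrr; apply: sub0.
Qed.

(** * Scalar extensions *)

(** A copy of R, so that scaling by F through phi does not compete with the
    module structures that R already has. *)
Definition alg_space (F : fieldType) (R : comNzRingType)
  (phi : {rmorphism F -> R}) : Type := R.

Section AlgSpace.
Variables (F : fieldType) (R : comNzRingType) (phi : {rmorphism F -> R}).
HB.instance Definition _ := GRing.Zmodule.on (alg_space phi).

Fact alg_scaleA a b (x : alg_space phi) :
  phi a * (phi b * x) = phi (a * b) * x.
Proof. by rewrite mulrA rmorphM. Qed.
Fact alg_scale1 : left_id 1 (fun a (x : alg_space phi) => phi a * x : alg_space phi).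
Proof. by move=> x; rewrite rmorph1 mul1r. Qed.
Fact alg_scaleDr :
  right_distributive (fun a (x : alg_space phi) => phi a * x : alg_space phi) +%R.
Proof. by move=> a x y; apply: mulrDr. Qed.
Fact alg_scaleDl (x : alg_space phi) :
  {morph (fun a => phi a * x : alg_space phi) : a b / a + b}.
Proof. by move=> a b; rewrite rmorphD mulrDl. Qed.
HB.instance Definition _ := GRing.Zmodule_isLmodule.Build F (alg_space phi)
  alg_scaleA alg_scale1 alg_scaleDr alg_scaleDl.

Lemma alg_scaleE a (x : alg_space phi) : a *: x = phi a * (x : R).
Proof. by []. Qed.

End AlgSpace.

Section TensLemmas.
Variables (F : fieldType) (R : comNzRingType) (phi : {rmorphism F -> R}).
Variable V : lmodType F.
Implicit Types (S T : V -> Prop) (t : tens phi V).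

Lemma tens_ind (P : tens phi V -> Prop) :
  (forall v r, P (pure phi v r)) -> (forall x y, P x -> P y -> P (x + y)) ->
  forall x, P x.
Proof.
move=> Ppure PD x; rewrite [x]tens_sum; apply: big_ind => //.
suff -> : 0 = pure phi (0 : V) 0 by [].
apply: (addrI (pure phi 0 0)).
by rewrite -(balancedDl (pure_balanced phi V)) !addr0.
Qed.

Lemma pureDl v w r : pure phi (v + w : V) r = pure phi v r + pure phi w r.
Proof. exact: (balancedDl (pure_balanced phi V)). Qed.

Lemma pureDr (v : V) r s : pure phi v (r + s) = pure phi v r + pure phi v s.
Proof. exact: (balancedDr (pure_balanced phi V)). Qed.

Lemma pureZ a (v : V) r : pure phi (a *: v) r = pure phi v (phi a * r).
Proof. exact: (balancedZ (pure_balanced phi V)). Qed.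

Lemma pure0 r : pure phi (0 : V) r = 0.
Proof. exact: (balanced0l (pure_balanced phi V)). Qed.

Lemma pureBl v w r : pure phi (v - w : V) r = pure phi v r - pure phi w r.
Proof. by apply/(addIr (pure phi w r)); rewrite -pureDl !subrK. Qed.

Lemma pureBr (v : V) r s : pure phi v (r - s) = pure phi v r - pure phi v s.
Proof. by apply/(addIr (pure phi v s)); rewrite -pureDr !subrK. Qed.

Lemma pure_suml I (s : seq I) (P : pred I) (E : I -> V) r :
  pure phi (\sum_(i <- s | P i) E i) r = \sum_(i <- s | P i) pure phi (E i) r.
Proof. exact: (big_morph (fun v => pure phi v r) (fun v w => pureDl v w r) (pure0 r)). Qed.

Lemma pure_scale (v : V) r : pure phi v r = r *: pure phi v 1.
Proof. by rewrite scale_pure mulr1. Qed.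

Lemma tlift0 (W : zmodType) (b : V -> R -> W) : balanced phi b ->
  tlift b (0 : tens phi V) = 0.
Proof. by move=> bP; apply/(addrI (tlift b (0 : tens phi V)));
  rewrite -(tliftD 0 0 bP) !addr0. Qed.

Lemma tens_eq (W : zmodType) (f g : tens phi V -> W) :
  {morph f : x y / x + y} -> {morph g : x y / x + y} ->
  (forall v r, f (pure phi v r) = g (pure phi v r)) -> f =1 g.
Proof.
move=> fD gD fg; apply: tens_ind => // x y fgx fgy.
by rewrite fD gD fgx fgy.
Qed.

Lemma extset_sub S T t : (forall x, S x -> T x) -> extset S t -> extset T t.
Proof. by move=> ST [s [Ss ->]]; exists s; split=> // p /Ss /ST. Qed.

Lemma extset_pure S v r : S v -> extset S (pure phi v r).
Proof.
by move=> Sv; exists [:: (v, r)]; rewrite big_seq1; split=> // p /[!inE] /eqP ->.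
Qed.

Lemma extset0 S : extset S (0 : tens phi V).
Proof. by exists [::]; rewrite big_nil. Qed.

Lemma extsetD S x y : extset S x -> extset S y -> extset S (x + y : tens phi V).
Proof.
move=> [s [Ss ->]] [t [St ->]]; exists (s ++ t); rewrite big_cat; split=> // p.
by rewrite mem_cat => /orP[/Ss|/St].
Qed.

Lemma extsetZ S a x : extset S x -> extset S (a *: x : tens phi V).
Proof.
move=> [s [Ss ->]]; exists [seq (p.1, a * p.2) | p <- s]; split.
  by move=> p /mapP[q /Ss Sq ->].
by rewrite big_map scaler_sumr; apply: eq_bigr => p _; rewrite scale_pure.
Qed.

Lemma extset_ind S (P : tens phi V -> Prop) :
  P 0 -> (forall v r, S v -> P (pure phi v r)) ->
  (forall x y, P x -> P y -> P (x + y)) -> forall t, extset S t -> P t.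
Proof.
move=> P0 Pp PD t [s [Ss ->]]; elim: s Ss => [|p s IH] Ss.
  by rewrite big_nil.
rewrite big_cons; apply: PD; first by apply: Pp; apply: Ss; rewrite mem_head.
by apply: IH => q qs; apply: Ss; rewrite inE qs orbT.
Qed.

Definition contr (mu : alg_space phi -> F^o) : tens phi V -> V :=
  tlift (fun v r => (mu r : F) *: v).

Section Contraction.
Variable mu : alg_space phi -> F^o.
Hypothesis muL : linear mu.

Lemma contr_balanced : balanced phi (fun (v : V) r => (mu r : F) *: v).
Proof.
split=> [v w r|v r s|a v r]; first exact: scalerDr.
  by rewrite (linD muL) scalerDl.
by rewrite scalerA (linZ muL a (r : alg_space phi) : mu (phi a * r) = a * mu r) mulrC.
Qed.

Lemma contr_pure v r : contr mu (pure phi v r) = (mu r : F) *: v.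
Proof. by rewrite /contr tlift_pure //; apply: contr_balanced. Qed.

Lemma contrD : {morph contr mu : x y / x + y}.
Proof. by move=> x y; apply: tliftD; apply: contr_balanced. Qed.

Lemma contr0 : contr mu 0 = 0.
Proof. exact: tlift0 contr_balanced. Qed.

Lemma contrZ a x : contr mu (phi a *: x) = a *: contr mu x.
Proof.
move: x; apply: (@tens_eq _ (fun x => contr mu (phi a *: x))
  (fun x => a *: contr mu x)) => [x y|x y|v r].
- by rewrite scalerDr contrD.
- by rewrite contrD scalerDr.
rewrite scale_pure !contr_pure.
by rewrite (linZ muL a (r : alg_space phi) : mu (phi a * r) = a * mu r) scalerA.
Qed.

Lemma contr_extset S t : subspace S -> extset S t -> S (contr mu t).
Proof.
move=> subS; move: t.
apply: (@extset_ind S (fun t => S (contr mu t))) => [|v r Sv|x y Sx Sy].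
- by rewrite contr0; apply: sub0.
- by rewrite contr_pure; apply: subZ.
- by rewrite contrD; apply: subD.
Qed.

End Contraction.

(** Write t with as few pure tensors as possible: the second components are
    then independent, and contraction by a dual functional isolates each of
    the first components. *)
Lemma extsetP S t : subspace S ->
  (forall mu, linear mu -> S (contr mu t)) -> extset S t.
Proof.
move=> subS.
have [n [v [r ->]]] : exists n (v : 'I_n -> V) (r : 'I_n -> R),
    t = \sum_i pure phi (v i) (r i).
  rewrite [t]tens_sum; exists (size (repr t)).
  exists (fun i => (nth (0, 0) (repr t) i).1).
  by exists (fun i => (nth (0, 0) (repr t) i).2); rewrite (big_nth (0, 0)) big_mkord.
elim: n v r => [|n IH] v r St; first by rewrite big_ord0; apply: extset0.
pose r' i : alg_space phi := r (lift ord0 i).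
have [[c rc]|r0] := pselect (fspan r' (r ord0)).
  have E : \sum_i pure phi (v i) (r i)
      = \sum_i pure phi (v (lift ord0 i) + c i *: v ord0) (r (lift ord0 i)).
    rewrite big_ord_recl rc (big_morph (pure phi _) (pureDr _) (_ : _ = 0)); last first.
      by rewrite pure_scale scale0r.
    rewrite -big_split /=; apply: eq_bigr => i _.
    by rewrite pureDl pureZ addrC.
  by rewrite E; apply: IH => mu muL; rewrite -E; apply: St.
have [mu [muL mu0 mu1]] := functional_separation (fspan_subspace r') r0.
have Sv0 : S (v ord0).
  have := St mu muL; rewrite big_ord_recl contrD // contr_pure // mu1 scale1r.
  rewrite (big_morph (contr mu) (contrD muL) (contr0 muL)) big1 ?addr0 // => i _.
  rewrite contr_pure // mu0 ?scale0r //.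
  exact: (fspan_mem r').
rewrite big_ord_recl; apply: extsetD; first exact: extset_pure.
apply: IH => nu nuL; have := St nu nuL; rewrite big_ord_recl contrD // => Snu.
rewrite -[X in S X](addKr (contr nu (pure phi (v ord0) (r ord0)))) addrC.
by apply: subB => //; rewrite contr_pure //; apply: subZ.
Qed.

End TensLemmas.

Arguments contr {F R phi V} mu t.

Section TensorFunctor.
Variables (F : fieldType) (R : comNzRingType) (phi : {rmorphism F -> R}).

Definition tmap (V W : lmodType F) (f : V -> W) : tens phi V -> tens phi W :=
  tlift (fun v r => pure phi (f v) r).

Section One.
Variables (V W : lmodType F) (f : V -> W).
Hypothesis fL : linear f.

Lemma tmap_balanced : balanced phi (fun v r => pure phi (f v) r).
Proof.
split=> [v w r|v r s|a v r]; first by rewrite (linD fL) pureDl.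
  exact: pureDr.
by rewrite (linZ fL) pureZ.
Qed.

Lemma tmap_pure v r : tmap f (pure phi v r) = pure phi (f v) r.
Proof. by rewrite /tmap tlift_pure //; apply: tmap_balanced. Qed.

Lemma tmapD : {morph tmap f : x y / x + y}.
Proof. by move=> x y; apply: tliftD; apply: tmap_balanced. Qed.

Lemma tmap_linear : linear (tmap f).
Proof.
move=> a x y; rewrite tmapD; congr (_ + _); move: x {y}.
apply: (@tens_eq _ _ _ _ _ (fun x => tmap f (a *: x)) (fun x => a *: tmap f x)).
- by move=> x y; rewrite scalerDr tmapD.
- by move=> x y; rewrite tmapD scalerDr.
by move=> v r; rewrite scale_pure !tmap_pure scale_pure.
Qed.

Lemma tmap_extset (S : V -> Prop) (T : W -> Prop) x :
  (forall v, S v -> T (f v)) -> extset S x -> extset T (tmap f x).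
Proof.
move=> ST; move: x.
apply: (@extset_ind _ _ _ _ S (fun x => extset T (tmap f x))) => [|v r Sv|y z].
- by rewrite (lin0 tmap_linear); apply: extset0.
- by rewrite tmap_pure; apply: extset_pure; apply: ST.
by rewrite tmapD; apply: extsetD.
Qed.

End One.

Lemma tmap_comp (U V W : lmodType F) (f : V -> W) (g : U -> V) x :
  linear f -> linear g -> tmap f (tmap g x) = tmap (f \o g) x.
Proof.
move=> fL gL; have fgL : linear (f \o g) by move=> a u v /=; rewrite gL fL.
move: x; apply: tens_eq => [x y|x y|v r]; first by rewrite !tmapD.
  by rewrite tmapD.
by rewrite !tmap_pure.
Qed.

Lemma eq_tmap (V W : lmodType F) (f g : V -> W) x :
  f =1 g -> tmap f x = tmap g x.
Proof. by move=> /funext ->. Qed.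

End TensorFunctor.

(** * Rank functions and composition series *)

(** Finite length is handled through functions that measure submodules: a rank
    is monotone and separates a submodule from any larger one.  Unlike
    composition series, ranks can be pulled back and added up. *)
Definition is_rank (V : Type) (good : (V -> Prop) -> Prop)
    (r : (V -> Prop) -> nat) : Prop :=
  forall N N', good N -> good N' -> (forall x, N x -> N' x) ->
    (r N <= r N')%N /\ ((r N' <= r N)%N -> forall x, N' x -> N x).

Definition covers (V : Type) (good : (V -> Prop) -> Prop) (S T : V -> Prop) :=
  [/\ forall x, S x -> T x, exists2 x, T x & ~ S x
    & forall D, good D -> (forall x, S x -> D x) -> (forall x, D x -> T x) ->
        (forall x, D x -> S x) \/ (forall x, T x -> D x)].

Section Series.
Variables (V : zmodType) (good : (V -> Prop) -> Prop).

(** The first term above S is a submodule of T of least rank among those that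
    strictly contain S. *)
Lemma rank_series r S T : is_rank good r -> good S -> good T ->
  (forall x, S x -> T x) ->
  exists m (C : nat -> V -> Prop), [/\ C 0 = S, C m = T,
    forall i, (i <= m)%N -> good (C i)
    & forall i, (i < m)%N -> covers good (C i) (C i.+1)].
Proof.
move=> rP; have [k] := ubnP (r T - r S); elim: k S => // k IH S lek goodS goodT ST.
have [TS|/existsNP[x0 /not_implyP[Tx0 Sx0]]] := pselect (forall x, T x -> S x).
  exists 0%N, (fun=> S); split=> //.
  by apply: funext => x; apply: propext; split; [apply: ST|apply: TS].
pose between n := `[< exists D, [/\ good D, forall x, S x -> D x,
  forall x, D x -> T x, exists2 x, D x & ~ S x & r D = n] >].
have ex_n : exists n, between n.
  by exists (r T); apply/asboolP; exists T; split=> //; exists x0.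
case: (ex_minnP ex_n) => _ /asboolP[D [goodD SD DT [x1 Dx1 Sx1] <-]] Dmin.
have ltSD : (r S < r D)%N.
  have [_ SDr] := rP S D goodS goodD SD.
  by rewrite ltnNge; apply/negP => /SDr /(_ x1 Dx1).
have leDT : (r D <= r T)%N by case: (rP D T goodD goodT DT).
have [|m [C [C0 Cm goodC covC]]] := IH D _ goodD goodT DT.
  by rewrite ltnS in lek; apply: leq_trans lek; apply: ltn_sub2l => //; apply: leq_trans leDT.
exists m.+1, (fun i => if i is i'.+1 then C i' else S); split=> //.
  by case=> // i; apply: goodC.
case=> [_|i]; last exact: covC.
rewrite C0; split=> //; first by exists x1.
move=> D' goodD' SD' D'D.
have [D'S|/existsNP[x /not_implyP[D'x Sx]]] := pselect (forall x, D' x -> S x).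
  by left.
right; have [_] := rP D' D goodD' goodD D'D; apply.
by apply: Dmin; apply/asboolP; exists D'; split=> //; [move=> y /D'D /DT|exists x].
Qed.

Hypothesis good_meet : forall N N', good N -> good N' ->
  good (fun x => N x /\ N' x).
Hypothesis good_join : forall N N', good N -> good N' ->
  good (fun x => exists y z, [/\ N y, N' z & x = y + z]).
Hypothesis good0 : forall N, good N -> N 0.
Hypothesis goodB : forall N x y, good N -> N x -> N y -> N (x - y).

(** The rank of N counts the simple factors of the series that N reaches. *)
Lemma series_rank m (C : nat -> V -> Prop) :
  (forall x, C 0 x -> x = 0) -> (forall x, C m x) ->
  (forall i, (i <= m)%N -> good (C i)) ->
  (forall i, (i < m)%N -> covers good (C i) (C i.+1)) ->
  exists r, is_rank good r.
Proof.
move=> C0 Cm goodC covC.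
pose A N := [set i : 'I_m | `[< exists x, [/\ N x, C i.+1 x & ~ C i x] >]].
exists (fun N => #|A N|) => N N' goodN goodN' NN'.
have subA : A N \subset A N'.
  apply/subsetP => i /[!inE] /asboolP[x [Nx Cx nCx]].
  by apply/asboolP; exists x; split=> //; apply: NN'.
split=> [|leA x N'x]; first exact: subset_leq_card.
have eqA : A N = A N' by apply/eqP; rewrite eqEcard subA.
suff IH i : (i <= m)%N -> forall x, N' x -> C i x -> N x by apply: (IH m).
elim: i => [_ y _ /C0 ->|i IH ltim y N'y Cy]; first exact: good0.
have [Ciy|nCiy] := pselect (C i y); first by apply: IH => //; apply: ltnW.
have : Ordinal ltim \in A N.
  by rewrite eqA inE; apply/asboolP; exists y.
rewrite inE => /asboolP /= [z [Nz Cz nCz]].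
have [SC _ simC] := covC i ltim.
have goodCi := goodC i (ltnW ltim); have goodCi1 := goodC i.+1 ltim.
have addC u v : C i.+1 u -> C i.+1 v -> C i.+1 (u + v).
  move=> Cu Cv; rewrite -[v]opprK -[- v]sub0r; apply: goodB => //.
  by apply: goodB => //; apply: good0.
have [|_ [u [v [[Nu Cu] Cv ->]]]||] := simC _ (good_join (good_meet goodN goodCi1) goodCi).
- move=> w Cw; exists 0, w; rewrite add0r; split=> //.
  by split; apply: good0.
- by apply: addC => //; apply: SC.
- move=> DC; case: nCz; apply: DC; exists z, 0; rewrite addr0; split=> //.
  exact: good0.
move=> /(_ y Cy)[u [v [[Nu Cu] Cv yE]]].
have Nv : N v.
  apply: IH => //; first exact: ltnW.
  by rewrite -[v](addKr u) -yE addrC; apply: goodB => //; apply: NN'.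
rewrite yE -[v]opprK -[- v]sub0r; apply: goodB => //.
by apply: goodB => //; apply: good0.
Qed.

End Series.

Lemma leq_sum_eq m (f g : 'I_m -> nat) :
  (forall i, f i <= g i)%N -> (\sum_i g i <= \sum_i f i)%N ->
  forall i, (g i <= f i)%N.
Proof.
move=> le_fg le_sum i; rewrite leqNgt; apply/negP => lt_fg.
suff : (\sum_i f i < \sum_i g i)%N by rewrite ltnNge le_sum.
rewrite (bigD1 i) //= [X in (_ < X)%N](bigD1 i) //= -addSn.
by apply: leq_add => //; apply: leq_sum => j _.
Qed.

(** * Dickson's lemma *)

Lemma nondecreasing_subsequence (h : nat -> nat) :
  exists g : nat -> nat, {homo g : i j / (i < j)%N}
    /\ {homo h \o g : i j / (i <= j)%N}.
Proof.
have next k : exists i, (k <= i)%N /\ forall j, (k <= j)%N -> (h i <= h j)%N.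
  have ex_h : exists v, `[< exists2 i, (k <= i)%N & h i = v >].
    by exists (h k); apply/asboolP; exists k.
  case: (ex_minnP ex_h) => _ /asboolP[i ki <-] min_i; exists i; split=> // j kj.
  by apply: min_i; apply/asboolP; exists j.
have [nx nxP] := choice next.
pose g := fix g n := if n is n'.+1 then nx (g n').+1 else nx 0%N.
have ltg n : (g n < g n.+1)%N by apply: (nxP _).1.
exists g; split; first exact: homo_ltn ltn_trans ltg.
apply: homo_leq leqnn leq_trans _ => -[|n] /=; apply: (nxP _).2 => //=.
by apply: leq_trans (ltg n) _; apply: ltnW; apply: (nxP _).1.
Qed.

Lemma dickson m (P : 'X_{1..m} -> Prop) :
  exists s : seq 'X_{1..m}, (forall b, b \in s -> P b) /\
    forall a, P a -> exists2 b, b \in s & (b <= a)%MM.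
Proof.
apply: contrapT => nos.
have ex_next (s : seq 'X_{1..m}) : exists a, (forall b, b \in s -> P b) ->
    P a /\ forall b, b \in s -> ~~ (b <= a)%MM.
  have [sP|sP] := pselect (forall b, b \in s -> P b); last by exists 0%MM.
  apply: contrapT => noa; apply: nos; exists s; split=> // a Pa.
  apply: contrapT => nob; apply: noa; exists a => _; split=> // b bs.
  by apply/negP => ba; apply: nob; exists b.
have [pick pickP] := choice ex_next.
pose s := fix s n := if n is n'.+1 then pick (s n') :: s n' else [::].
have sP n b : b \in s n -> P b.
  by elim: n b => // n IH b; rewrite inE => /orP[/eqP ->|/IH //]; case: (pickP (s n)).
have s_mem i j : (i < j)%N -> pick (s i) \in s j.
  elim: j => // j IH; rewrite ltnS leq_eqVlt inE => /orP[/eqP ->|/IH ->].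
    by rewrite eqxx.
  by rewrite orbT.
have sub (l : seq 'I_m) : exists g : nat -> nat, {homo g : i j / (i < j)%N} /\
    forall k, k \in l -> {homo (fun i => pick (s (g i)) k) : i j / (i <= j)%N}.
  elim: l => [|k l [g [gS gP]]]; first by exists id; split=> [i j|].  
  have [h [hS hP]] := nondecreasing_subsequence (fun i => pick (s (g i)) k).
  exists (g \o h); split=> [i j ij|k']; first by apply: gS; apply: hS.
  rewrite inE => /orP[/eqP ->|/gP k'P] i j ij; first exact: hP.
  by apply: k'P; move: ij; rewrite leq_eqVlt => /orP[/eqP -> //|/hS /ltnW].
have [g [gS gP]] := sub (enum 'I_m).
have [_ /(_ _ (s_mem _ _ (gS 0%N 1%N isT))) /negP] := pickP _ (sP (g 1%N)).
by case; apply/mnm_lepP => k; apply: gP => //; rewrite mem_enum.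
Qed.

(** * Leading terms *)

Section LeadingTerms.
Variables (B : nzRingType) (M : lmodType B) (T : Type) (lt : T -> T -> Prop).
Hypotheses (lt_wf : well_founded lt)
  (lt_trans : forall a b c, lt a b -> lt b c -> lt a c)
  (lt_total : forall a b, lt a b \/ a = b \/ lt b a).
Variable e : T -> M.

(** The elements of low b are the combinations of the e a with a below b,
    written with strictly decreasing indices, so that the leading term of a
    nonzero combination can be read off. *)
Inductive low : T -> M -> Prop :=
| low0 b : low b 0
| lowS b a c x : lt a b -> low a x -> low b (c *: e a + x).

Lemma low_trans a b x : lt a b -> low a x -> low b x.
Proof.
move=> ab ax; case: ax ab => [*|a' a0 c y a0a' ly a'b]; first exact: low0.
by apply: lowS => //; apply: lt_trans a'b.
Qed.

Lemma lowZ c b x : low b x -> low b (c *: x).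
Proof.
elim=> {b x} [b|b a d x ab _ IH]; first by rewrite scaler0; apply: low0.
by rewrite scalerDr scalerA; apply: lowS.
Qed.

Lemma lowD b x y : low b x -> low b y -> low b (x + y).
Proof.
elim/(well_founded_ind lt_wf): b x y => b IH x y lx ly.
case: lx IH ly => {x b} [b _|b a c x ab lx IH ly]; first by rewrite add0r.
case: ly IH ab => {y b} [b *|b a' d y a'b ly IH ab].
  by rewrite addr0; apply: lowS.
have [aa'|[aa'|a'a]] := lt_total a a'.
- rewrite addrCA; apply: lowS => //; apply: IH => //.
  exact: lowS.
- by rewrite -aa' in ly *; rewrite addrACA -scalerDl; apply: lowS => //; apply: IH.
- rewrite -addrA; apply: lowS => //; apply: IH => //.
  exact: lowS.
Qed.

Lemma lowN b x : low b x -> low b (- x).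
Proof. by rewrite -scaleN1r; apply: lowZ. Qed.

Lemma lowB b x y : low b x -> low b y -> low b (x - y).
Proof. by move=> lx ly; apply: lowD => //; apply: lowN. Qed.

Lemma low_e a b : lt a b -> low b (e a).
Proof.
by move=> ab; rewrite -[e a]addr0 -[e a]scale1r; apply: lowS => //; apply: low0.
Qed.

End LeadingTerms.

Section LeadingTermsField.
Variables (K : fieldType) (M : lmodType K) (T : Type) (lt : T -> T -> Prop).
Hypotheses (lt_wf : well_founded lt)
  (lt_total : forall a b, lt a b \/ a = b \/ lt b a).
Variable e : T -> M.

Definition leading (N : M -> Prop) (a : T) : Prop :=
  exists2 x, N x & low lt e a (x - e a).

(** Subspaces N of N' with the same leading indices agree, because the leading
    term of an element of N' can be cancelled by an element of N. *)
Lemma leading_inj (N N' : M -> Prop) b x :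
  subspace N -> subspace N' -> (forall x, N x -> N' x) ->
  (forall a, leading N' a -> leading N a) -> low lt e b x -> N' x -> N x.
Proof.
move=> subN subN' NN' lead; elim/(well_founded_ind lt_wf): b x => b IH x.
move=> lx; case: lx IH => {x b} [b _ _|b a c x ab lx IH N'x]; first exact: sub0.
have [c0|c0] := eqVneq c 0.
  by move: N'x; rewrite c0 scale0r add0r; apply: IH lx.
have [|n Nn ln] := lead a.
  exists (c^-1 *: (c *: e a + x)); first exact: subZ.
  by rewrite scalerDr scalerA mulVf // scale1r addrC addKr; apply: lowZ.
have E : c *: e a + x - c *: n = x - c *: (n - e a).
  by rewrite scalerBr opprB addrA addrAC addrC addrA.
have Ny : N (c *: e a + x - c *: n).
  apply: (IH a ab); last by apply: subB => //; apply: subZ => //; apply: NN'.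
  by rewrite E; apply: lowB => //; apply: lowZ.
by rewrite -[X in N X](subrK (c *: n)); apply: subD => //; apply: subZ.
Qed.

End LeadingTermsField.

(** * Standard monomials *)

Lemma mdegU_add m (a : 'X_{1..m}) k : mdeg (a + U_(k))%MM = (mdeg a).+1.
Proof. by rewrite mdegD mdeg1 addn1. Qed.

Section Monomials.
Variables (B : nzRingType) (M : lmodType B) (m : nat) (u : 'I_m -> M -> M).
Variable c : 'I_m -> 'I_m -> 'I_m -> B.
Hypotheses (uL : forall k, linear (u k))
  (u_bracket : forall i j x, u i (u j x) - u j (u i x) = \sum_k c i j k *: u k x).
Variables (n : nat) (g : 'I_n.+1 -> M).

Definition mindex : Type := 'X_{1..m} * 'I_n.+1.

Definition mlt (a b : mindex) : Prop :=
  (a.1 < b.1)%O \/ a.1 = b.1 /\ (a.2 < b.2)%N.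

Lemma mlt_wf : well_founded mlt.
Proof.
move=> [a j]; elim/(well_founded_ind (@ltom_wf m)): a j => a IHa j.
have [k] := ubnP (val j); elim: k j => [j|k IHk j ltjk]; first by rewrite ltn0.
constructor=> -[b i] /= [ba|/= [-> ij]]; first exact: IHa.
by apply: IHk; apply: leq_trans ij _.
Qed.

Lemma mlt_trans a b d : mlt a b -> mlt b d -> mlt a d.
Proof.
rewrite /mlt => -[ab|[-> ab]] [bd|[<- bd]]; try by left.
- by left; apply: Order.POrderTheory.lt_trans bd.
- by right; split=> //; apply: ltn_trans bd.
Qed.

Lemma mlt_total a b : mlt a b \/ a = b \/ mlt b a.
Proof.
case: a b => a i [b j]; rewrite /mlt /=.
have [ab|ba|->] := Order.TotalTheory.ltgtP a b; [by left; left|by right; right; left|].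
have [ij|ji|ij] := ltngtP i j; [by left; right|by right; right; right|].
by right; left; congr (_, _); apply: val_inj.
Qed.

Definition mshift (a : mindex) (k : 'I_m) : mindex := ((a.1 + U_(k))%MM, a.2).

Lemma mlt_shift a b k : mlt a b -> mlt (mshift a k) (mshift b k).
Proof.
case=> [ab|[ab ij]]; [left|right]; rewrite /= ?ab //.
by rewrite ltmc_add2l.
Qed.

Lemma mlt_mdeg a b : (mdeg a.1 < mdeg b.1)%N -> mlt a b.
Proof. by move=> ab; left; apply: lt_mdeg_ltmc. Qed.

(** The operators are applied in a fixed order, the one with the smallest index
    last, as in a Poincare-Birkhoff-Witt basis. *)
Definition monom (a : mindex) : M :=
  foldr (fun i => iter (a.1 i) (u i)) (g a.2) (enum 'I_m).

Local Notation mlow := (low mlt monom).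

(** When k is not above any variable of the monomial, multiplication by u_k
    creates no inversion. *)
Lemma monom_min (a : mindex) (k : 'I_m) : (forall l : 'I_m, (l < k)%N -> a.1 l = 0%N) ->
  monom (mshift a k) = u k (monom a).
Proof.
move=> a0; rewrite /monom.
have [s1 [s2 [-> s1k s2k]]] : exists s1 s2, [/\ enum 'I_m = s1 ++ k :: s2,
    forall l, l \in s1 -> (l < k)%N & k \notin s2].
  have kE : k \in enum 'I_m by rewrite mem_enum.
  have := enum_uniq 'I_m; have sE : sorted ltn (map val (enum 'I_m)).
    by rewrite val_enum_ord iota_ltn_sorted.
  move: sE; case/splitPr: kE => s1 s2 sE uE; exists s1, s2; split=> // [l ls1|].
    move: sE; rewrite map_cat (sorted_pairwise ltn_trans) pairwise_cat.
    by case/andP=> /allrelP sE _; apply: sE; rewrite ?map_f //= mem_head.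
  by move: uE; rewrite cat_uniq /= => /and3P[_ _ /andP[]].
rewrite !foldr_cat /= mnmDE mnm1E eqxx addn1 /=.
have s1_id x (b : mindex) : (forall l, l \in s1 -> b.1 l = 0%N) ->
    foldr (fun i => iter (b.1 i) (u i)) x s1 = x.
  elim: s1 {s1k} => //= l s1 IH b0; rewrite b0 ?mem_head //=.
  by apply: IH => l' l's; apply: b0; rewrite inE l's orbT.
rewrite (s1_id _ a) => [|l /s1k lk]; last by rewrite a0.
rewrite (s1_id _ (mshift a k)) => [|l /s1k lk]; last first.
  by rewrite /= mnmDE mnm1E a0 // (negbTE (_ : k != l)) // neq_ltn lk orbT.
congr (u k (iter _ _ _)); elim: s2 s2k => //= l s2 IH.
rewrite inE negb_or => /andP[kl /IH ->].
by rewrite mnmDE mnm1E (negbTE kl) addn0.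
Qed.

Inductive filt (d : nat) : M -> Prop :=
| filt0 : filt d 0
| filtS r a x : (mdeg a.1 <= d)%N -> filt d x -> filt d (r *: monom a + x).

Lemma filtD d x y : filt d x -> filt d y -> filt d (x + y).
Proof.
move=> fx fy; elim: fx => [|r a x' ad _ IH]; first by rewrite add0r.
by rewrite -addrA; apply: filtS.
Qed.

Lemma filtZ d r x : filt d x -> filt d (r *: x).
Proof.
elim=> [|s a y ad _ IH]; first by rewrite scaler0; apply: filt0.
by rewrite scalerDr scalerA; apply: filtS.
Qed.

Lemma filtW d d' x : (d <= d')%N -> filt d x -> filt d' x.
Proof.
move=> dd'; elim=> [|r a y ad _ IH]; first exact: filt0.
by apply: filtS => //; apply: leq_trans dd'.
Qed.

Lemma filt_monom d a : (mdeg a.1 <= d)%N -> filt d (monom a).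
Proof.
by move=> ad; rewrite -[monom a]addr0 -[monom a]scale1r; apply: filtS => //; apply: filt0.
Qed.

Lemma filt_low d b x : (d < mdeg b.1)%N -> filt d x -> mlow b x.
Proof.
move=> db; elim=> [|r a y ad _ IH]; first exact: low0.
apply: (lowD mlt_wf mlt_total) => //; apply: lowZ.
by apply: low_e; apply: mlt_mdeg; apply: leq_ltn_trans db.
Qed.

(** Reordering a product of operators only costs terms of lower degree, since
    a commutator of two operators is again a combination of operators. *)
Lemma straighten a k : filt (mdeg a.1) (u k (monom a) - monom (mshift a k)).
Proof.
have [d] := ubnP (mdeg a.1); elim: d a k => [//|d IH] a k; rewrite ltnS => le_ad.
have u_filt d' x l : (d' < d)%N -> filt d' x -> filt d'.+1 (u l x).
  move=> d'd; elim=> [|r b y bd _ IHy]; first by rewrite (lin0 (uL l)); apply: filt0.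
  rewrite (uL l); apply: filtD => //; apply: filtZ.
  rewrite -[u l _](subrK (monom (mshift b l))); apply: filtD.
    by apply: filtW (IH b l _); [apply: leqW|apply: leq_ltn_trans d'd].
  by apply: filt_monom; rewrite /= mdegU_add.
have [a0|/existsNP[l0 /not_implyP[l0k /eqP al0]]] :=
    pselect (forall l : 'I_m, (l < k)%N -> a.1 l = 0%N).
  by rewrite monom_min // subrr; apply: filt0.
have [i /andP[ik ai] imin] : exists2 i : 'I_m, (i < k)%N && (a.1 i != 0%N)
    & forall l : 'I_m, (l < i)%N -> a.1 l = 0%N.
  case: (@arg_minnP _ l0 (fun i : 'I_m => (i < k)%N && (a.1 i != 0%N)) val).
    by rewrite l0k.
  move=> i Pi imin; exists i => // l li; apply/eqP/negPn/negP => al.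
  have /andP[ik _] := Pi.
  by have := imin l; rewrite (ltn_trans li ik) al => /(_ isT); rewrite leqNgt li.
(* The smallest variable i of the monomial lies below k: exchange u_k and
   u_i. *)
pose b : mindex := ((a.1 - U_(i))%MM, a.2).
have ab : a = mshift b i.
  by rewrite /mshift /= submK -?surjective_pairing // lep1mP.
have dab : mdeg a.1 = (mdeg b.1).+1 by rewrite ab /= mdegU_add.
have bd : (mdeg b.1 < d)%N by rewrite -dab.
have b0 (l : 'I_m) : (l < i)%N -> b.1 l = 0%N.
  by move=> li; rewrite mnmBE imin.
have fil l : filt (mdeg b.1) (u l (monom b) - monom (mshift b l)) by apply: IH.
have -> : monom a = u i (monom b) by rewrite ab monom_min.
have -> : monom (mshift a k) = u i (monom (mshift b k)).
  rewrite -monom_min => [|l li]; first by rewrite {1}ab /mshift /= -!addmA [(U_(i) + _)%MM]addmC.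
  by rewrite /= mnmDE b0 // mnm1E -val_eqE /= gtn_eqF // (ltn_trans li).
have -> : u k (u i (monom b)) = u i (u k (monom b)) + \sum_l c k i l *: u l (monom b).
  by rewrite -u_bracket addrC subrK.
rewrite addrAC -(linB (uL i)) dab; apply: filtD; first exact: u_filt.
apply: (big_ind (filt _)) => [|x y|l _]; [exact: filt0|exact: filtD|].
apply: filtZ; rewrite -[u l _](subrK (monom (mshift b l))); apply: filtD.
  by apply: filtW (fil l).
by apply: filt_monom; rewrite /= mdegU_add.
Qed.

Lemma straighten_low a k : mlow (mshift a k) (u k (monom a) - monom (mshift a k)).
Proof. by apply: filt_low (straighten a k); rewrite /= mdegU_add. Qed.

Lemma low_u b x k : mlow b x -> mlow (mshift b k) (u k x).
Proof.
elim=> {b x} [b|b a r x ab _ IH]; first by rewrite (lin0 (uL k)); apply: low0.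
have abk := mlt_shift k ab.
rewrite (uL k); apply: (lowD mlt_wf mlt_total); last exact: (low_trans mlt_trans abk IH).
apply: lowZ; rewrite -[u k _](subrK (monom (mshift a k))).
apply: (lowD mlt_wf mlt_total); last exact: low_e.
exact: (low_trans mlt_trans abk (straighten_low a k)).
Qed.

(** The order on indices is strict, so some index has to lie above the
    generators; the last generator is set to 0 to provide one. *)
Lemma low_exhaust x : g ord_max = 0 ->
  (forall S : M -> Prop, (forall y z, S y -> S z -> S (y + z)) ->
    (forall r y, S y -> S (r *: y)) -> (forall k y, S y -> S (u k y)) ->
    (forall j, S (g j)) -> S x) ->
  exists b, mlow b x.
Proof.
move=> gmax /(_ (fun x => exists b, mlow b x)).
apply=> [y z [b lby] [b' lb'z]|r y [b lby]|k y [b lby]|j].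
- have [bb'|[bb'|b'b]] := mlt_total b b'.
  + by exists b'; apply: (lowD mlt_wf mlt_total) => //; exact: (low_trans mlt_trans bb' lby).
  + by exists b; rewrite -bb' in lb'z; apply: (lowD mlt_wf mlt_total).
  + by exists b; apply: (lowD mlt_wf mlt_total) => //; exact: (low_trans mlt_trans b'b lb'z).
- by exists b; apply: lowZ.
- by exists (mshift b k); apply: low_u.
have [->|jmax] := eqVneq j ord_max.
  by exists (0%MM, ord0); rewrite gmax; apply: low0.
exists (0%MM, ord_max); have -> : g j = monom (0%MM, j).
  by rewrite /monom /=; elim: (enum 'I_m) => //= i s <-; rewrite mnm0E.
apply: low_e; right; split=> //=.
by rewrite ltn_neqAle -ltnS ltn_ord andbT; apply: contra jmax => /eqP jE; apply/eqP/val_inj.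
Qed.

End Monomials.

Lemma wf_minimal (T : Type) (lt : T -> T -> Prop) (P : T -> Prop) a :
  well_founded lt -> P a -> exists b, P b /\ forall c, lt c b -> ~ P c.
Proof.
move=> wf; elim/(well_founded_ind wf): a => a IH Pa.
have [[c [ca Pc]]|noc] := pselect (exists c, lt c a /\ P c); first exact: IH c ca Pc.
by exists a; split=> // c ca Pc; apply: noc; exists c.
Qed.

Lemma dickson_index m n (P : mindex m n -> Prop) :
  exists s : seq (mindex m n), (forall b, b \in s -> P b) /\
    forall a, P a -> exists b, [/\ b \in s, b.2 = a.2 & (b.1 <= a.1)%MM].
Proof.
have [s sP] := choice (fun j => dickson (fun a => P (a, j))).
exists (flatten [seq [seq (b, j) | b <- s j] | j <- enum 'I_n.+1]); split.
  by move=> _ /flattenP[_ /mapP[j _ ->] /mapP[b bs ->]]; apply: (sP j).1.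
move=> [a j] /(sP j).2 [b bs ba]; exists (b, j); split=> //.
by apply/flatten_mapP; exists j; rewrite ?mem_enum //; apply: map_f.
Qed.

Lemma shift_closed m n (P : mindex m n -> Prop) a b :
  (forall a k, P a -> P (mshift a k)) -> b.2 = a.2 -> (b.1 <= a.1)%MM ->
  P b -> P a.
Proof.
case: a b => a j [b i] /= PS -> /submK; rewrite addmC => <-.
move: (a - b)%MM => d; have [k] := ubnP (mdeg d); elim: k b d => // k IH b d.
rewrite ltnS => le_dk Pb.
have [->|] := eqVneq d 0%MM; first by rewrite addm0.
rewrite -mdeg_eq0 => d0.
have [l dl] : exists l, d l != 0%N.
  apply: contrapT => dz; case/negP: d0; rewrite mdeg_eq0; apply/eqP/mnmP => l.
  by rewrite mnm0E; apply/eqP/negPn/negP => dl; apply: dz; exists l.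
have dE : d = (d - U_(l) + U_(l))%MM by rewrite submK // lep1mP.
rewrite dE [(_ + U_(l))%MM]addmC addmA; apply: IH; last exact: (PS (b, j)).
by apply: leq_trans le_dk; rewrite {2}dE mdegU_add.
Qed.

(** * Noetherianity of enveloping algebra modules *)

Section Noetherian.
Variables (K : fieldType) (M : lmodType K) (m : nat) (u : 'I_m -> M -> M).
Variable c : 'I_m -> 'I_m -> 'I_m -> K.
Hypotheses (uL : forall k, linear (u k))
  (u_bracket : forall i j x, u i (u j x) - u j (u i x) = \sum_k c i j k *: u k x).
Variables (n : nat) (g : 'I_n.+1 -> M).
Hypotheses (gmax : g ord_max = 0)
  (gen_g : forall x (S : M -> Prop), (forall y z, S y -> S z -> S (y + z)) ->
    (forall r y, S y -> S (r *: y)) -> (forall k y, S y -> S (u k y)) ->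
    (forall j, S (g j)) -> S x).

Lemma leading_shift (N : M -> Prop) a k : (forall k x, N x -> N (u k x)) ->
  leading (@mlt m n) (monom u g) N a ->
  leading (@mlt m n) (monom u g) N (mshift a k).
Proof.
move=> uN [x Nx lx]; exists (u k x); first exact: uN.
rewrite -(subrK (u k (monom u g a)) (u k x)) -(linB (uL k)) -addrA.
apply: (lowD (@mlt_wf m n) (@mlt_total m n)).
  exact: (low_u uL u_bracket).
exact: (straighten_low uL u_bracket).
Qed.

(** The leading indices of an increasing sequence of submodules eventually
    stop growing, and they determine the submodules. *)
Lemma noetherian_family (Z : Type) (N : Z -> M -> Prop) (z : Z) :
  (forall z, subspace (N z) /\ forall k x, N z x -> N z (u k x)) ->
  exists z0, forall z, (forall x, N z0 x -> N z x) -> forall x, N z x -> N z0 x.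
Proof.
move=> NP; apply: contrapT => nomax.
have ex_next z0 : exists z, (forall x, N z0 x -> N z x) /\
    ~ forall x, N z x -> N z0 x.
  apply: contrapT => noz; apply: nomax; exists z0 => z1 N01.
  by apply: contrapT => N10; apply: noz; exists z1.
have [next nextP] := choice ex_next.
pose s i := iter i next z.
have mono i j x : (i <= j)%N -> N (s i) x -> N (s j) x.
  move=> /subnK <-; elim: (j - i)%N => // d IH Nx.
  by apply: (nextP _).1; apply: IH.
pose lead i := leading (@mlt m n) (monom u g) (N (s i)).
have leadS i j a : (i <= j)%N -> lead i a -> lead j a.
  by move=> ij [x Nx lx]; exists x => //; apply: mono Nx.
have [l [lP lgen]] := dickson_index (fun a => exists i, lead i a).
have [i0 li0] : exists i, forall b, b \in l -> lead i b.
  elim: l lP {lgen} => [|b l IH] lP; first by exists 0%N.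
  have [|i li] := IH; first by move=> b' b'l; apply: lP; rewrite inE b'l orbT.
  have [j lj] := lP b (mem_head b l); exists (maxn i j) => b'.
  rewrite inE => /orP[/eqP ->|/li lib'].
    exact: leadS (leq_maxr i j) lj.
  exact: leadS (leq_maxl i j) lib'.
apply: (nextP (s i0)).2 => x Nx; have [b lb] := low_exhaust uL u_bracket gmax (gen_g x).
apply: (leading_inj (@mlt_wf m n) (@mlt_total m n) _ _ _ _ lb Nx).
- exact: (NP _).1.
- exact: (NP (next (s i0))).1.
- exact: (nextP _).1.
move=> a la; have [|b' [b'l e2 e1]] := lgen a; first by exists i0.+1.
apply: (shift_closed _ e2 e1 (li0 _ b'l)) => a' k; apply: leading_shift.
exact: (NP _).2.
Qed.

End Noetherian.

(** * Generic flatness over a polynomial ring *)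

Section GenericFlatness.
Variables (F : fieldType) (M : lmodType {poly F}).
Variables (m : nat) (u : 'I_m -> M -> M).
Variable c : 'I_m -> 'I_m -> 'I_m -> {poly F}.
Hypotheses (uL : forall k, linear (u k))
  (u_bracket : forall i j x, u i (u j x) - u j (u i x) = \sum_k c i j k *: u k x).
Variables (n : nat) (g : 'I_n.+1 -> M).
Hypotheses (gmax : g ord_max = 0)
  (gen_g : forall x (S : M -> Prop), (forall y z, S y -> S z -> S (y + z)) ->
    (forall r y, S y -> S (r *: y)) -> (forall k y, S y -> S (u k y)) ->
    (forall j, S (g j)) -> S x).

Local Notation e := (monom u g).
Local Notation mlow := (low (@mlt m n) e).

(** The monomials whose class modulo lower terms is torsion form a shift-stable
    set, so a single polynomial f kills all these classes. *)
Lemma torsion_bound : exists f : {poly F}, f != 0 /\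
  forall a p, p != 0 -> mlow a (p *: e a) -> mlow a (f *: e a).
Proof.
have shift p a k : mlow a (p *: e a) -> mlow (mshift a k) (p *: e (mshift a k)).
  move=> la; have -> : p *: e (mshift a k) =
      u k (p *: e a) - p *: (u k (e a) - e (mshift a k)).
    by rewrite (linZ (uL k)) scalerBr opprB addrC subrK.
  apply: (lowB (@mlt_wf m n) (@mlt_total m n)).
    exact: (low_u uL u_bracket).
  by apply: lowZ; apply: (straighten_low uL u_bracket).
have [s [sP sgen]] :=
  dickson_index (fun a => exists p : {poly F}, p != 0 /\ mlow a (p *: e a)).
have [f [f0 fP]] : exists f : {poly F}, f != 0 /\
    forall b, b \in s -> mlow b (f *: e b).
  elim: s sP {sgen} => [|b s IH] sP; first by exists 1; rewrite oner_eq0.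
  have [|f [f0 fP]] := IH; first by move=> b' b's; apply: sP; rewrite inE b's orbT.
  have [p [p0 lp]] := sP b (mem_head b s).
  exists (p * f); rewrite mulf_neq0 //; split=> // b'.
  rewrite inE => /orP[/eqP ->|/fP lb]; last by rewrite -scalerA; apply: lowZ.
  by rewrite mulrC -scalerA; apply: lowZ.
exists f; split=> // a p p0 lp; have [|b [bs e2 e1]] := sgen a; first by exists p.
apply: (shift_closed (P := fun a => mlow a (f *: e a)) _ e2 e1 (fP b bs)).
by move=> a' k; apply: shift.
Qed.

(** Inverting f makes M free, with the monomials that are not torsion as a
    basis; a prime that does not divide f then cannot divide the first of
    them. *)
Lemma divisible_torsion_free_trivial :
  (forall (p : {poly F}) (x : M), p != 0 -> p *: x = 0 -> x = 0) ->
  (forall (p : {poly F}) (x : M), p != 0 -> exists y, p *: y = x) ->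
  forall x : M, x = 0.
Proof.
move=> tf dv x; apply: contrapT => x0.
have [f [f0 fP]] := torsion_bound.
have [a0 ea0] : exists a, e a <> 0.
  apply: contrapT => noa; apply: x0.
  have [b lb] := low_exhaust uL u_bracket gmax (gen_g x).
  elim: lb => // b' a r y _ _ ->; rewrite addr0.
  suff -> : e a = 0 by rewrite scaler0.
  by apply: contrapT => ea; apply: noa; exists a.
have [a [ea amin]] := wf_minimal (P := fun a => e a <> 0) (@mlt_wf m n) ea0.
have low_a y b : mlow b y -> (b = a \/ mlt b a) -> y = 0.
  elim=> // b' a' r z a'b' _ IH b'a.
  have a'a : mlt a' a by case: b'a => [<-//|]; apply: mlt_trans.
  rewrite IH ?addr0; last by right.
  suff -> : e a' = 0 by rewrite scaler0.
  by apply: contrapT => ea'; apply: (amin a').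
(* q is coprime to f and not constant. *)
pose q := f * 'X + 1%:P.
have q1 : (1 < size q)%N by rewrite size_MXaddC (negbTE f0) /= ltnS size_poly_gt0.
have q0 : q != 0 by rewrite -size_poly_gt0 ltnW.
have key b y k : mlow b y -> q *: y = f ^+ k *: e a ->
    exists N r, f ^+ N *: y = r *: e a.
  elim/(well_founded_ind (@mlt_wf m n)): b y k => b IH y k ly.
  case: ly IH => {b y} [b _ _|b a' r y a'b ly IH qy].
    by exists 0%N, 0; rewrite scaler0 scale0r.
  have [a'a|[a'a|aa']] := mlt_total a' a.
  - exists 0%N, 0; rewrite (low_a y a') //; last by right.
    suff -> : e a' = 0 by rewrite scaler0 addr0 scaler0 scale0r.
    by apply: contrapT => ea'; apply: (amin a').
  - exists 0%N, r; rewrite (low_a y a') //; last by left.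
    by rewrite expr0 scale1r addr0 a'a.
  have [r0|r0] := eqVneq r 0.
    by move: qy; rewrite r0 scale0r add0r; apply: IH ly.
  have lqr : mlow a' ((q * r) *: e a').
    have -> : (q * r) *: e a' = f ^+ k *: e a - q *: y.
      by rewrite -qy scalerDr addrK scalerA.
    apply: (lowB (@mlt_wf m n) (@mlt_total m n)); last exact: lowZ.
    by apply: lowZ; apply: low_e.
  have lf := fP _ _ (mulf_neq0 q0 r0) lqr.
  have [||N [t Nt]] := IH a' a'b (f *: (r *: e a' + y)) k.+1.
  - rewrite scalerDr scalerA mulrC -scalerA.
    by apply: (lowD (@mlt_wf m n) (@mlt_total m n)); apply: lowZ.
  - by rewrite scalerA mulrC -scalerA qy scalerA exprS.
  by exists N.+1, t; rewrite exprSr -scalerA.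
have [y qy] := dv q (e a) q0.
have [b lb] := low_exhaust uL u_bracket gmax (gen_g y).
have [|N [r Nr]] := key b y 0%N lb; first by rewrite expr0 scale1r.
have fN : f ^+ N = q * r.
  apply/eqP; rewrite -subr_eq0; apply: contrapT => /negP nz; apply: ea.
  apply: tf nz _; rewrite scalerBl -scalerA -Nr scalerA mulrC -scalerA qy.
  by rewrite subrr.
have : coprimep q (f ^+ N).
  apply: coprimep_expr; apply/Bezout_coprimepP; exists (1, - 'X) => /=.
  by rewrite mul1r mulNr /q mulrC addrAC subrr add0r eqpxx.
have qf : q %| f ^+ N by rewrite fN dvdp_mulr.
move/(coprimep_dvdl qf); rewrite coprimepp => /eqP sq.
by rewrite sq in q1.
Qed.

End GenericFlatness.

(** * Division algebras with a finite maximal subfield *)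

Section DivisionRing.
Variable D : nzRingType.
Hypothesis divD : forall x : D, x != 0 -> exists y, y * x = 1.

(** Gaussian elimination works over a division ring, as long as rows are
    combined with coefficients on the left. *)
Lemma left_dependent p n (v : 'I_n -> 'I_p -> D) : (p < n)%N ->
  exists b : 'I_n -> D, (exists i, b i != 0) /\
    forall k, \sum_i b i * v i k = 0.
Proof.
elim: p n v => [|p IH] [//|n] v lt_pn.
  by exists (fun=> 1); split=> [|[]//]; exists ord0; apply: oner_neq0.
have [[i0 nz]|allz] := pselect (exists i, v i ord0 != 0); last first.
  have z i : v i ord0 = 0.
    by apply/eqP/negPn/negP => nz; apply: allz; exists i.
  have [b [bnz b0]] := IH _ (fun i k => v i (lift ord0 k)) (ltnW lt_pn).
  exists b; split=> // k; case: (unliftP ord0 k) => [k' ->|->]; first exact: b0.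
  by rewrite big1 // => i _; rewrite z mulr0.
have [w wv] := divD nz.
pose v' j k := v (lift i0 j) k - v (lift i0 j) ord0 * w * v i0 k.
have [b [[j bj] b0]] := IH _ (fun j k => v' j (lift ord0 k)) lt_pn.
have v'0 j' : v' j' ord0 = 0 by rewrite /v' -mulrA wv mulr1 subrr.
exists (fun i => if unlift i0 i is Some j then b j
  else - \sum_j b j * v (lift i0 j) ord0 * w); split.
  by exists (lift i0 j); rewrite liftK.
move=> k; rewrite (bigD1_ord i0) //= unlift_none.
under [X in _ + X]eq_bigr do rewrite liftK.
rewrite mulNr mulr_suml addrC -sumrB.
transitivity (\sum_j b j * v' j k).
  by apply: eq_bigr => j' _; rewrite /v' mulrBr !mulrA.
case: (unliftP ord0 k) => [k' ->|->]; first exact: b0.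
by rewrite big1 // => j' _; rewrite v'0 mulr0.
Qed.

Variable L : D -> Prop.
Hypothesis LP : forall x, L x <-> forall y, L y -> x * y = y * x.

Lemma maxcomm_closed : [/\ L 1, forall x y, L x -> L y -> L (x - y),
  forall x y, L x -> L y -> L (x * y) & forall x y, L x -> y * x = 1 -> L y].
Proof.
have comm x y : L x -> L y -> x * y = y * x by move=> /LP; apply.
split=> [|x y Lx Ly|x y Lx Ly|x y Lx yx]; apply/LP => z Lz.
- by rewrite mul1r mulr1.
- by rewrite mulrBl mulrBr !(comm _ z).
- by rewrite -mulrA (comm y) // !mulrA (comm x).
have y0 : y != 0.
  by apply/eqP => y0; move/eqP: yx; rewrite y0 mul0r eq_sym oner_eq0.
have [w wy] := divD y0.
have xw : x = w by rewrite -[x]mul1r -wy -mulrA yx mulr1.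
have xy : x * y = 1 by rewrite xw wy.
by rewrite -[y * z]mulr1 -xy !mulrA -[y * z * x]mulrA (comm z x) // mulrA yx mul1r.
Qed.

Definition left_free n (d : 'I_n -> D) := forall b : 'I_n -> D,
  (forall i, L (b i)) -> \sum_i b i * d i = 0 -> forall i, b i = 0.

Variables (F : fieldType) (phi : {rmorphism F -> D}).
Hypothesis phiC : forall a x, phi a * x = x * phi a.
Variables (p : nat) (l : 'I_p -> D).
Hypothesis Ll : forall x, L x -> exists c : 'I_p -> F, x = \sum_k phi (c k) * l k.

(** Artin's argument: in a shortest relation between the maps x |-> x * d i
    on L, with coefficients in D, the coefficients commute with L. *)
Lemma left_free_bound n (d : 'I_n -> D) : left_free d -> (n <= p)%N.
Proof.
move=> freed; rewrite leqNgt; apply/negP => lt_pn.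
have [b [[i0 bi0] b0]] := left_dependent (fun i k => l k * d i) lt_pn.
have bL x : L x -> \sum_i b i * x * d i = 0.
  move=> /Ll[c ->].
  transitivity (\sum_k phi (c k) * \sum_i b i * (l k * d i)).
    under [RHS]eq_bigr do rewrite mulr_sumr.
    rewrite exchange_big; apply: eq_bigr => i _.
    rewrite mulr_sumr mulr_suml; apply: eq_bigr => k _.
    by rewrite !mulrA phiC.
  by rewrite big1 // => k _; rewrite b0 mulr0.
have [s] := ubnP #|[set i | b i != 0]|.
elim: s b i0 bi0 bL {b0} => // s IH b i0 bi0 bL; rewrite ltnS => le_bs.
have [w wb] := divD bi0.
pose b' i := w * b i.
have b'L x : L x -> \sum_i b' i * x * d i = 0.
  move=> Lx; transitivity (w * \sum_i b i * x * d i); last by rewrite bL ?mulr0.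
  by rewrite mulr_sumr; apply: eq_bigr => i _; rewrite /b' !mulrA.
(* For y in L, the coefficients b' i * y - y * b' i give a relation that lacks
   the term i0. *)
have b'C i : L (b' i).
  apply/LP => y Ly; apply/eqP; rewrite -subr_eq0; apply: contraT => nz.
  case: (IH (fun i => b' i * y - y * b' i) i nz) => [x Lx|].
    transitivity (\sum_i b' i * (y * x) * d i - y * \sum_i b' i * x * d i).
      rewrite mulr_sumr -sumrB; apply: eq_bigr => j _.
      by rewrite !mulrBl !mulrA.
    have [_ _ LM _] := maxcomm_closed.
    by rewrite !b'L ?mulr0 ?subrr //; apply: LM.
  apply: leq_trans le_bs; apply: proper_card; apply/properP; split.
    apply/subsetP => j; rewrite !inE; apply: contra => /eqP bj.
    by rewrite /b' bj mulr0 mul0r mulr0 subrr.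
  by exists i0; rewrite !inE ?bi0 // /b' wb mul1r mulr1 subrr eqxx.
have [L1 _ _ _] := maxcomm_closed.
have := freed b' b'C; rewrite -[X in X = 0](_ : \sum_i b' i * 1 * d i = _); last first.
  by apply: eq_bigr => i _; rewrite mulr1.
move=> /(_ (b'L 1 L1) i0) /eqP; rewrite /b' wb.
by rewrite oner_eq0.
Qed.

(** A left free family over L of maximal size spans D over L. *)
Lemma finite_over_center : exists N (e : 'I_N -> D),
  forall y, exists c : 'I_N -> F, y = \sum_i phi (c i) * e i.
Proof.
pose P n := `[< exists d : 'I_n -> D, left_free d >].
have exP : exists n, P n.
  by exists 0%N; apply/asboolP; exists (fun=> 0) => b _ _ [].
have bP n : P n -> (n <= p)%N by move=> /asboolP[d] /left_free_bound.
case: (ex_maxnP exP bP) => n /asboolP[d freed] nmax.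
have span y : exists b : 'I_n -> D, (forall i, L (b i)) /\ y = \sum_i b i * d i.
  pose d' i := if unlift ord0 i is Some j then d j else y.
  have nfree : ~ left_free d'.
    by move=> fd'; have := nmax n.+1; rewrite ltnn => H; apply/notF/H/asboolP; exists d'.
  have [b [bL b0 [i bi]]] : exists b : 'I_n.+1 -> D,
      [/\ forall i, L (b i), \sum_i b i * d' i = 0 & exists i, b i != 0].
    apply: contrapT => nob; apply: nfree => b bL b0 i.
    by apply/eqP/negPn/negP => bi; apply: nob; exists b; split=> //; exists i.
  move: b0; rewrite big_ord_recl /d' unlift_none.
  under eq_bigr do rewrite liftK.
  move=> b0; have b00 : b ord0 != 0.
    apply/eqP => b00; move: b0; rewrite b00 mul0r add0r => /freed fb.
    case/eqP: bi; case: (unliftP ord0 i) => [j ->|-> //].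
    by apply: (fb _ j) => j'; apply: bL.
  have [w wb] := divD b00; have [_ LB LM LV] := maxcomm_closed.
  have Lw : L w by apply: LV wb.
  have L0 : L 0 by rewrite -(subrr w); apply: LB.
  exists (fun j => - (w * b (lift ord0 j))); split=> [j|].
    by rewrite -sub0r; apply: LB => //; apply: LM.
  have by0 : b ord0 * y = - \sum_j b (lift ord0 j) * d j.
    by apply/eqP; rewrite -addr_eq0; apply/eqP.
  rewrite -[LHS]mul1r -wb -mulrA by0.
  rewrite mulrN mulr_sumr -sumrN.
  by apply: eq_bigr => j _; rewrite mulNr mulrA.
pose J : finType := ('I_n * 'I_p)%type.
exists #|J|, (fun j => l (enum_val j).2 * d (enum_val j).1) => y.
have [b [bL ->]] := span y.
have [c cP] := choice (fun i => Ll (bL i)).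
exists (fun j => c (enum_val j).1 (enum_val j).2).
transitivity (\sum_(x in J) phi (c x.1 x.2) * (l x.2 * d x.1)); last first.
  exact: big_enum_val.
rewrite -(pair_bigA _ (fun i k => phi (c i k) * (l k * d i))) /=.
apply: eq_bigr => i _; rewrite {1}cP mulr_suml.
by apply: eq_bigr => k _; rewrite mulrA.
Qed.

End DivisionRing.

Lemma max_commutative (D : nzRingType) :
  exists L : D -> Prop, forall x, L x <-> forall y, L y -> x * y = y * x.
Proof.
pose comm (A : D -> Prop) := forall x y, A x -> A y -> x * y = y * x.
have [|A [commA Amax]] := @classical_sets.Zorn_bigcup D comm.
  move=> Fam commF totF x y [X FX Xx] [Y FY Yy].
  have [XY|YX] := totF _ _ FX FY; first by apply: (commF Y) => //; apply: XY.
  by apply: (commF X) => //; apply: YX.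
exists A => x; split=> [Ax y|Cx]; first exact: commA.
apply: contrapT => nAx; apply: (Amax (fun y => A y \/ y = x)).
  split; first by left.
  by move=> /(_ x) AA; apply: nAx; apply: AA; right.
move=> y z [Ay|->] [Az|->] //; first exact: commA.
- by rewrite Cx.
- exact: Cx.
Qed.

(** A maximal commutative subset is its own centralizer, hence closed under the
    ring operations and inverses.  Divisibility is part of the record so that
    the field structure below can be inferred. *)
Record maximal_subfield (D : nzRingType) := MaximalSubfield {
  mset :> D -> Prop;
  msetP : forall x, mset x <-> forall y, mset y -> x * y = y * x;
  mdiv : forall x : D, x != 0 -> exists y, y * x = 1 }.

Section MaximalSubfield.
Variables (D : nzRingType) (L : maximal_subfield D).

Definition mpred : {pred D} := fun x => `[< L x >].

Fact mpred_subring : subring_closed mpred.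
Proof.
have [L1 LB LM _] := maxcomm_closed (@mdiv _ L) (@msetP _ L).
split=> [|x y /asboolP Lx /asboolP Ly|x y /asboolP Lx /asboolP Ly]; apply/asboolP => //.
  exact: LB.
exact: LM.
Qed.
HB.instance Definition _ := GRing.isSubringClosed.Build D mpred mpred_subring.

Definition mfield : Type := {x : D | x \in mpred}.
HB.instance Definition _ := SubChoice.on mfield.
HB.instance Definition _ := [SubChoice_isSubNzRing of mfield by <:].

Definition mval (x : mfield) : D := val x.

Lemma mval_inj : injective mval. Proof. exact: val_inj. Qed.

Fact mval_zmod : zmod_morphism mval.
Proof. by move=> x y; rewrite /mval raddfB. Qed.
Fact mval_monoid : monoid_morphism mval.
Proof. by split=> [|x y]; rewrite /mval ?rmorph1 ?rmorphM. Qed.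
HB.instance Definition _ := GRing.isZmodMorphism.Build mfield D mval mval_zmod.
HB.instance Definition _ := GRing.isMonoidMorphism.Build mfield D mval mval_monoid.

Lemma mval_mem x : L (mval x). Proof. exact/asboolP/(valP x). Qed.

Fact mfield_mulC : commutative (@GRing.mul mfield).
Proof.
move=> x y; apply: mval_inj; rewrite !rmorphM /=.
by have /msetP := mval_mem x; apply; apply: mval_mem.
Qed.
HB.instance Definition _ := GRing.PzRing_hasCommutativeMul.Build mfield mfield_mulC.

Fact mfield_exV (x : mfield) : exists y, x != 0 -> y * x = 1.
Proof.
have [x0|x0] := eqVneq x 0; first by exists 0.
have [|y yx] := @mdiv _ L (val x).
  by apply: contra x0 => /eqP x0; apply/eqP/val_inj.
have [_ _ _ LV] := maxcomm_closed (@mdiv _ L) (@msetP _ L).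
have Ly : y \in mpred by apply/asboolP; apply: LV yx; apply/asboolP/(valP x).
by exists (Sub y Ly) => _; apply: val_inj; rewrite rmorphM.
Qed.

Definition mfield_inv x : mfield :=
  if x == 0 then 0 else projT1 (cid (mfield_exV x)).

Fact mfield_mulVf (x : mfield) : x != 0 -> mfield_inv x * x = 1.
Proof. by move=> x0; rewrite /mfield_inv ifN //; apply: (projT2 (cid (mfield_exV x))). Qed.

Fact mfield_inv0 : mfield_inv 0 = 0.
Proof. by rewrite /mfield_inv ifT // eqxx. Qed.
HB.instance Definition _ :=
  GRing.ComNzRing_isField.Build mfield mfield_mulVf mfield_inv0.

Variables (F : fieldType) (phi : {rmorphism F -> D}).
Hypothesis phiC : forall a x, phi a * x = x * phi a.

Fact mfield_scalar_mem a : phi a \in mpred.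
Proof. by apply/asboolP/msetP => y _. Qed.

Definition mfield_scalar a : mfield := Sub (phi a) (mfield_scalar_mem a).

Fact mfield_scalar_zmod : zmod_morphism mfield_scalar.
Proof. by move=> a b; apply: val_inj; rewrite /= rmorphB. Qed.
Fact mfield_scalar_monoid : monoid_morphism mfield_scalar.
Proof. by split=> [|a b]; apply: val_inj; rewrite /= ?rmorph1 ?rmorphM. Qed.
HB.instance Definition _ :=
  GRing.isZmodMorphism.Build F mfield mfield_scalar mfield_scalar_zmod.
HB.instance Definition _ :=
  GRing.isMonoidMorphism.Build F mfield mfield_scalar mfield_scalar_monoid.

End MaximalSubfield.

(** * Simple field extensions *)

Section SimpleExtension.
Variables (F L : fieldType) (phi : {rmorphism F -> L}).

Definition adjoined (z x : L) : Prop := exists q, x = (map_poly phi q).[z].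

Lemma adjoined_pair : [pchar F] =i pred0 -> (forall z, algebraicOver phi z) ->
  forall x y, exists z, adjoined z x /\ adjoined z y.
Proof.
move=> char0 algL x y.
have [p p0 px] := algL x; have [q q0 qy] := algL y.
have [n [[r rx] [s sy]]] := pchar0_PET p0 px q0 qy char0.
by exists (y *+ n - x); split; [exists r|exists s].
Qed.

Section Generator.
Variable z : L.
Hypothesis algz : algebraicOver phi z.

Lemma minimal_polynomial : exists d (m : {poly F}),
  [/\ size m = d.+1, m \is monic, (map_poly phi m).[z] = 0
    & forall q, (map_poly phi q).[z] = 0 -> (size q <= d)%N -> q = 0].
Proof.
pose P n := `[< exists p : {poly F}, [/\ p != 0, (map_poly phi p).[z] = 0 & size p = n.+1] >].
have exP : exists n, P n.
  have [p p0 /rootP pz] := algz; exists (size p).-1; apply/asboolP; exists p.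
  by split=> //; rewrite prednK // size_poly_gt0.
case: (ex_minnP exP) => d /asboolP[p [p0 pz sp]] dmin.
have lp : (lead_coef p)^-1 != 0 by rewrite invr_eq0 lead_coef_eq0.
exists d, ((lead_coef p)^-1 *: p); split.
- by rewrite size_scale.
- by rewrite monicE lead_coefZ mulVf // lead_coef_eq0.
- by rewrite map_polyZ hornerZ pz mulr0.
move=> q qz sq; apply/eqP; apply: contraT => q0.
have /dmin : P (size q).-1.
  by apply/asboolP; exists q; split=> //; rewrite prednK // size_poly_gt0.
by rewrite -ltnS prednK ?size_poly_gt0 // ltnNge sq.
Qed.

Lemma adjoined_span : exists d, forall x, adjoined z x ->
  exists c : 'I_d -> F, x = \sum_(i < d) phi (c i) * z ^+ i.
Proof.
have [d [m [sm mm mz _]]] := minimal_polynomial; exists d => _ [q ->].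
exists (fun i => (q %% m)`_i).
have -> : (map_poly phi q).[z] = (map_poly phi (q %% m)).[z].
  by rewrite {1}(divp_eq q m) rmorphD rmorphM hornerD hornerM mz mulr0 add0r.
rewrite (@horner_coef_wide _ d).
  by apply: eq_bigr => i _; rewrite coef_map.
by rewrite size_map_poly -ltnS -sm ltn_modp -size_poly_gt0 sm.
Qed.

(** If mu is an F-linear functional on L and m the minimal polynomial of z, the
    sum of the mu (m_i(z) x) z^i, where m(t) / (t - z) = sum m_i(z) t^i, is
    F(z)-linear in x. *)
Lemma adjoined_separation (t : L) : ~ adjoined z t -> exists nu : L -> L,
  [/\ forall x y, nu (x + y) = nu x + nu y,
      forall a x, nu (phi a * x) = phi a * nu x,
      forall x, nu (z * x) = z * nu x, nu 1 = 0 & nu t != 0].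
Proof.
move=> zt; have [d [m [sm mm mz mmin]]] := minimal_polynomial.
have adj_sub : subspace (adjoined z : alg_space phi -> Prop).
  split=> [|a _ _ [q ->] [r ->]]; first by exists 0; rewrite rmorph0 horner0.
  by exists (a *: q + r); rewrite rmorphD /= map_polyZ hornerD hornerZ.
have [mu [muL mu0 mu1]] := functional_separation adj_sub zt.
have muZ a (x : L) : mu (phi a * x) = a * mu x := linZ muL a x.
(* Q i.+1 is the coefficient of t ^ i in m(t) / (t - z). *)
pose Q i := (map_poly phi (drop_poly i m)).[z].
have QS i : Q i = z * Q i.+1 + phi m`_i.
  rewrite /Q; have -> : drop_poly i m = drop_poly i.+1 m * 'X + (m`_i)%:P.
    by apply/polyP=> -[|j]; rewrite !coefE /= ?add0r // addr0 addSnnS.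
  by rewrite rmorphD rmorphM /= map_polyX map_polyC hornerMXaddC mulrC.
have Q0 : Q 0%N = 0 by rewrite /Q drop_poly0l.
have Qd : Q d = 1.
  have md : m`_d = 1 by move: (monicP mm); rewrite lead_coefE sm.
  rewrite /Q; have -> : drop_poly d m = 1%:P.
    apply/polyP=> -[|j]; rewrite !coefE /= ?add0n //.
    by rewrite nth_default // sm addSn ltnS leq_addl.
  by rewrite map_polyC hornerC; apply: rmorph1.
pose nu (x : L) : L := \sum_(i < d) phi (mu (Q i.+1 * x)) * z ^+ i.
exists nu; split=> [x y|a x|x||].
- rewrite -big_split; apply: eq_bigr => i _.
  by rewrite mulrDr (linD muL) rmorphD mulrDl.
- rewrite mulr_sumr; apply: eq_bigr => i _.
  by rewrite mulrCA muZ rmorphM mulrA.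
- have zd : z ^+ d = - \sum_(i < d) phi m`_i * z ^+ i.
    apply/eqP; rewrite -addr_eq0 addrC; apply/eqP.
    move: mz; rewrite (@horner_coef_wide _ d.+1) ?size_map_poly ?sm //.
    rewrite big_ord_recr /= coef_map /= (_ : m`_d = 1) ?rmorph1 ?mul1r.
      by under eq_bigr do rewrite coef_map.
    by move: (monicP mm); rewrite lead_coefE sm.
  transitivity (\sum_(i < d.+1) phi (mu (Q i * x)) * z ^+ i).
    rewrite big_ord_recr /= Qd mul1r zd mulrN mulr_sumr -sumrB.
    apply: eq_bigr => i _.
    have -> : Q i.+1 * (z * x) = Q i * x - phi m`_i * x.
      by rewrite (QS i) mulrDl addrK mulrA [z * _]mulrC.
    by rewrite (linB muL) muZ rmorphB rmorphM mulrBl mulrA [phi (mu x) * _]mulrC.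
  rewrite big_ord_recl Q0 mul0r (lin0 muL) rmorph0 mul0r add0r mulr_sumr.
  by apply: eq_bigr => i _; rewrite /= exprS mulrCA.
- rewrite /nu big1 // => i _; rewrite mulr1 mu0 ?rmorph0 ?mul0r //.
  by exists (drop_poly i.+1 m).
apply/eqP => nut; case: d sm Qd @nu nut mmin => [|d] sm Qd nu nut mmin.
  by move/eqP: Q0; rewrite Qd oner_eq0.
have := mmin (\poly_(i < d.+1) mu (Q i.+1 * t)).
rewrite (@horner_coef_wide _ d.+1) ?size_map_poly ?size_poly // => H.
have /(congr1 (fun p : {poly F} => p`_d)) : \poly_(i < d.+1) mu (Q i.+1 * t) = 0.
  apply: H => //; rewrite -[RHS]nut; apply: eq_bigr => i _.
  by rewrite coef_map coef_poly ltn_ord.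
rewrite coef_poly ltnSn coef0 Qd mul1r mu1 => /eqP.
by rewrite oner_eq0.
Qed.

End Generator.
End SimpleExtension.

(** * Modules over a family of operators *)

Section Stable.
Variables (K : fieldType) (V : lmodType K) (I : Type) (op : I -> V -> V).

(** Invariance under the operators op i; submodules of every kind will be
    described in this way. *)
Definition stable (S : V -> Prop) : Prop :=
  subspace S /\ forall i x, S x -> S (op i x).

Hypothesis opL : forall i, linear (op i).

Inductive alg : (V -> V) -> Prop :=
| alg_id : alg id
| alg_comb a f g : alg f -> alg g -> alg (fun x => a *: f x + g x)
| alg_op i f : alg f -> alg (fun x => op i (f x)).

Lemma alg_linear f : alg f -> linear f.
Proof.
elim=> {f} [//|a f g _ fL _ gL|i f _ fL] b x y.
  by rewrite fL gL !scalerDr !scalerA [a * b]mulrC addrACA.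
by rewrite fL opL.
Qed.

Lemma alg_comp f g : alg f -> alg g -> alg (f \o g).
Proof.
move=> Af Ag; elim: Af => {f} [//|a f f' _ Af _ Af'|i f _ Af]; first exact: alg_comb.
exact: (alg_op i Af).
Qed.

Lemma alg_stable f S x : alg f -> stable S -> S x -> S (f x).
Proof.
move=> Af [subS Sop] Sx; elim: Af => {f} [//|a f g _ Sf _ Sg|i f _ Sf].
  by apply: subD => //; apply: subZ.
exact: Sop.
Qed.

Lemma cyclic_stable x : stable (fun y => exists2 f, alg f & y = f x).
Proof.
split; last by move=> i _ [f Af ->]; exists (fun x => op i (f x)) => //; apply: alg_op.
split=> [|a _ _ [f Af ->] [g Ag ->]].
  exists (fun x => -1 *: x + x); first exact: (alg_comb _ alg_id alg_id).
  by rewrite scaleN1r addNr.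
by exists (fun x => a *: f x + g x) => //; apply: alg_comb.
Qed.

Definition simple_module : Prop :=
  (exists x : V, x != 0) /\
  forall S, stable S -> (forall x, S x -> x = 0) \/ (forall x, S x).

Lemma simple_cyclic x y : simple_module -> x != 0 -> exists2 f, alg f & y = f x.
Proof.
move=> [_ simV] x0; case: (simV _ (cyclic_stable x)) => [z|]; last by apply.
by case/eqP: x0; apply: z; exists id => //; apply: alg_id.
Qed.

End Stable.

(** * The endomorphism ring *)

Section Endomorphisms.
Variables (F : fieldType) (V : lmodType F) (I : Type) (op : I -> V -> V).

Definition endo_pred : {pred V -> V} :=
  fun f => `[< linear f /\ forall i x, f (op i x) = op i (f x) >].

(** The type depends on the linearity of the operators and on the nontriviality
    of the module, so that its ring structure can be inferred. *)
Definition endo (opL : forall i, linear (op i)) (Vnz : exists x : V, x != 0) : Type :=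
  {f : V -> V | f \in endo_pred}.

Variables (opL : forall i, linear (op i)) (Vnz : exists x : V, x != 0).
Local Notation D := (endo opL Vnz).
HB.instance Definition _ := SubChoice.on D.

Definition ev (d : D) : V -> V := val d.

Lemma endo_linear (d : D) : linear (ev d).
Proof. by have /asboolP[] := valP d. Qed.

Lemma endo_op (d : D) i x : ev d (op i x) = op i (ev d x).
Proof. by have /asboolP[_] := valP d; apply. Qed.

Lemma endo_ext (d e : D) : ev d =1 ev e -> d = e.
Proof. by move=> de; apply: val_inj; apply: funext. Qed.

Definition mk_endo f (fL : linear f) (fop : forall i x, f (op i x) = op i (f x)) : D :=
  exist (fun f => f \in endo_pred) f (introT (asboolP _) (conj fL fop)).

Fact zero_linear : linear (fun _ : V => 0 : V).
Proof. by move=> a x y; rewrite scaler0 addr0. Qed.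
Fact zero_op i (x : V) : 0 = op i 0.
Proof. by rewrite (lin0 (opL i)). Qed.
Definition endo_zero : D := mk_endo zero_linear zero_op.

Fact opp_linear (d : D) : linear (fun x => - ev d x).
Proof. by move=> a x y; rewrite endo_linear opprD scalerN. Qed.
Fact opp_op (d : D) i x : - ev d (op i x) = op i (- ev d x).
Proof. by rewrite endo_op (linN (opL i)). Qed.
Definition endo_opp d : D := mk_endo (opp_linear d) (opp_op d).

Fact add_linear (d e : D) : linear (fun x => ev d x + ev e x).
Proof. by move=> a x y; rewrite !endo_linear scalerDr addrACA. Qed.
Fact add_op (d e : D) i x : ev d (op i x) + ev e (op i x) = op i (ev d x + ev e x).
Proof. by rewrite !endo_op (linD (opL i)). Qed.
Definition endo_add d e : D := mk_endo (add_linear d e) (add_op d e).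

Fact one_linear : linear (fun x : V => x). Proof. by []. Qed.
Definition endo_one : D := mk_endo one_linear (fun i x => erefl (op i x)).

Fact mul_linear (d e : D) : linear (fun x => ev d (ev e x)).
Proof. by move=> a x y; rewrite !endo_linear. Qed.
Fact mul_op (d e : D) i x : ev d (ev e (op i x)) = op i (ev d (ev e x)).
Proof. by rewrite !endo_op. Qed.
Definition endo_mul d e : D := mk_endo (mul_linear d e) (mul_op d e).

Fact endo_addA : associative endo_add.
Proof. by move=> d e f; apply: endo_ext => x; apply: addrA. Qed.
Fact endo_addC : commutative endo_add.
Proof. by move=> d e; apply: endo_ext => x; apply: addrC. Qed.
Fact endo_add0 : left_id endo_zero endo_add.
Proof. by move=> d; apply: endo_ext => x; apply: add0r. Qed.
Fact endo_addN : left_inverse endo_zero endo_opp endo_add.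
Proof. by move=> d; apply: endo_ext => x; apply: addNr. Qed.
HB.instance Definition _ :=
  GRing.isZmodule.Build D endo_addA endo_addC endo_add0 endo_addN.

Fact endo_mulA : associative endo_mul.
Proof. by move=> d e f; apply: endo_ext. Qed.
Fact endo_mul1 : left_id endo_one endo_mul.
Proof. by move=> d; apply: endo_ext. Qed.
Fact endo_mulr1 : right_id endo_one endo_mul.
Proof. by move=> d; apply: endo_ext. Qed.
Fact endo_mulDl : left_distributive endo_mul endo_add.
Proof. by move=> d e f; apply: endo_ext. Qed.
Fact endo_mulDr : right_distributive endo_mul endo_add.
Proof. by move=> d e f; apply: endo_ext => x; apply: (linD (endo_linear d)). Qed.
Fact endo_one_neq0 : endo_one != 0.
Proof.
have [x x0] := Vnz; apply: contra x0 => /eqP /(congr1 (fun d => ev d x)) xE.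
exact/eqP.
Qed.
HB.instance Definition _ := GRing.Zmodule_isNzRing.Build D endo_mulA endo_mul1
  endo_mulr1 endo_mulDl endo_mulDr endo_one_neq0.

Lemma evD d e x : ev (d + e) x = ev d x + ev e x. Proof. by []. Qed.
Lemma ev0 x : ev 0 x = 0. Proof. by []. Qed.
Lemma evM d e x : ev (d * e) x = ev d (ev e x). Proof. by []. Qed.

Lemma ev_sum J (r : seq J) (P : pred J) (E : J -> D) x :
  ev (\sum_(i <- r | P i) E i) x = \sum_(i <- r | P i) ev (E i) x.
Proof. exact: (big_morph (fun d => ev d x) (fun d e => evD d e x) (ev0 x)). Qed.

Fact scale_linear (a : F) : linear (fun x : V => a *: x).
Proof. by move=> b x y; rewrite scalerDr !scalerA mulrC. Qed.
Fact scale_op (a : F) i x : a *: op i x = op i (a *: x).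
Proof. by rewrite (linZ (opL i)). Qed.
Definition endo_scale a : D := mk_endo (scale_linear a) (scale_op a).

Lemma ev_scale a x : ev (endo_scale a) x = a *: x. Proof. by []. Qed.

Fact endo_scale_zmod : zmod_morphism endo_scale.
Proof. by move=> a b; apply: endo_ext => x; apply: scalerBl. Qed.
Fact endo_scale_monoid : monoid_morphism endo_scale.
Proof.
split=> [|a b]; apply: endo_ext => x; first exact: scale1r.
by rewrite evM !ev_scale scalerA.
Qed.
HB.instance Definition _ := GRing.isZmodMorphism.Build F D endo_scale endo_scale_zmod.
HB.instance Definition _ :=
  GRing.isMonoidMorphism.Build F D endo_scale endo_scale_monoid.

Lemma endo_scaleC a (d : D) : endo_scale a * d = d * endo_scale a.
Proof. by apply: endo_ext => x; rewrite !evM !ev_scale (linZ (endo_linear d)). Qed.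

Hypothesis simV : simple_module op.

(** Schur's lemma: the kernel and the image of an endomorphism are stable. *)
Lemma endo_bij (d : D) : d != 0 ->
  (forall x, ev d x = 0 -> x = 0) /\ (forall y, exists x, ev d x = y).
Proof.
move=> d0; have kerP : stable op (fun x => ev d x = 0).
  split; last by move=> i x dx; rewrite endo_op dx (lin0 (opL i)).
  split=> [|a x y dx dy]; first exact: (lin0 (endo_linear d)).
  by rewrite endo_linear dx dy scaler0 addr0.
have imP : stable op (fun y => exists x, ev d x = y).
  split; last by move=> i _ [x <-]; exists (op i x); rewrite endo_op.
  split=> [|a _ _ [x <-] [y <-]]; first by exists 0; apply: (lin0 (endo_linear d)).
  by exists (a *: x + y); rewrite endo_linear.
split.
  case: (simV.2 _ kerP) => // dz; case/eqP: d0; exact: endo_ext.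
case: (simV.2 _ imP) => // dz; case/eqP: d0; apply: endo_ext => x.
by rewrite ev0; apply: dz; exists x.
Qed.

Lemma endo_div (d : D) : d != 0 -> exists e, e * d = 1.
Proof.
move=> /endo_bij[inj surj]; have [f df] := choice surj.
have fE x y : ev d y = x -> f x = y.
  move=> dy; apply/eqP; rewrite -subr_eq0; apply/eqP/inj.
  by rewrite (linB (endo_linear d)) df dy subrr.
have fL : linear f by move=> a x y; apply: fE; rewrite endo_linear !df.
have fop i x : f (op i x) = op i (f x) by apply: fE; rewrite endo_op df.
by exists (mk_endo fL fop); apply: endo_ext => x; apply: fE.
Qed.

End Endomorphisms.

(** * Endomorphisms are algebraic *)

Section PolynomialAction.
Variables (F : fieldType) (V : lmodType F) (I : Type) (op : I -> V -> V).
Variables (opL : forall i, linear (op i)) (Vnz : exists x : V, x != 0).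
Local Notation D := (endo opL Vnz).
Variable d : D.

Fact endo_scale_comm : commr_rmorph (endo_scale opL Vnz) d.
Proof. by move=> a; rewrite /GRing.comm endo_scaleC. Qed.

Definition poly_endo : {poly F} -> D := horner_morph endo_scale_comm.

(** V as a module over the polynomials in d; the phantom argument lets the
    scaling operation be inferred. *)
Definition poly_space of D : Type := V.
Local Notation W := (poly_space d).
HB.instance Definition _ := GRing.Zmodule.on W.

Definition poly_scale (p : {poly F}) (x : W) : W :=
  ev (poly_endo p) x.

Fact poly_scaleA p q x : poly_scale p (poly_scale q x) = poly_scale (p * q) x.
Proof. by rewrite /poly_scale /poly_endo rmorphM. Qed.
Fact poly_scale1 : left_id 1 poly_scale.
Proof. by move=> x; rewrite /poly_scale /poly_endo rmorph1. Qed.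
Fact poly_scaleDr : right_distributive poly_scale +%R.
Proof. by move=> p x y; apply: (linD (endo_linear (poly_endo p))). Qed.
Fact poly_scaleDl x : {morph poly_scale^~ x : p q / p + q}.
Proof. by move=> p q; rewrite /poly_scale /poly_endo rmorphD. Qed.
HB.instance Definition _ := GRing.Zmodule_isLmodule.Build {poly F} W
  poly_scaleA poly_scale1 poly_scaleDr poly_scaleDl.

Lemma poly_spaceE (p : {poly F}) (x : W) : p *: x = ev (poly_endo p) x.
Proof. by []. Qed.

Lemma poly_spaceC a (x : W) : a%:P *: x = a *: (x : V) :> V.
Proof. by rewrite poly_spaceE /poly_endo horner_morphC. Qed.

End PolynomialAction.

Section Quillen.
Variables (F : fieldType) (V : lmodType F) (I : Type) (op : I -> V -> V).
Hypotheses (opL : forall i, linear (op i)) (simV : simple_module op).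
Variables (m : nat) (k : 'I_m -> I) (c : 'I_m -> 'I_m -> 'I_m -> F).
Hypothesis bracket : forall i j x,
  op (k i) (op (k j) x) - op (k j) (op (k i) x) = \sum_l c i j l *: op (k l) x.
Variables (n : nat) (g : 'I_n.+1 -> V).
Hypotheses (gmax : g ord_max = 0)
  (gen_g : forall x (S : V -> Prop), subspace S ->
    (forall l y, S y -> S (op (k l) y)) -> (forall j, S (g j)) -> S x).

(** Quillen's lemma.  Were d transcendental, V would be a vector space over
    F(d), hence divisible over F[d]. *)
Lemma endo_algebraic (d : endo opL simV.1) :
  exists p : {poly F}, p != 0 /\ poly_endo d p = 0.
Proof.
apply: contrapT => tr.
have bij (p : {poly F}) : p != 0 -> (forall x, ev (poly_endo d p) x = 0 -> x = 0) /\
    (forall y, exists x, ev (poly_endo d p) x = y).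
  move=> p0; apply: endo_bij => //; apply/eqP => dp; apply: tr.
  by exists p.
have [x /eqP[]] := simV.1; move: x.
suff : forall x : poly_space d, x = 0 by [].
apply: (@divisible_torsion_free_trivial F (poly_space d) m (fun l => op (k l))
  (fun i j l => (c i j l)%:P) _ _ n g gmax).
- by move=> l p x y; rewrite !poly_spaceE (linD (opL _)) endo_op.
- by move=> i j x; rewrite bracket; apply: eq_bigr => l _; rewrite poly_spaceC.
- move=> x S SD SZ Su Sg; apply: (@gen_g x S) => //.
  split=> [|a y z Sy Sz].
    by move: (SZ 0 _ (Sg ord0)); rewrite scale0r.
  by apply: SD => //; rewrite -(poly_spaceC a (y : poly_space d)); apply: SZ.
- by move=> p x p0; rewrite poly_spaceE; apply: (bij p p0).1.
by move=> p x p0; apply: (bij p p0).2.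
Qed.

End Quillen.

(** * Finiteness of the endomorphism ring *)

Section ScalarExtension.
Variables (F F' : fieldType) (j : {rmorphism F -> F'}) (V : lmodType F).
Variables (m : nat) (u : 'I_m -> V -> V) (c : 'I_m -> 'I_m -> 'I_m -> F).
Hypotheses (uL : forall l, linear (u l))
  (bracket : forall i k x, u i (u k x) - u k (u i x) = \sum_l c i k l *: u l x).
Variables (n : nat) (g : 'I_n.+1 -> V).
Hypothesis gen_g : forall x (S : V -> Prop), subspace S ->
  (forall l y, S y -> S (u l y)) -> (forall i, S (g i)) -> S x.

Lemma tens_bracket i k (x : tens j V) :
  tmap (u i) (tmap (u k) x) - tmap (u k) (tmap (u i) x)
  = \sum_l j (c i k l) *: tmap (u l) x.
Proof.
move: x; apply: tens_ind => [v r|x y IHx IHy].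
  rewrite !tmap_pure // -pureBl bracket pure_suml; apply: eq_bigr => l _.
  by rewrite pureZ tmap_pure // scale_pure.
rewrite !(tmapD (uL i), tmapD (uL k)) opprD addrACA IHx IHy -big_split.
by apply: eq_bigr => l _; rewrite (tmapD (uL l)) scalerDr.
Qed.

Lemma tens_generated (x : tens j V) (S : tens j V -> Prop) :
  (forall y z, S y -> S z -> S (y + z)) -> (forall r y, S y -> S (r *: y)) ->
  (forall l y, S y -> S (tmap (u l) y)) -> (forall i, S (pure j (g i) 1)) -> S x.
Proof.
move=> SD SZ Su Sg; move: x; apply: tens_ind => [v r|//].
rewrite pure_scale; apply: (SZ); apply: (@gen_g v (fun v => S (pure j v 1))) => //.
  split=> [|a y z Sy Sz].
    by rewrite pure0 -(scale0r (pure j (g ord0) 1)); apply: SZ.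
  by rewrite pureDl pureZ mulr1 pure_scale; apply: SD => //; apply: SZ.
by move=> l y Sy; rewrite -tmap_pure //; apply: Su.
Qed.

End ScalarExtension.

Section FieldOfEndomorphisms.
Variables (F E : fieldType) (iota : {rmorphism F -> E}) (V : lmodType F).
Variable act : E -> V -> V.
Hypotheses (actL : forall z, linear (act z))
  (actD : forall z w x, act (z + w) x = act z x + act w x)
  (actM : forall z w x, act (z * w) x = act z (act w x))
  (actC : forall a x, act (iota a) x = a *: x).

(** For K = F(z), the image of z (x) 1 - 1 (x) z is the kernel of the map from
    V (x)_F E to V (x)_K E. *)
Definition relation_space (z : E) (y : tens iota V) : Prop :=
  exists t : tens iota V, y = tmap (act z) t - z *: t.

Let tactL z := tmap_linear (phi := iota) (actL z).

Lemma relation_subspace z : subspace (relation_space z).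
Proof.
split=> [|a _ _ [s ->] [t ->]].
  by exists 0; rewrite (lin0 (tactL z)) scaler0 subr0.
exists (a *: s + t); rewrite (tactL z) [z *: (_ + _)]scalerDr scalerBr opprD addrACA.
by rewrite !scalerA [z * a]mulrC.
Qed.

Lemma relation_space_op (f : V -> V) z y : linear f ->
  (forall x, act z (f x) = f (act z x)) ->
  relation_space z y -> relation_space z (tmap f y).
Proof.
move=> fL zf [t ->]; have tfL := tmap_linear (phi := iota) fL.
exists (tmap f t); rewrite (linB tfL) (linZ tfL) !tmap_comp //.
by congr (_ - _); apply: eq_tmap => x /=.
Qed.

(** If w is a polynomial in z, then w (x) 1 - 1 (x) w is a multiple of
    z (x) 1 - 1 (x) z. *)
Lemma relation_space_adjoined z w :
  adjoined iota z w -> forall y, relation_space w y -> relation_space z y.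
Proof.
have zsub := relation_subspace z.
pose P w := forall t : tens iota V, relation_space z (tmap (act w) t - w *: t).
suff PX q : P (map_poly iota q).[z] by move=> [q ->] _ [t ->]; apply: PX.
have PC a : P (iota a).
  move=> t; suff -> : tmap (act (iota a)) t = iota a *: t.
    by rewrite subrr; apply: sub0.
  move: t; apply: tens_eq => [x y|x y|v r]; first exact: tmapD.
    exact: scalerDr.
  by rewrite tmap_pure // scale_pure -pureZ actC.
have PD v v' : P v -> P v' -> P (v + v').
  move=> Pv Pv' t; have := subD zsub (Pv t) (Pv' t).
  rewrite addrACA -opprD -scalerDl; congr (relation_space z (_ - _)).
  move: t; apply: tens_eq => [x y|x y|x r].
  - by rewrite !tmapD // addrACA.
  - exact: tmapD.
  by rewrite !tmap_pure // -pureDl actD.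
have PMz v : P v -> P (v * z).
  move=> Pv t; have zvt : relation_space z (tmap (act v) (tmap (act z) t - z *: t)).
    apply: relation_space_op => // [x|]; first by rewrite -!actM mulrC.
    by exists t.
  have := subD zsub zvt (subZ zsub z (Pv t)).
  rewrite (linB (tactL v)) (linZ (tactL v)) scalerBr addrA subrK scalerA.
  rewrite tmap_comp // [z * v]mulrC; congr (relation_space z (_ - _)).
  by apply: eq_tmap => x; rewrite /= actM.
elim/poly_ind: q => [|q a IH].
  by rewrite rmorph0 horner0 -[0](rmorph0 iota).
rewrite rmorphD rmorphM /= map_polyX map_polyC hornerMXaddC.
exact: PD (PMz _ IH) (PC a).
Qed.

(** A vector of V (x)_F E of the form w x (x) 1 - x (x) w dies in V (x)_K E
    only if w lies in K = F(z): apply a K-linear functional on E. *)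
Lemma relation_space_separation z w x : algebraicOver iota z -> x != 0 ->
  relation_space z (tmap (act w) (pure iota x 1) - w *: pure iota x 1) ->
  adjoined iota z w.
Proof.
move=> algz x0 [t tE]; apply: contrapT => /(adjoined_separation algz).
case=> nu [nuD nuZ nuz nu1 nuw].
pose b (v : V) r := act (nu r) v.
have bP : balanced iota b.
  split=> [v v' r|v r s|a v r]; first exact: (linD (actL _)).
    by rewrite /b nuD actD.
  by rewrite /b nuZ mulrC actM actC.
have bD (y y' : tens iota V) : tlift b (y + y') = tlift b y + tlift b y'.
  exact: tliftD.
have bB (v v' : tens iota V) : tlift b (v - v') = tlift b v - tlift b v'.
  by apply/(addIr (tlift b v')); rewrite -bD !subrK.
have bz : tlift b (tmap (act z) t - z *: t) = 0.
  rewrite bB; apply/eqP; rewrite subr_eq0; apply/eqP.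
  move: (t); apply: tens_eq => [y y'|y y'|v r].
  - by rewrite tmapD // bD.
  - by rewrite scalerDr bD.
  by rewrite tmap_pure // scale_pure !tlift_pure // /b nuz [z * _]mulrC actM.
move: bz; rewrite -tE bB tmap_pure // scale_pure mulr1 !tlift_pure // /b nu1.
rewrite -(rmorph0 iota) actC scale0r sub0r => /eqP; rewrite oppr_eq0 => /eqP nux.
case/eqP: x0; rewrite -[x]scale1r -actC rmorph1 -(mulVf nuw) actM nux.
exact: (lin0 (actL _)).
Qed.

Variables (m : nat) (u : 'I_m -> V -> V) (c : 'I_m -> 'I_m -> 'I_m -> F).
Hypotheses (uL : forall l, linear (u l))
  (bracket : forall i k x, u i (u k x) - u k (u i x) = \sum_l c i k l *: u l x).
Variables (n : nat) (g : 'I_n.+1 -> V).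
Hypotheses (gmax : g ord_max = 0)
  (gen_g : forall x (S : V -> Prop), subspace S ->
    (forall l y, S y -> S (u l y)) -> (forall i, S (g i)) -> S x).
Hypothesis act_u : forall z l x, act z (u l x) = u l (act z x).

(** A maximal relation space contains all others, since any two of them lie in
    the relation space of a common primitive element. *)
Lemma field_of_endomorphisms_simple :
  [pchar F] =i pred0 -> (forall z, algebraicOver iota z) -> (exists x : V, x != 0) ->
  exists z, forall w, adjoined iota z w.
Proof.
move=> char0 algE [x x0].
have [z0 z0max] : exists z0, forall z,
    (forall y, relation_space z0 y -> relation_space z y) ->
    forall y, relation_space z y -> relation_space z0 y.
  apply: (@noetherian_family E (tens iota V) m (fun l => tmap (u l))
    (fun i j l => iota (c i j l)) _ _ n (fun i => pure iota (g i) 1)).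
  - by move=> l; apply: tmap_linear.
  - by move=> i j y; apply: tens_bracket.
  - by rewrite gmax pure0.
  - move=> y S SD SZ Su Sg.
    exact: (@tens_generated _ _ iota V m u uL n g gen_g y S SD SZ Su Sg).
  - exact: 0.
  by move=> z; split=> [|l y]; [apply: relation_subspace|apply: relation_space_op].
exists z0 => w; apply: (relation_space_separation (algE z0) x0).
have [z [zz0 zw]] := adjoined_pair char0 algE z0 w.
apply: (z0max z); first by move=> y; apply: relation_space_adjoined zz0 y.
by apply: (relation_space_adjoined zw); exists (pure iota x 1).
Qed.

End FieldOfEndomorphisms.

Section FiniteEndomorphisms.
Variables (F : fieldType) (V : lmodType F) (I : Type) (op : I -> V -> V).
Hypotheses (opL : forall i, linear (op i)) (simV : simple_module op).
Variables (m : nat) (k : 'I_m -> I) (c : 'I_m -> 'I_m -> 'I_m -> F).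
Hypothesis bracket : forall i j x,
  op (k i) (op (k j) x) - op (k j) (op (k i) x) = \sum_l c i j l *: op (k l) x.
Variables (n : nat) (g : 'I_n.+1 -> V).
Hypotheses (gmax : g ord_max = 0)
  (gen_g : forall x (S : V -> Prop), subspace S ->
    (forall l y, S y -> S (op (k l) y)) -> (forall j, S (g j)) -> S x).
Hypothesis char0 : [pchar F] =i pred0.

(** A maximal subfield is generated by one algebraic element, hence finite over
    F, and bounds the dimension of the endomorphism ring. *)
Lemma endo_finite : exists N (e : 'I_N -> endo opL simV.1),
  forall d, exists c : 'I_N -> F, d = \sum_i endo_scale opL simV.1 (c i) * e i.
Proof.
have [L0 L0P] := max_commutative (endo opL simV.1).
pose L := MaximalSubfield L0P (endo_div simV).
pose iota : {rmorphism F -> mfield L} :=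
  mfield_scalar L (@endo_scaleC F V I op opL simV.1).
have alg (z : mfield L) : algebraicOver iota z.
  have [p [p0 pz]] := endo_algebraic bracket gmax gen_g (mval z).
  exists p => //; apply/rootP/mval_inj.
  by rewrite -horner_map -map_poly_comp; apply: etrans pz _.
have [z zP] := @field_of_endomorphisms_simple F (mfield L) iota V
  (fun z => ev (mval z)) (fun z => endo_linear _) (fun z w x => erefl)
  (fun z w x => erefl) (fun a x => erefl) m (fun l => op (k l)) c
  (fun l => opL (k l)) bracket n g gmax gen_g (fun z l => endo_op _ _)
  char0 alg simV.1.
have [d dP] := adjoined_span (alg z).
apply: (finite_over_center (endo_div simV) L0P (endo_scaleC (Vnz := simV.1))
  (l := fun i : 'I_d => mval (z ^+ i))) => x Lx.
pose y : mfield L := Sub x (introT (asboolP _) Lx).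
have [a ya] := dP y (zP y); exists a.
have -> : x = mval y by [].
rewrite ya raddf_sum; apply: eq_bigr => i _.
exact: (rmorphM (@mval _ L)).
Qed.

End FiniteEndomorphisms.

(** * Extensions of a simple module *)

Section SimpleExtensionRank.
Variables (F F' : fieldType) (j : {rmorphism F -> F'}) (V : lmodType F).
Variables (I : Type) (op : I -> V -> V).
Hypotheses (opL : forall i, linear (op i)) (simV : simple_module op).

Local Notation tstable := (stable (fun i => tmap (phi := j) (op i))).

Lemma alg_tstable f N x : alg op f -> tstable N -> N x -> N (tmap f x).
Proof.
move=> Af [subN Nop] Nx; elim: Af => {f} [|a f g Af Nf Ag Ng|i f Af Nf].
- suff -> : tmap id x = x by [].
  by move: x {Nx}; apply: tens_eq => [x y|//|v r]; [apply: tmapD|rewrite tmap_pure].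
- suff -> : tmap (fun v => a *: f v + g v) x = j a *: tmap f x + tmap g x.
    exact: subN.2.
  have [fL gL] := (alg_linear opL Af, alg_linear opL Ag).
  have fgL := alg_linear opL (alg_comb a Af Ag).
  move: x {Nx Nf Ng}; apply: tens_eq => [x y|x y|v r]; first exact: tmapD.
    by rewrite !tmapD // scalerDr addrACA.
  by rewrite !tmap_pure // pureDl pureZ scale_pure.
have fL := alg_linear opL Af.
by rewrite -[tmap _ x](tmap_comp (g := f) x (opL i) fL); apply: Nop.
Qed.

(** For x != 0 this is the orbit of x under the endomorphism ring; the
    condition on annihilators is the one that arises from operators. *)
Definition ann_space (x y : V) : Prop := forall f, alg op f -> f x = 0 -> f y = 0.

Lemma ann_space_endo x y : x != 0 -> ann_space x y ->
  exists d : endo opL simV.1, y = ev d x.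
Proof.
move=> x0 xy.
have ex_f v : exists f, alg op f /\ v = f x.
  by have [f Af vE] := simple_cyclic v simV x0; exists f.
have [f fP] := choice ex_f.
have fE h v : alg op h -> h x = v -> f v y = h y.
  move=> Ah hx; have [Af vE] := fP v.
  have := xy _ (alg_comb (-1) Ah Af); rewrite hx -vE scaleN1r addNr => /(_ erefl).
  by rewrite scaleN1r addrC => /eqP; rewrite subr_eq0 => /eqP.
have fL : linear (fun v => f v y).
  move=> a u v; apply: (fE (fun z => a *: f u z + f v z)).
    by apply: alg_comb; apply: (fP _).1.
  by rewrite -!(fP _).2.
have fop i v : f (op i v) y = op i (f v y).
  by apply: (fE (fun z => op i (f v z))); [apply/alg_op/(fP _).1|rewrite -(fP _).2].
by exists (mk_endo opL simV.1 fL fop); symmetry; apply: (fE id) => //; apply: alg_id.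
Qed.

(** Every stable subspace N of V (x) F' is generated by its intersection with
    (ann_space x) (x) F'.  The proof is by induction on the number of pure
    tensors in an element of N: either some operator kills one component but
    not all, and the element splits as a sum of two shorter ones, or all
    components are images of the first one under endomorphisms. *)
Lemma tstable_generated x N N' : x != 0 -> tstable N -> tstable N' ->
  (forall t, N t -> extset (ann_space x) t -> N' t) -> forall t, N t -> N' t.
Proof.
move=> x0 stN stN' NN'.
have [subN _] := stN; have [subN' _] := stN'.
suff IH n (v : 'I_n -> V) (r : 'I_n -> F') :
    N (\sum_i pure j (v i) (r i)) -> N' (\sum_i pure j (v i) (r i)).
  move=> t; rewrite [t]tens_sum (big_nth (0, 0)) big_mkord; exact: IH.
elim: n v r => [|n IH] v r Nv; first by rewrite big_ord0; apply: sub0.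
set t := \sum_i _ in Nv *.
have tmap_t f : alg op f -> tmap f t = \sum_i pure j (f (v i)) (r i).
  move=> Af; have fL := alg_linear opL Af.
  rewrite (lin_sum (tmap_linear (phi := j) fL)).
  by apply: eq_bigr => i _; rewrite tmap_pure.
have drop i0 f : alg op f -> f (v i0) = 0 -> N' (tmap f t).
  move=> Af fv; have := alg_tstable Af stN Nv.
  rewrite tmap_t // (bigD1_ord i0) //= fv pure0 add0r; exact: IH.
have [[f [Af f0 [i fi]]]|nof] := pselect (exists f, [/\ alg op f, f (v ord0) = 0 &
    exists i, f (v i) != 0]).
  have [g Ag vE] := simple_cyclic (v i) simV fi.
  have Agf := alg_comp Ag Af.
  have N'w : N' (tmap (g \o f) t).
    by apply: (drop ord0) => //=; rewrite f0 (lin0 (alg_linear opL Ag)).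
  rewrite -[t](subrK (tmap (g \o f) t)); apply: subD => //.
  have Ah : alg op (fun y => -1 *: (g \o f) y + y) := alg_comb _ Agf (alg_id op).
  suff -> : t - tmap (g \o f) t = tmap (fun y => -1 *: (g \o f) y + y) t.
    by apply: (drop i) => //=; rewrite -vE scaleN1r addNr.
  rewrite !tmap_t // /t -sumrB; apply: eq_bigr => l _.
  by rewrite pureDl addrC; congr (_ + _); rewrite pureZ rmorphN1 -scale_pure scaleN1r.
have kill f : alg op f -> f (v ord0) = 0 -> forall i, f (v i) = 0.
  move=> Af f0 i; apply/eqP/negPn/negP => fi; apply: nof.
  by exists f; split=> //; exists i.
have [v0|v0] := eqVneq (v ord0) 0.
  rewrite /t big1; first exact: sub0.
  by move=> i _; rewrite (kill id (alg_id op) v0) pure0.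
have [f Af fx] := simple_cyclic x simV v0.
have [g Ag gv] := simple_cyclic (v ord0) simV x0.
have vE i : v i = g (f (v i)).
  have := kill _ (alg_comb (-1) (alg_comp Ag Af) (alg_id op)).
  rewrite /= -fx -gv scaleN1r addNr => /(_ erefl i).
  by rewrite scaleN1r => /eqP; rewrite addrC subr_eq0 => /eqP.
have -> : t = tmap g (tmap f t).
  rewrite tmap_t // (lin_sum (tmap_linear (phi := j) (alg_linear opL Ag))).
  by apply: eq_bigr => i _; rewrite (tmap_pure _ (alg_linear opL Ag)) -vE.
apply: (alg_tstable Ag stN'); apply: NN'; first exact: alg_tstable.
rewrite tmap_t //; apply: (big_ind (extset _)) => [|y z|i _].
- exact: extset0.
- exact: extsetD.
apply: extset_pure => h Ah hx; apply: (kill (h \o f)); first exact: alg_comp.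
by rewrite /= -fx.
Qed.

Variables (m : nat) (k : 'I_m -> I) (c : 'I_m -> 'I_m -> 'I_m -> F).
Hypothesis bracket : forall i j x,
  op (k i) (op (k j) x) - op (k j) (op (k i) x) = \sum_l c i j l *: op (k l) x.
Variables (n : nat) (g : 'I_n.+1 -> V).
Hypotheses (gmax : g ord_max = 0)
  (gen_g : forall x (S : V -> Prop), subspace S ->
    (forall l y, S y -> S (op (k l) y)) -> (forall j, S (g j)) -> S x).
Hypothesis char0 : [pchar F] =i pred0.

(** The rank of N is the dimension of its intersection with the finite
    dimensional space (ann_space x) (x) F', counted by leading indices. *)
Lemma simple_extension_rank : exists r, is_rank tstable r.
Proof.
have [x x0] := simV.1.
have [d [e eP]] := endo_finite opL simV bracket gmax gen_g char0.
(* Vectors of index at least d are 0, so that d bounds all indices strictly. *)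
pose b i : tens j V := if insub i is Some i' then pure j (ev (e i') x) 1 else 0.
have b_big i : (d <= i)%N -> b i = 0 by move=> di; rewrite /b insubF // ltnNge di.
have ltn_tot i l : (i < l)%N \/ i = l \/ (l < i)%N.
  by case: ltngtP; [left|right; right|right; left].
have ltn_wf : well_founded (fun i l => (i < l)%N).
  by move=> i; elim/ltn_ind: i => i IH; constructor.
have b_low t : extset (ann_space x) t -> low (fun i l => (i < l)%N) b d t.
  apply: extset_ind => [|v r|y z]; [exact: low0| |exact: lowD].
  move=> /(ann_space_endo x0)[f ->]; have [a ->] := eP f.
  rewrite ev_sum pure_suml; apply: (big_ind (low _ _ _)) => [|y z|i _].
  - exact: low0.
  - exact: lowD.
  rewrite evM ev_scale pureZ pure_scale; apply: lowZ.
  have -> : pure j (ev (e i) x) 1 = b i by rewrite /b valK.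
  exact: low_e.
pose lead N i := leading (fun i l => (i < l)%N) b N i.
exists (fun N => #|[set i : 'I_d | `[< lead N i >]]|) => N N' stN stN' NN'.
have leadNN' i : lead N i -> lead N' i by case=> y Ny ly; exists y => //; apply: NN'.
have sub : [set i : 'I_d | `[< lead N i >]] \subset [set i : 'I_d | `[< lead N' i >]].
  by apply/subsetP => i /[!inE] /asboolP /leadNN' ?; apply/asboolP.
split=> [|le_card]; first exact: subset_leq_card.
have eq_lead : [set i : 'I_d | `[< lead N i >]] = [set i : 'I_d | `[< lead N' i >]].
  by apply/eqP; rewrite eqEcard sub.
have leadN'N i : lead N' i -> lead N i.
  have [lt_id|le_di] := ltnP i d; last first.
    move=> _; exists 0; first exact: (sub0 stN.1).
    by rewrite b_big // subr0; apply: low0.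
  move=> leadi; have : Ordinal lt_id \in [set i : 'I_d | `[< lead N i >]].
    by rewrite eq_lead inE; apply/asboolP.
  by rewrite inE => /asboolP.
apply: (tstable_generated x0) => // t N't /b_low lt.
exact: (leading_inj ltn_wf ltn_tot stN.1 stN'.1 NN' leadN'N lt).
Qed.

End SimpleExtensionRank.

(** * Subquotients *)

Section SubspaceType.
Variables (F : fieldType) (V : lmodType F) (S : V -> Prop) (subS : subspace S).

Definition subspace_pred of subspace S : {pred V} := fun x => `[< S x >].
Local Notation P := (subspace_pred subS).

Fact subspace_pred_closed : submod_closed P.
Proof.
split=> [|a x y /asboolP Sx /asboolP Sy]; apply/asboolP; first exact: sub0.
exact: subS.2.
Qed.
HB.instance Definition _ := GRing.isSubmodClosed.Build F V P subspace_pred_closed.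

Definition subspace_type : Type := {x : V | x \in P}.
HB.instance Definition _ := SubChoice.on subspace_type.
HB.instance Definition _ := [SubChoice_isSubLmodule of subspace_type by <:].

Definition sub_val (x : subspace_type) : V := val x.

Lemma sub_val_linear : linear sub_val. Proof. exact: linearP. Qed.

Lemma sub_valP x : S (sub_val x). Proof. exact/asboolP/(valP x). Qed.

Lemma sub_val_surj x : S x -> exists y, sub_val y = x.
Proof. by move=> Sx; exists (exist _ x (introT (asboolP _) Sx)). Qed.

End SubspaceType.

Lemma complement (F : fieldType) (V : lmodType F) (S T : V -> Prop) :
  subspace S -> subspace T -> (forall x, S x -> T x) ->
  exists C : V -> Prop, [/\ subspace C, forall x, C x -> T x,
    forall x, C x -> S x -> x = 0
    & forall x, T x -> exists y z, [/\ C y, S z & x = y + z]].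
Proof.
move=> subS subT ST.
pose good (C : V -> Prop) := subspace (fun x => x = 0 \/ C x) /\
  forall x, C x -> T x /\ (S x -> x = 0).
have [|A [[subA AP] Amax]] := @classical_sets.Zorn_bigcup V good.
  move=> Fam goodF totF; split; last by move=> x [X FX Xx]; apply: (goodF X FX).2.
  split=> [|a x y]; first by left.
  have inX X : Fam X -> a *: x + y = 0 \/ X (a *: x + y) ->
      a *: x + y = 0 \/ classical_sets.bigcup Fam id (a *: x + y).
    by move=> FX [|Xz]; [left|right; exists X].
  case=> [x0|[X FX Xx]] [y0|[Y FY Yy]].
  - by left; rewrite x0 y0 scaler0 addr0.
  - by apply: (inX Y) => //; apply: (goodF Y FY).1.2; [left|right].
  - by apply: (inX X) => //; apply: (goodF X FX).1.2; [right|left].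
  have [XY|YX] := totF _ _ FX FY.
    by apply: (inX Y) => //; apply: (goodF Y FY).1.2; right => //; apply: XY.
  by apply: (inX X) => //; apply: (goodF X FX).1.2; right => //; apply: YX.
pose C x := x = 0 \/ A x.
have CP x : C x -> T x /\ (S x -> x = 0).
  by case=> [->|/AP //]; split=> //; apply: sub0.
exists C; split=> // [x /CP[]//|x /CP[]//|x Tx].
apply: contrapT => nox.
pose B z := exists c : F, C (z - c *: x).
apply: (Amax B).
  split; first by move=> z Az; exists 0; rewrite scale0r subr0; right.
  move=> BA; apply: nox; exists x, 0; rewrite addr0; split=> //; last exact: sub0.
  right; apply: BA; exists 1; rewrite scale1r subrr; exact: (sub0 subA).
have BE z : z = 0 \/ B z -> B z.
  by case=> // ->; exists 0; rewrite scale0r subr0; left.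
split.
  split=> [|a y z /BE[c Cc] /BE[d Cd]]; first by left.
  right; exists (a * c + d); rewrite scalerDl -scalerA opprD addrACA -scalerBr.
  exact: (subA.2 _ _ _ Cc Cd).
move=> z [c Cc]; split.
  by rewrite -(subrK (c *: x) z); apply: (subD subT); [case: (CP _ Cc)|apply: subZ].
move=> Sz; have [c0|c0] := eqVneq c 0.
  by move: Cc; rewrite c0 scale0r subr0 => /CP[_]; apply.
case: nox; exists (- c^-1 *: (z - c *: x)), (c^-1 *: z); split.
- exact: (subZ subA).
- exact: subZ.
by rewrite scalerBr !scaleNr scalerA mulVf // scale1r opprK addrAC addNr add0r.
Qed.

Section Subquotient.
Variables (F : fieldType) (V : lmodType F) (I : Type) (op : I -> V -> V).
Hypothesis opL : forall i, linear (op i).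

(** The subquotient T / S, realized on a complement Q of S in T; the inclusion
    of Q in V commutes with the operators modulo S. *)
Lemma subquotient (S T : V -> Prop) :
  stable op S -> stable op T -> (forall x, S x -> T x) ->
  exists (Q : lmodType F) (opQ : I -> Q -> Q) (s : Q -> V),
  [/\ forall i, linear (opQ i), linear s, forall q, T (s q) /\ (S (s q) -> q = 0),
      forall x, T x -> exists q y, S y /\ x = s q + y
    & forall i q, S (op i (s q) - s (opQ i q))].
Proof.
move=> [subS opS] [subT opT] ST.
have [C [subC CT CS CTS]] := complement subS subT ST.
pose Q : lmodType F := subspace_type subC.
pose s : Q -> V := @sub_val _ _ _ subC.
have sL : linear s by exact: sub_val_linear.
have sS q : S (s q) -> q = 0.
  move=> Sq; apply: val_inj; apply: CS => //; exact: sub_valP.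
have dec x : T x -> exists q y, S y /\ x = s q + y.
  by move=> /CTS[y [z [/(sub_val_surj subC)[q <-] Sz ->]]]; exists q, z.
have sT q : T (s q) by apply: CT; apply: sub_valP.
have ex_op i : exists f : Q -> Q, forall q, S (op i (s q) - s (f q)).
  have H q : exists q', S (op i (s q) - s q').
    have [q' [y [Sy ->]]] := dec _ (opT i _ (sT q)); exists q'.
    by rewrite addrC addKr.
  by have [f fP] := choice H; exists f.
have [opQ opQP] := choice ex_op.
exists Q, opQ, s.
split; [|exact: sL|by move=> q; split; [exact: sT|exact: sS]|exact: dec|exact: opQP].
move=> i a q q'.
apply/eqP; rewrite -subr_eq0; apply/eqP/sS; rewrite (linB sL) sL.
have := subB subS (subD subS (subZ subS a (opQP i q)) (opQP i q'))
  (opQP i (a *: q + q')).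
by rewrite sL opL scalerBr addrACA -opprD opprB [X in S X -> _]addrC addrA subrK.
Qed.

End Subquotient.

(** * Extensions of a module of finite length *)

Section ExtensionRank.
Variables (F F' : fieldType) (j : {rmorphism F -> F'}) (V : lmodType F).
Variables (I : Type) (op : I -> V -> V).
Hypothesis opL : forall i, linear (op i).
Variables (m : nat) (k : 'I_m -> I) (c : 'I_m -> 'I_m -> 'I_m -> F).
Hypothesis bracket : forall i j x,
  op (k i) (op (k j) x) - op (k j) (op (k i) x) = \sum_l c i j l *: op (k l) x.
Hypothesis char0 : [pchar F] =i pred0.

Definition lie_gen (s : seq V) (x : V) : Prop := forall S : V -> Prop,
  subspace S -> (forall l y, S y -> S (op (k l) y)) ->
  (forall y, y \in s -> S y) -> S x.

(** The leading term argument knows only the Lie algebra, so cyclic modules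
    for all operators must be finitely generated over it. *)
Hypothesis fin_gen : forall x, exists s,
  [/\ forall S, stable op S -> S x -> forall y, y \in s -> S y,
      lie_gen s x & forall i y, lie_gen s y -> lie_gen s (op i y)].

Local Notation tstable := (stable (fun i => tmap (phi := j) (op i))).

Lemma lie_gen_subspace s : subspace (lie_gen s).
Proof.
split=> [S subS _ _|a x y sx sy S subS Su Ss]; first exact: sub0.
by apply: subS.2; [apply: sx|apply: sy].
Qed.

(** The rank of N on a simple subquotient Q = T / S is the rank of the image of
    N in Q (x) F'. *)
Lemma step_rank (S T : V -> Prop) : stable op S -> stable op T ->
  covers (stable op) S T -> exists r : (tens j V -> Prop) -> nat,
  forall N N', tstable N -> tstable N' -> (forall x, N x -> N' x) ->
    (r N <= r N')%N /\ ((r N' <= r N)%N -> forall x, N' x -> extset T x ->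
      exists y, N y /\ extset S (x - y)).
Proof.
move=> stS stT [ST [x0 Tx0 Sx0] covST].
have [Q [opQ [s [opQL sL sP dec opQP]]]] := subquotient opL stS stT ST.
have [subS opS] := stS; have [subT opT] := stT.
have s_inj q q' : S (s q - s q') -> q = q'.
  by rewrite -(linB sL) => /(sP _).2 /eqP; rewrite subr_eq0 => /eqP.
have op_dec i q y : S y -> S (op i (s q + y) - s (opQ i q)).
  move=> Sy; rewrite (linD (opL i)) addrAC; apply: (subD subS) => //.
  exact: opS.
have simQ : simple_module opQ.
  split.
    have [q [y [Sy x0E]]] := dec x0 Tx0; exists q; apply/eqP => q0; apply: Sx0.
    by rewrite x0E q0 (lin0 sL) add0r.
  move=> D [subD' opD].
  pose D' x := exists q y, [/\ D q, S y & x = s q + y].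
  have SD' x : S x -> D' x.
    by move=> Sx; exists 0, x; rewrite (lin0 sL) add0r; split=> //; apply: sub0.
  have stD' : stable op D'.
    split.
      split=> [|a _ _ [q [y [Dq Sy ->]]] [q' [y' [Dq' Sy' ->]]]].
        by apply: SD'; apply: sub0.
      exists (a *: q + q'), (a *: y + y'); split; [exact: subD'.2|exact: subS.2|].
      by rewrite sL scalerDr addrACA.
    move=> i _ [q [y [Dq Sy ->]]]; exists (opQ i q), (op i (s q + y) - s (opQ i q)).
    by split; [exact: opD|exact: op_dec|rewrite [RHS]addrC subrK].
  case: (covST D' stD' SD') => [x [q [y [Dq Sy ->]]]|D'S|TD'].
  - by apply: (subD subT); [case: (sP q)|apply: ST].
  - left=> q Dq; apply: (sP q).2; apply: D'S; exists q, 0; rewrite addr0.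
    by split=> //; apply: sub0.
  right=> q; have [q' [y [Dq' Sy sq]]] := TD' _ (sP q).1.
  by have -> // : q = q' by apply: s_inj; rewrite sq addrC addKr.
have bracketQ i l q : opQ (k i) (opQ (k l) q) - opQ (k l) (opQ (k i) q)
    = \sum_h c i l h *: opQ (k h) q.
  have op2 i1 l1 : S (op i1 (op l1 (s q)) - s (opQ i1 (opQ l1 q))).
    have H : op l1 (s q) = s (opQ l1 q) + (op l1 (s q) - s (opQ l1 q)).
      by rewrite addrC subrK.
    by rewrite {1}H; apply: op_dec; apply: opQP.
  have transS x y z : S (x - y) -> S (x - z) -> S (y - z).
    move=> xy xz; have := subB subS xz xy.
    by rewrite opprB addrC addrA subrK.
  apply: s_inj; rewrite (linB sL) (lin_sum sL).
  apply: (transS (op (k i) (op (k l) (s q)) - op (k l) (op (k i) (s q)))).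
    by rewrite opprD addrACA -opprD; apply: subB.
  rewrite bracket -sumrB; apply: (sub_sum subS) => h _.
  by rewrite (linZ sL) -scalerBr; apply: subZ.
have [ss [ssT ssx ssop]] := fin_gen x0.
have ex_q x : exists q, T x -> S (x - s q).
  have [Tx|nTx] := pselect (T x); last by exists 0.
  by have [q [y [Sy ->]]] := dec x Tx; exists q; rewrite addrAC subrr add0r.
have [cl clP] := choice ex_q.
pose g (i : 'I_(size ss).+1) := nth 0 (map cl ss) i.
have gmax : g ord_max = 0 by rewrite /g nth_default // size_map.
have gen_g q (P : Q -> Prop) : subspace P ->
    (forall l q, P q -> P (opQ (k l) q)) -> (forall i, P (g i)) -> P q.
  move=> subP opP Pg.
  pose R x := exists q', P q' /\ S (x - s q').
  have SR x : S x -> R x.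
    by exists 0; rewrite (lin0 sL) subr0; split=> //; apply: sub0.
  have genR x : lie_gen ss x -> R x.
    apply.
    - split=> [|a y z [q1 [P1 S1]] [q2 [P2 S2]]]; first by apply: SR; apply: sub0.
      exists (a *: q1 + q2); split; first exact: subP.2.
      by rewrite sL opprD addrACA -scalerBr; apply: subS.2.
    - move=> l y [q1 [P1 S1]]; exists (opQ (k l) q1); split; first exact: (opP l q1 P1).
      have -> : y = s q1 + (y - s q1) by rewrite addrC subrK.
      exact: op_dec.
    move=> y yss; exists (cl y); split; last by apply: clP; apply: (ssT T).
    have := Pg (inord (index y ss)).
    by rewrite /g inordK ?ltnS ?index_size // (nth_map 0) ?index_mem // nth_index.
  (* By simplicity of T / S, the Lie algebra generates T from x0 modulo S. *)
  pose W x := T x /\ exists y, lie_gen ss y /\ S (x - y).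
  have stW : stable op W.
    split; last first.
      move=> i x [Tx [y [yss Sxy]]]; split; first exact: opT.
      exists (op i y); split; first exact: ssop.
      by rewrite -(linB (opL i)); apply: opS.
    split=> [|a x x' [Tx [y [yss Sxy]]] [Tx' [y' [yss' Sxy']]]].
      split; first exact: sub0.
      by exists 0; rewrite subr0; split; [exact: sub0 (lie_gen_subspace ss)|apply: sub0].
    split; first exact: subT.2.
    exists (a *: y + y'); split; first exact: (lie_gen_subspace ss).2.
    by rewrite opprD addrACA -scalerBr; apply: subS.2.
  have [x Sx|x []//|WS|TW] := covST W stW.
  - split; first exact: ST.
    by exists 0; rewrite subr0; split=> //; exact: (sub0 (lie_gen_subspace ss)).
  - case: Sx0; apply: WS; split=> //; exists x0; split=> //.
    by rewrite subrr; apply: sub0.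
  have [_ [y [/genR[q' [Pq' Syq']] Sqy]]] := TW _ (sP q).1.
  have -> // : q = q'.
  by apply: s_inj; have := subD subS Sqy Syq'; rewrite addrA subrK.
have [r rP] := simple_extension_rank j opQL simQ bracketQ gmax gen_g char0.
pose ext x := extset S (x : tens j V).
have subext : subspace ext.
  by split=> [|a x y ex ey]; [apply: extset0|apply: extsetD => //; apply: extsetZ].
pose image N (y : tens j Q) := exists x, N x /\ ext (tmap s y - x).
have sjL := tmap_linear (phi := j) sL.
have st_image N : tstable N -> stable (fun i => tmap (phi := j) (opQ i)) (image N).
  move=> [subN opN]; split.
    split=> [|a y y' [x [Nx Ex]] [x' [Nx' Ex']]].
      by exists 0; rewrite (lin0 sjL) subr0; split; apply: sub0.
    exists (a *: x + x'); split; first exact: subN.2.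
    by rewrite sjL opprD addrACA -scalerBr; apply: subext.2.
  move=> i y [x [Nx Ex]]; exists (tmap (op i) x); split; first exact: opN.
  have ijL := tmap_linear (phi := j) (opL i).
  have Eop : ext (tmap (op i) (tmap s y) - tmap s (tmap (opQ i) y)).
    move: (y); apply: tens_ind => [q a|y1 y2 E1 E2].
      by rewrite !tmap_pure // -pureBl; apply: extset_pure; apply: opQP.
    by rewrite !(tmapD sL, tmapD (opL i), tmapD (opQL i)) opprD addrACA; apply: (subD subext).
  have Eop' : ext (tmap (op i) (tmap s y) - tmap (op i) x).
    rewrite -(linB ijL); apply: tmap_extset Ex => //; exact: opS.
  have := subB subext Eop' Eop.
  by rewrite addrC opprB -addrA addKr.
exists (fun N => r (image N)) => N N' stN stN' NN'.
have imNN' y : image N y -> image N' y.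
  by move=> [x [Nx Ex]]; exists x; split=> //; apply: NN'.
have [le_r lt_r] := rP _ _ (st_image N stN) (st_image N' stN') imNN'.
split=> // le_r' x N'x Tx.
have [y Ey] : exists y, ext (x - tmap s y).
  apply: (extset_ind (P := fun x => exists y, ext (x - tmap s y))) Tx => [|v a Tv|].
  - by exists 0; rewrite (lin0 sjL) subr0; apply: extset0.
  - have [q [w [Sw vE]]] := dec v Tv; exists (pure j q a).
    rewrite tmap_pure // -pureBl vE addrAC subrr add0r; exact: extset_pure.
  move=> x1 x2 [y1 E1] [y2 E2]; exists (y1 + y2).
  by rewrite tmapD // opprD addrACA; apply: (subD subext).
have [|z [Nz Ez]] := lt_r le_r' y.
  by exists x; split=> //; rewrite -opprB; apply: (subN subext).
exists z; split=> //; have := subD subext Ey Ez.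
by rewrite addrA subrK.
Qed.

(** The ranks of the steps of a composition series add up: an element of N' is
    moved into N one step of the series at a time. *)
Lemma extension_rank m' (C : nat -> V -> Prop) :
  (forall x, C 0 x -> x = 0) -> (forall x, C m' x) ->
  (forall i, (i <= m')%N -> stable op (C i)) ->
  (forall i, (i < m')%N -> covers (stable op) (C i) (C i.+1)) ->
  exists r, is_rank tstable r.
Proof.
move=> C0 Cm stC covC.
have [r rP] := choice (fun i : 'I_m' => step_rank (stC i (ltnW (ltn_ord i)))
  (stC i.+1 (ltn_ord i)) (covC i (ltn_ord i))).
exists (fun N => \sum_i r i N)%N => N N' stN stN' NN'; split.
  by apply: leq_sum => i _; case: (rP i N N' stN stN' NN').
move=> le_r x N'x.
have le_ri := leq_sum_eq (fun i => (rP i N N' stN stN' NN').1) le_r.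
suff IH i : (i <= m')%N -> forall x, N' x -> extset (C i) x -> N x.
  by apply: (IH m') => //; exists (repr x); split=> //; apply: tens_sum.
elim: i => [_ y N'y|i IH lt_im y N'y Cy].
  apply: extset_ind => [|v r' /C0 ->|y1 y2]; [exact: (sub0 stN.1)| |exact: (subD stN.1)].
  by rewrite pure0; apply: (sub0 stN.1).
have [z [Nz Cyz]] := (rP (Ordinal lt_im) N N' stN stN' NN').2 (le_ri _) y N'y Cy.
rewrite -(subrK z y); apply: (subD stN.1) => //; apply: IH => //; first exact: ltnW.
by apply: (subB stN'.1) => //; apply: NN'.
Qed.

End ExtensionRank.

(** * Points *)

Lemma mxeval_natural (F : fieldType) (R S : comNzRingType)
    (phi : {rmorphism F -> R}) (psi : {rmorphism F -> S}) (h : {rmorphism R -> S})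
    n (p : {mpoly F[n * n]}) (g : 'M[R]_n) : h \o phi =1 psi ->
  mxeval psi p (map_mx h g) = h (mxeval phi p g).
Proof.
move=> hphi; rewrite /mxeval /mmap rmorph_sum; apply: eq_bigr => m _.
rewrite rmorphM -hphi /mmap1 rmorph_prod; congr (_ * _).
by apply: eq_bigr => i _; rewrite rmorphXn -map_mxvec mxE.
Qed.

Lemma points_natural (F : fieldType) (G : gl_scheme F) (R S : comNzRingType)
    (phi : {rmorphism F -> R}) (psi : {rmorphism F -> S}) (h : {rmorphism R -> S}) g :
  h \o phi =1 psi -> points G phi g -> points G psi (map_mx h g).
Proof.
move=> hphi [[g' gg'] g0]; split.
  by exists (map_mx h g'); rewrite -map_mxM gg' map_mx1.
by move=> p Gp; rewrite (mxeval_natural p g hphi) g0 ?rmorph0.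
Qed.

Lemma points_base_change (F F' : fieldType) (j : {rmorphism F -> F'})
    (G : gl_scheme F) (R : comNzRingType) (phi : {rmorphism F' -> R}) g :
  points (gl_base_change j G) phi g <-> points G (phi \o j : {rmorphism F -> R}) g.
Proof.
have ev p : mxeval phi (map_mpoly j p) g = mxeval (phi \o j : {rmorphism F -> R}) p g.
  rewrite /mxeval {1}/map_mpoly {2}/mmap rmorph_sum; apply: eq_bigr => m _.
  by rewrite rmorphM /= mmapC mmap1_id mmapX.
split=> -[inv g0]; split=> //.
  by move=> p Gp; rewrite -ev; apply: g0; exists p.
by move=> _ [p [Gp ->]]; rewrite ev; apply: g0.
Qed.

(** * Group actions as families of operators *)

Section GroupOperators.
Variables (F : fieldType) (G : gl_scheme F) (V : lmodType F).
Variable act : fun_action (gdim G) V.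

Record gpoint := GPoint {
  gp_ring : comNzRingType;
  gp_map : {rmorphism F -> gp_ring};
  gp_mx : 'M[gp_ring]_(gdim G);
  gp_mxP : points G gp_map gp_mx;
  gp_fun : alg_space gp_map -> F^o;
  gp_funL : linear gp_fun }.

(** The matrix coefficients of the action: contracting the R-factor of g x by
    all functionals on R loses no information about submodules. *)
Definition gp_op (p : gpoint) (x : V) : V :=
  contr (@gp_fun p) (@act (gp_ring p) (gp_map p) (gp_mx p) x).

Lemma group_stableP S : subspace S ->
  group_stable G act S <-> forall p x, S x -> S (gp_op p x).
Proof.
move=> subS; split=> [stS p x Sx|opS R phi g Gg x Sx].
  by apply: contr_extset => //; [apply: gp_funL|apply: stS Sx; apply: gp_mxP].
by apply: extsetP => // mu muL; apply: (opS (GPoint Gg muL)).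
Qed.

Definition act_linear : Prop :=
  forall (R : comNzRingType) (phi : {rmorphism F -> R}) g, points G phi g ->
  forall a x y, act phi g (a *: x + y) = phi a *: act phi g x + act phi g y.

Lemma gp_op_linear p : act_linear -> linear (gp_op p).
Proof.
move=> actL a x y; have muL := @gp_funL p; have Gp := @gp_mxP p.
by rewrite /gp_op actL // contrD // contrZ.
Qed.

End GroupOperators.

Definition gk_index (F : fieldType) (P : pair F) : Type :=
  (plie P + gpoint (pgrp P))%type.

Definition gk_op (F : fieldType) (P : pair F) (X : gkmod P) (i : gk_index P) :
    mcarrier X -> mcarrier X :=
  match i with inl u => mlie X u | inr p => gp_op (@mgrp F P X) p end.

(** Submodules are thus treated on the same footing for all pairs and after
    base change. *)
Lemma submoduleE (F : fieldType) (P : pair F) (X : gkmod P) :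
  @submodule F P X = stable (@gk_op F P X).
Proof.
apply: funext => S; apply: propext; split.
  move=> [subS lieS grpS]; split=> // -[u|p] x Sx; first exact: lieS.
  by have [/(_ grpS) opS _] := group_stableP (@mgrp F P X) subS; apply: opS.
move=> [subS opS]; split=> // [u x|]; first exact: (opS (inl u)).
by apply/group_stableP => // p x; apply: (opS (inr p)).
Qed.

Section FiniteLengthRank.
Variables (F : fieldType) (P : pair F) (X : gkmod P).
Hypothesis opL : forall i, linear (@gk_op F P X i).
Local Notation good := (stable (@gk_op F P X)).

Lemma finite_length_series : finite_length X <-> exists m C,
  [/\ forall i, (i <= m)%N -> good (C i), forall x, C 0%N x <-> x = 0,
      forall x, C m x & forall i, (i < m)%N -> covers good (C i) (C i.+1)].
Proof. by rewrite -submoduleE. Qed.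

Lemma rank_finite_length r : is_rank good r -> finite_length X.
Proof.
move=> rP; apply/finite_length_series.
have st0 : good (fun x => x = 0).
  split; last by move=> i _ ->; apply: (lin0 (opL i)).
  by split=> // a x y -> ->; rewrite scaler0 addr0.
have stT : good (fun=> True) by [].
have [m [C [C0 Cm stC covC]]] := rank_series rP st0 stT (fun _ _ => I).
by exists m, C; split=> // x; rewrite ?C0 ?Cm.
Qed.

Lemma finite_length_rank : finite_length X -> exists r, is_rank good r.
Proof.
move=> /finite_length_series[m [C [stC C0 Cm covC]]].
apply: (@series_rank _ good _ _ _ _ m C) => // [N N' [subN opN] [subN' opN']||||x /C0 //].
- split; last by move=> i x [Nx N'x]; split; [apply: opN|apply: opN'].
  split; first by split; apply: sub0.
  by move=> a x y [Nx N'x] [Ny N'y]; split; [apply: subN.2|apply: subN'.2].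
- move=> N N' [subN opN] [subN' opN']; split.
    split=> [|a _ _ [y [z [Ny N'z ->]]] [y' [z' [Ny' N'z' ->]]]].
      by exists 0, 0; rewrite addr0; split=> //; apply: sub0.
    exists (a *: y + y'), (a *: z + z'); rewrite scalerDr addrACA.
    by split=> //; [apply: subN.2|apply: subN'.2].
  move=> i _ [y [z [Ny N'z ->]]]; exists (@gk_op F P X i y), (@gk_op F P X i z).
  by rewrite (linD (opL i)); split=> //; [apply: opN|apply: opN'].
- by move=> N [subN _]; apply: sub0.
by move=> N x y [subN _]; apply: subB.
Qed.

End FiniteLengthRank.

(** * Base change *)

Section Bilext.
Variables (F : fieldType) (R : comNzRingType) (phi : {rmorphism F -> R}).
Variables (U V W : lmodType F) (b : U -> V -> W).
Hypothesis bB : bilin b.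

Lemma bilext_inner u r (y : tens phi V) :
  tlift (fun v s => pure phi (b u v) (r * s)) y = r *: tmap (b u) y.
Proof.
have buL := bB.2 u.
have bal : balanced phi (fun v s => pure phi (b u v) (r * s)).
  exact: (balanced_scale (tmap_balanced phi buL)).
move: y; apply: tens_eq => [x y|x y|v s]; first exact: tliftD.
  by rewrite tmapD // scalerDr.
by rewrite tlift_pure // tmap_pure // scale_pure.
Qed.

Lemma bilext_balanced (y : tens phi V) : balanced phi
  (fun u r => tlift (fun v s => pure phi (b u v) (r * s)) y).
Proof.
have buL u := bB.2 u; have bvL v := bB.1 v.
split=> [u u' r|u r s|a u r]; rewrite !bilext_inner.
- rewrite -scalerDr; congr (_ *: _).
  move: y; apply: tens_eq => [x y|x y|v s]; first exact: tmapD.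
    by rewrite !tmapD // addrACA.
  by rewrite !tmap_pure // -pureDl; congr (pure _ _ _); apply: (linD (bvL v)).
- exact: scalerDl.
rewrite mulrC -scalerA; congr (_ *: _).
move: y; apply: tens_eq => [x y|x y|v s]; first exact: tmapD.
  by rewrite tmapD // scalerDr.
by rewrite !tmap_pure // scale_pure -pureZ; congr (pure _ _ _); apply: (linZ (bvL v)).
Qed.

Lemma bilext_pure u r (y : tens phi V) : bilext b (pure phi u r) y = r *: tmap (b u) y.
Proof. by rewrite /bilext tlift_pure ?bilext_inner //; apply: bilext_balanced. Qed.

Lemma bilextDl x x' (y : tens phi V) :
  bilext b (x + x') y = bilext b x y + bilext b x' y.
Proof. exact: (tliftD _ _ (bilext_balanced y)). Qed.

Lemma bilext_linear (x : tens phi U) : linear (bilext b x).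
Proof.
move=> a y z; move: x; apply: tens_ind => [u r|x x' IHx IHx'].
  rewrite !bilext_pure (tmap_linear (bB.2 u)) scalerDr !scalerA.
  by rewrite [r * a]mulrC.
by rewrite !bilextDl IHx IHx' scalerDr addrACA.
Qed.

Lemma bilext_extset (S : V -> Prop) (T : W -> Prop) x (y : tens phi V) :
  (forall u v, S v -> T (b u v)) -> extset S y -> extset T (bilext b x y).
Proof.
move=> ST Sy; move: x; apply: tens_ind => [u r|x x' Tx Tx'].
  rewrite bilext_pure; apply: extsetZ; apply: tmap_extset Sy => [|v]; first exact: bB.2.
  exact: ST.
by rewrite bilextDl; apply: extsetD.
Qed.

End Bilext.

Section Assoc.
Variables (F F' : fieldType) (j : {rmorphism F -> F'}).
Variables (R : comNzRingType) (phi : {rmorphism F' -> R}) (V : lmodType F).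
Local Notation phij := (phi \o j : {rmorphism F -> R}).

Lemma tassoc_balanced :
  balanced phij (fun (v : V) r => pure phi (pure j v 1) r).
Proof.
split=> [v w r|v r s|a v r]; first by rewrite !pureDl.
  exact: pureDr.
by rewrite pureZ [pure j v _]pure_scale pureZ mulr1.
Qed.

Lemma tassoc_pure (v : V) r : tassoc (pure phij v r) = pure phi (pure j v 1) r.
Proof. by rewrite /tassoc tlift_pure //; apply: tassoc_balanced. Qed.

Lemma tassocD : {morph (@tassoc _ _ j _ phi V) : x y / x + y}.
Proof. by move=> x y; apply: tliftD; apply: tassoc_balanced. Qed.

Lemma tassoc_linear : linear (@tassoc _ _ j _ phi V : tens phij V -> tens phi (tens j V)).
Proof.
move=> a x y; rewrite tassocD; congr (_ + _); move: x {y}.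
apply: (@tens_eq _ _ _ _ _ (fun x => tassoc (a *: x)) (fun x => a *: tassoc x)).
- by move=> x y; rewrite scalerDr tassocD.
- by move=> x y; rewrite tassocD scalerDr.
by move=> v r; rewrite scale_pure !tassoc_pure scale_pure.
Qed.

Lemma tassoc_extset (S : V -> Prop) x :
  extset S x -> extset (extset S) (@tassoc _ _ j _ phi V x).
Proof.
move: x; apply: (extset_ind (P := fun x => extset (extset S) (tassoc x))) => [|v r Sv|y z].
- by rewrite (lin0 tassoc_linear); apply: extset0.
- by rewrite tassoc_pure; do 2!apply: extset_pure.
by rewrite tassocD; apply: extsetD.
Qed.

End Assoc.

Section ActionBaseChange.
Variables (F F' : fieldType) (j : {rmorphism F -> F'}) (G : gl_scheme F).
Variables (V : lmodType F) (act : fun_action (gdim G) V).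
Hypothesis actL : act_linear act.
Variables (R : comNzRingType) (phi : {rmorphism F' -> R}) (g : 'M[R]_(gdim G)).
Hypothesis Gg : points (gl_base_change j G) phi g.

Let Gg' : points G (phi \o j : {rmorphism F -> R}) g.
Proof. by have [H _] := @points_base_change F F' j G R phi g; apply: H. Qed.

Lemma act_base_change_balanced : balanced j
  (fun v c => phi c *: tassoc (act (phi \o j : {rmorphism F -> R}) g v)).
Proof.
have vL := actL Gg'.
split=> [v w r|v r s|a v r].
- by rewrite -[v in LHS]scale1r vL rmorph1 scale1r tassocD scalerDr.
- by rewrite rmorphD scalerDl.
have v0 : act (phi \o j : {rmorphism F -> R}) g 0 = 0.
  have := vL (-1) 0 0; rewrite scaleN1r oppr0 addr0 rmorphN1 scaleN1r.
  by rewrite addNr.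
rewrite -[a *: v]addr0 vL v0 addr0 (linZ (@tassoc_linear _ _ _ _ _ _)).
by rewrite scalerA rmorphM mulrC.
Qed.

Lemma act_base_change_pure v c : act_base_change act phi g (pure j v c)
  = phi c *: tassoc (act (phi \o j : {rmorphism F -> R}) g v).
Proof. by rewrite /act_base_change tlift_pure //; apply: act_base_change_balanced. Qed.

Lemma act_base_changeD :
  {morph (act_base_change act phi g : tens j V -> _) : x y / x + y}.
Proof. by move=> x y; apply: tliftD; apply: act_base_change_balanced. Qed.

Lemma act_base_change_linear a (x y : tens j V) : act_base_change act phi g (a *: x + y)
  = phi a *: act_base_change act phi g x + act_base_change act phi g y.
Proof.
rewrite act_base_changeD; congr (_ + _); move: x {y}.
apply: (@tens_eq _ _ _ _ _ (fun x => act_base_change act phi g (a *: x))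
  (fun x => phi a *: act_base_change act phi g x)).
- by move=> x y; rewrite scalerDr act_base_changeD.
- by move=> x y; rewrite act_base_changeD scalerDr.
by move=> v c; rewrite scale_pure !act_base_change_pure rmorphM scalerA.
Qed.

Lemma act_base_change_extset (S : V -> Prop) (x : tens j V) : group_stable G act S ->
  extset S x -> extset (extset S) (act_base_change act phi g x).
Proof.
move=> stS; move: x; apply: (extset_ind
  (P := fun x => extset (extset S) (act_base_change act phi g x))) => [|v c Sv|y z].
- by rewrite /act_base_change (tlift0 act_base_change_balanced); apply: extset0.
- by rewrite act_base_change_pure; apply/extsetZ/tassoc_extset; apply: stS.
by rewrite act_base_changeD; apply: extsetD.
Qed.

End ActionBaseChange.

(** * The algebra R (x) F' *)

Section TensorRing.
Variables (F F' : fieldType) (j : {rmorphism F -> F'}).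
Variables (R : comNzRingType) (phi : {rmorphism F -> R}).
Local Notation A := (alg_space phi).

Definition tring : Type := tens j A.
HB.instance Definition _ := GRing.Zmodule.on tring.

Definition alg_mul (r s : A) : A := (r : R) * s.

Lemma alg_mul_bilin : bilin alg_mul.
Proof.
split=> [s a r r'|r a s s']; rewrite /alg_mul.
  by rewrite [LHS]mulrDl alg_scaleE -mulrA.
by rewrite [LHS]mulrDr alg_scaleE mulrCA.
Qed.

Definition tmul (x y : tring) : tring := bilext alg_mul x y.

Lemma tmul_pure r c s d :
  tmul (pure j (r : A) c) (pure j (s : A) d) = pure j (alg_mul r s) (c * d).
Proof.
rewrite /tmul (bilext_pure alg_mul_bilin) tmap_pure; last exact: alg_mul_bilin.2.
by rewrite scale_pure.
Qed.

Lemma tmulDl : left_distributive tmul +%R.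
Proof. by move=> x y z; apply: (bilextDl alg_mul_bilin). Qed.

Lemma tmulDr : right_distributive tmul +%R.
Proof. by move=> x y z; apply: (linD (bilext_linear alg_mul_bilin x)). Qed.

Lemma tmulC : commutative tmul.
Proof.
move=> x y; move: x; apply: tens_ind => [r c|x x' IH IH']; last by rewrite tmulDl tmulDr IH IH'.
move: y; apply: tens_ind => [s d|y y' IH IH']; last by rewrite tmulDl tmulDr IH IH'.
by rewrite !tmul_pure mulrC; congr (pure _ _ _); apply: mulrC.
Qed.

Lemma tmulA : associative tmul.
Proof.
move=> x y z; move: x; apply: tens_ind => [r c|x x' IH IH']; last by rewrite !tmulDl IH IH'.
move: y; apply: tens_ind => [s d|y y' IH IH']; last by rewrite !(tmulDl, tmulDr) IH IH'.
move: z; apply: tens_ind => [t e|z z' IH IH']; last by rewrite !tmulDr IH IH'.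
by rewrite !tmul_pure mulrA; congr (pure _ _ _); apply: mulrA.
Qed.

Lemma tmul1 : left_id (pure j ((1 : R) : A) 1 : tring) tmul.
Proof.
apply: tens_ind => [r c|x x' IH IH']; last by rewrite tmulDr IH IH'.
by rewrite tmul_pure mul1r; congr (pure _ _ _); apply: mul1r.
Qed.

Definition tfun (mu : A -> F^o) (x : tring) : F' :=
  tlift (fun r c => j (mu r : F) * c) x.

Section TFun.
Variable mu : A -> F^o.
Hypothesis muL : linear mu.

Lemma tfun_balanced : balanced j (fun (r : A) c => j (mu r : F) * c).
Proof.
split=> [r s c|r c d|a r c]; first by rewrite (linD muL) rmorphD mulrDl.
  exact: mulrDr.
by rewrite (linZ muL) rmorphM mulrA [j (mu r) * _]mulrC.
Qed.

Lemma tfun_pure r c : tfun mu (pure j r c) = j (mu r : F) * c.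
Proof. by rewrite /tfun tlift_pure //; apply: tfun_balanced. Qed.

Lemma tfunD : {morph tfun mu : x y / x + y}.
Proof. by move=> x y; apply: tliftD; apply: tfun_balanced. Qed.

End TFun.

Lemma tring_one_neq0 : (pure j ((1 : R) : A) 1 : tring) != 0.
Proof.
have sub00 : subspace (fun x : A => x = 0).
  by split=> // a x y -> ->; rewrite scaler0 addr0.
have n1 : (1 : R) <> 0 by apply/eqP; apply: oner_neq0.
have [mu [muL _ mu1]] := functional_separation sub00 (n1 : ~ ((1 : R) : A) = 0).
apply/eqP => /(congr1 (tfun mu)); rewrite tfun_pure // mu1 rmorph1 mulr1.
rewrite /tfun (tlift0 (tfun_balanced muL)) => /eqP.
by rewrite oner_eq0.
Qed.

HB.instance Definition _ := GRing.Zmodule_isComNzRing.Build tring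
  tmulA tmulC tmul1 tmulDl tring_one_neq0.

Definition tring_inl (r : R) : tring := pure j (r : A) 1.
Definition tring_inr (c : F') : tring := pure j ((1 : R) : A) c.

Fact tring_inl_zmod : zmod_morphism tring_inl.
Proof. by move=> r s; apply: pureBl. Qed.
Fact tring_inl_monoid : monoid_morphism tring_inl.
Proof. by split=> // r s; rewrite [RHS]tmul_pure mulr1. Qed.
HB.instance Definition _ := GRing.isZmodMorphism.Build R tring tring_inl tring_inl_zmod.
HB.instance Definition _ := GRing.isMonoidMorphism.Build R tring tring_inl tring_inl_monoid.

Fact tring_inr_zmod : zmod_morphism tring_inr.
Proof. by move=> c d; apply: pureBr. Qed.
Fact tring_inr_monoid : monoid_morphism tring_inr.
Proof. by split=> // c d; rewrite [RHS]tmul_pure /alg_mul mulr1. Qed.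
HB.instance Definition _ := GRing.isZmodMorphism.Build F' tring tring_inr tring_inr_zmod.
HB.instance Definition _ := GRing.isMonoidMorphism.Build F' tring tring_inr tring_inr_monoid.

Lemma tring_square : tring_inl \o phi =1 tring_inr \o j.
Proof.
move=> a; rewrite /= /tring_inl /tring_inr -[j a]mulr1 -pureZ.
by congr (pure _ _ _); rewrite alg_scaleE mulr1.
Qed.

Lemma tring_scale c x : tring_inr c * x = (c *: (x : tens j A) : tens j A).
Proof.
rewrite [LHS](bilext_pure alg_mul_bilin); congr (_ *: _).
move: x; apply: tens_eq => [x y|//|r d].
  by apply: tmapD; apply: alg_mul_bilin.2.
rewrite tmap_pure; last exact: alg_mul_bilin.2.
by congr (pure _ _ _); apply: mul1r.
Qed.

Lemma tfun_linear mu : linear mu ->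
  linear (tfun mu : alg_space tring_inr -> F'^o).
Proof.
move=> muL c x y; rewrite [LHS](tfunD muL); congr (_ + _).
rewrite alg_scaleE tring_scale; move: x {y}.
apply: (@tens_eq _ _ _ _ _ (fun x => tfun mu (c *: x)) (fun x => c * tfun mu x)).
- by move=> x y; rewrite scalerDr tfunD.
- by move=> x y; rewrite tfunD // mulrDr.
by move=> r d; rewrite scale_pure !tfun_pure // mulrCA.
Qed.

End TensorRing.

(** * Submodules under base change *)

Section ModuleBaseChange.
Variables (F F' : fieldType) (j : {rmorphism F -> F'}) (P : pair F).
Variables (X : gkmod P) (gkX : is_gkmod X).
Local Notation Y := (gkmod_base_change j X).

Let actL : act_linear (@mgrp F P X) := ract_linear (gkmod_rational gkX).

Lemma gk_op_linear i : linear (@gk_op F P X i).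
Proof.
case: i => [u|p]; first exact: (gkmod_bilin gkX).2.
exact: gp_op_linear.
Qed.

Lemma gk_op_base_change_linear i : linear (@gk_op F' (pair_base_change j P) Y i).
Proof.
case: i => [u|p]; first exact: (bilext_linear (gkmod_bilin gkX)).
apply: gp_op_linear => R phi g Gg a x y.
exact: (act_base_change_linear actL Gg).
Qed.

Lemma extset_submodule N : submodule N -> @submodule F' (pair_base_change j P) Y (extset N).
Proof.
move=> [subN lieN grpN]; split.
- by split=> [|a x y Nx Ny]; [apply: extset0|apply: extsetD => //; apply: extsetZ].
- by move=> u x; apply: (bilext_extset (gkmod_bilin gkX)).
by move=> R phi g Gg x; apply: (act_base_change_extset actL Gg).
Qed.

(** A point g of G(R) also acts on X (x) F' through its image in
    G(R (x) F'); this recovers the operators of g over F. *)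
Lemma gp_op_tring (p : gpoint (pgrp P)) : exists p' : gpoint (gl_base_change j (pgrp P)),
  forall y : tens j (mcarrier X),
  gp_op (@mgrp _ _ Y) p' y = tmap (gp_op (@mgrp F P X) p) y.
Proof.
case: p => R phi g Gg mu muL.
pose psi := tring_inr j phi : {rmorphism F' -> tring j phi}.
have hsq : tring_inl j phi \o phi =1 (psi \o j : {rmorphism F -> tring j phi}).
  exact: tring_square.
have Gg' := points_natural hsq Gg.
have Gg'' : points (gl_base_change j (pgrp P)) psi (map_mx (tring_inl j phi) g).
  have [_ H] :=
    @points_base_change _ _ j (pgrp P) _ psi (map_mx (tring_inl j phi) g).
  exact: H.
have mu'L := tfun_linear (j := j) muL.
exists (GPoint Gg'' mu'L) => y.
have pL := gp_op_linear (GPoint Gg muL) actL.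
have p'L := gp_op_linear (GPoint Gg'' mu'L) (act_base_change_linear actL).
move: y; apply: tens_eq => [x y|x y|v c]; first exact: (linD p'L).
  exact: tmapD.
rewrite tmap_pure // /gp_op /=.
rewrite [X in contr _ X](act_base_change_pure actL Gg'') contrZ // [pure j _ c]pure_scale.
congr (_ *: _).
rewrite (ract_natural (gkmod_rational gkX) hsq Gg).
have pushP : balanced phi (fun (v : mcarrier X) r =>
    pure (psi \o j : {rmorphism F -> _}) v (tring_inl j phi r)).
  split=> [v1 v2 r|v1 r s|a v1 r]; first exact: pureDl.
    by rewrite rmorphD pureDr.
  by rewrite pureZ -hsq rmorphM.
move: (mgrp X phi g v) => t {v}; move: t.
apply: (@tens_eq _ _ _ _ _ (fun t => contr _ (tassoc (tpush _ _ t)))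
  (fun t => pure j (contr mu t) 1)) => [x y|x y|v r].
- by rewrite [tpush _ _ _](tliftD _ _ pushP) tassocD contrD.
- by rewrite contrD // pureDl.
rewrite [tpush _ _ _]tlift_pure // tassoc_pure !contr_pure // pureZ mulr1.
by rewrite [RHS]pure_scale [tfun _ _]tfun_pure // mulr1.
Qed.

Lemma submodule_tstable N : @submodule F' (pair_base_change j P) Y N ->
  stable (fun i => tmap (phi := j) (@gk_op F P X i)) N.
Proof.
rewrite submoduleE => -[subN opN]; split=> // -[u|p] x Nx.
  have := opN (inl (pure j u 1)) x Nx.
  by rewrite /= (bilext_pure (gkmod_bilin gkX)) scale1r.
have [p' <-] := gp_op_tring p.
exact: (opN (inr p')).
Qed.

End ModuleBaseChange.

(** * Finite generation over the Lie algebra *)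

Lemma subspace_fin_gen (F : fieldType) (V : lmodType F) n (e : 'I_n -> V) (S : V -> Prop) :
  subspace S -> (forall x, S x -> fspan e x) ->
  exists s : seq V, (forall y, y \in s -> S y) /\
    forall T, subspace T -> (forall y, y \in s -> T y) -> forall x, S x -> T x.
Proof.
elim: n e S => [|n IH] e S subS Se.
  exists [::]; split=> // T subT _ x /Se[c ->].
  by rewrite big_ord0; apply: sub0.
pose e' (i : 'I_n) := e (lift ord0 i).
pose S' x := S x /\ fspan e' x.
have subS' : subspace S'.
  split=> [|a x y [Sx ex] [Sy ey]]; first by split; [|apply: (sub0 (fspan_subspace _))]; apply: sub0.
  by split; [apply: subS.2|apply: (fspan_subspace e').2].
have [s [sS' sgen]] := IH e' S' subS' (fun x S'x => S'x.2).
have [[y [Sy [c [c0 yE]]]]|noy] := pselect (exists y, S y /\ exists c : F, c != 0 /\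
    fspan e' (y - c *: e ord0)).
  exists (y :: s); split=> [z|T subT sT x Sx].
    by rewrite inE => /orP[/eqP ->|/sS'[]].
  have [d xE] := Se x Sx.
  have xd : fspan e' (x - d ord0 *: e ord0).
    by exists (fun i => d (lift ord0 i)); rewrite xE big_ord_recl addrAC subrr add0r.
  rewrite -(subrK ((d ord0 / c) *: y) x); apply: (subD subT).
    apply: (sgen T) => //; first by move=> z zs; apply: sT; rewrite inE zs orbT.
    split; first by apply: subB => //; apply: subZ.
    have := subB (fspan_subspace e') xd (subZ (fspan_subspace e') (d ord0 / c) yE).
    by rewrite scalerBr scalerA divfK // opprB addrA subrK.
  by apply: (subZ subT); apply: sT; rewrite mem_head.
exists s; split=> [z /sS'[]//|T subT sT x Sx].
apply: (sgen T) => //; split=> //; have [d xE] := Se x Sx.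
have [d0|d0] := eqVneq (d ord0) 0.
  exists (fun i => d (lift ord0 i)).
  by rewrite xE big_ord_recl d0 scale0r add0r.
case: noy; exists x; split=> //; exists (d ord0); split=> //.
by exists (fun i => d (lift ord0 i)); rewrite xE big_ord_recl addrAC subrr add0r.
Qed.

Section FiniteGeneration.
Variables (F : fieldType) (P : pair F) (X : gkmod P) (gkX : is_gkmod X).
Variables (m : nat) (b : 'I_m -> plie P).
Hypothesis b_span : forall u, fspan b u.

Let k (l : 'I_m) : gk_index P := inl (b l).
Local Notation op := (@gk_op F P X).
Local Notation gen := (lie_gen op k).

Lemma lie_gen_lie s u y : gen s y -> gen s (mlie X u y).
Proof.
move=> sy; have [c ->] := b_span u.
have yL := (gkmod_bilin gkX).1 y.
rewrite (lin_sum (f := fun u => mlie X u y) yL).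
apply: (sub_sum (lie_gen_subspace op k s)) => l _.
rewrite (linZ (f := fun u => mlie X u y) yL).
apply: (subZ (lie_gen_subspace op k s)) => S subS Su Ss.
by apply: (Su l); apply: sy.
Qed.

(** The list s spans the K-submodule W generated by x, which is finite
    dimensional; by equivariance U(g) W is then K-stable as well. *)
Lemma fin_gen_lie x : exists s,
  [/\ forall S, stable op S -> S x -> forall y, y \in s -> S y,
      gen s x & forall i y, gen s y -> gen s (op i y)].
Proof.
pose gop (p : gpoint (pgrp P)) := gp_op (@mgrp F P X) p.
have actL : act_linear (@mgrp F P X) := ract_linear (gkmod_rational gkX).
have gopL p : linear (gop p) by apply: gp_op_linear.
pose W y := exists2 f, alg gop f & y = f x.
have stW : stable gop W := cyclic_stable gop x.
have [t [tx stt]] := gkmod_locally_finite gkX x.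
have tsub : subspace (lspan t) := fspan_subspace (fun i : 'I_(size t) => t`_i).
have Wt y : W y -> fspan (fun i : 'I_(size t) => t`_i) y.
  move=> [f Af ->]; apply: (alg_stable Af) (tx : lspan t x); split=> // p z.
  by have [/(_ stt) H _] := group_stableP (@mgrp F P X) tsub; apply: H.
have [s [sW sgen]] := subspace_fin_gen stW.1 Wt.
have gsub := lie_gen_subspace op k s.
have Wgen y : W y -> gen s y.
  by apply: sgen => // z zs S _ _; apply.
exists s; split.
- move=> S [subS opS] Sx y /sW[f Af ->]; apply: (alg_stable Af) Sx.
  by split=> // p z; apply: (opS (inr p)).
- by apply: Wgen; exists id => //; apply: alg_id.
case=> [u y sy|p y sy]; first exact: lie_gen_lie.
pose T y := gen s y /\ forall p, gen s (gop p y).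
suff : T y by case=> _; apply.
apply: sy.
- split=> [|a y1 y2 [s1 T1] [s2 T2]].
    by split=> [|q]; [exact: (sub0 gsub)|rewrite (lin0 (gopL q)); exact: (sub0 gsub)].
  split=> [|q]; first exact: gsub.2.
  by rewrite gopL; apply: gsub.2.
- move=> l z [sz Tz]; split=> [|q]; first exact: lie_gen_lie.
  rewrite /gop /gp_op /= (gkmod_equivariant gkX (@gp_mxP _ _ q)).
  apply: contr_extset => //; first exact: gp_funL.
  apply: (bilext_extset (gkmod_bilin gkX)) => [u v|]; first exact: lie_gen_lie.
  apply: extsetP => // mu muL.
  exact: (Tz (GPoint (@gp_mxP _ _ q) muL)).
move=> z zs; split=> [|q]; first exact: (Wgen _ (sW _ zs)).
exact: (Wgen _ (stW.2 _ _ (sW _ zs))).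
Qed.

End FiniteGeneration.

(** A basis of the Lie algebra turns its action into finitely many operators
    with structure constants, to which the rank of an extension applies. *)
Lemma finite_length_base_change (F : fieldType) (char0 : [pchar F] =i pred0)
    (P : pair F) (X : gkmod P) (gkX : is_gkmod X) (brP : is_lie_bracket (pbr P))
    (finP : exists s : seq (plie P), forall x, lspan s x)
    (F' : fieldType) (j : {rmorphism F -> F'}) :
  finite_length X -> finite_length (gkmod_base_change j X).
Proof.
have [s sP] := finP; pose b (i : 'I_(size s)) := s`_i.
have b_span u : fspan b u by exact: sP.
have [c cP] : exists c : 'I_(size s) -> 'I_(size s) -> 'I_(size s) -> F,
    forall i l, pbr P (b i) (b l) = \sum_h c i l h *: b h.
  have [c cP] := choice (fun il => b_span (pbr P (b il.1) (b il.2))).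
  by exists (fun i l => c (i, l)) => i l; apply: (cP (i, l)).
have opL := gk_op_linear gkX.
have bracket i l x : mlie X (b i) (mlie X (b l) x) - mlie X (b l) (mlie X (b i) x)
    = \sum_h c i l h *: mlie X (b h) x.
  have xL := (gkmod_bilin gkX).1 x.
  rewrite -(gkmod_br gkX) cP (lin_sum (f := fun u => mlie X u x) xL).
  by apply: eq_bigr => h _; rewrite (linZ (f := fun u => mlie X u x) xL).
move=> /finite_length_series[m [C [stC C0 Cm covC]]].
have [r rP] := extension_rank j opL (k := fun l => inl (b l)) bracket char0
  (fin_gen_lie gkX b_span) (fun x => (C0 x).1) Cm stC covC.
have rP' : is_rank (stable (@gk_op F' (pair_base_change j P) (gkmod_base_change j X))) r.
  rewrite -submoduleE => N N' /(submodule_tstable gkX) stN /(submodule_tstable gkX).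
  exact: rP.
exact: (rank_finite_length (gk_op_base_change_linear (j := j) gkX) rP').
Qed.

(** The rank of N (x) F' is a rank for N: a functional on F' that takes the
    value 1 at 1 maps N (x) F' back onto N. *)
Lemma finite_length_descent (F : fieldType) (P : pair F) (X : gkmod P)
    (gkX : is_gkmod X) (F' : fieldType) (j : {rmorphism F -> F'}) :
  finite_length (gkmod_base_change j X) -> finite_length X.
Proof.
move=> /(finite_length_rank (gk_op_base_change_linear (j := j) gkX))[r rP].
apply: (rank_finite_length (gk_op_linear gkX) (r := fun N => r (extset N))) => N N'.
rewrite -submoduleE => subN subN' NN'.
have st M : submodule M -> stable (@gk_op _ _ (gkmod_base_change j X)) (extset M).
  by move=> subM; rewrite -submoduleE; apply: extset_submodule.
have [le_r lt_r] := rP _ _ (st _ subN) (st _ subN') (fun x => extset_sub NN').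
split=> // /lt_r H x N'x; have [sN _ _] := subN.
have Ex : extset N (pure j x 1) by apply: H; apply: extset_pure.
have sub00 : subspace (fun y : alg_space j => y = 0).
  by split=> // a y z -> ->; rewrite scaler0 addr0.
have n1 : ~ ((1 : F') : alg_space j) = 0 by apply/eqP; apply: oner_neq0.
have [mu [muL _ mu1]] := functional_separation sub00 n1.
by have := contr_extset muL sN Ex; rewrite contr_pure // mu1 scale1r.
Qed.

Theorem corollary3p8 (F : fieldType) (hchar : [pchar F] =i pred0)
    (Fbar : closedFieldType) (iota : {rmorphism F -> Fbar})
    (hclosure : forall z : Fbar, algebraicOver iota z)
    (P : pair F) (hP : is_reductive_pair iota P)
    (hQ : condition_Q iota (pgrp P))
    (X : gkmod P) (hX : is_gkmod X) :
  (finite_length X <->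
     exists (F' : fieldType) (j : {rmorphism F -> F'}),
       finite_length (gkmod_base_change j X)) /\
  (finite_length X <->
     forall (F' : fieldType) (j : {rmorphism F -> F'}),
       finite_length (gkmod_base_change j X)).
Proof.
have pairP := reductive_is_pair hP.
have up (F' : fieldType) (j : {rmorphism F -> F'}) := finite_length_base_change hchar hX
  (pair_bracket pairP) (pair_finite_dim pairP) j.
split; split=> [fl|].
- by exists F, idfun; apply: up.
- by move=> [F' [j]]; apply: finite_length_descent.
- by move=> F' j; apply: up.
by move=> /(_ F idfun); apply: finite_length_descent.
Qed.
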